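(* Let $M$ be any one of the sets $$(B(\ell_2)\setminus\mathcal{K}(\ell_2))\cup\{0\}\subset B(\ell_2),\qquad (\ell_\infty\setminus c)\cup\{0\}\subset\ell_\infty,\qquad (B(\ell_2)\setminus\widetilde{\mathcal{K}}(\ell_2))\cup\{0\}\subset B(\ell_2),$$ and let $\mathfrak{c}=2^{\aleph_0}$. Then: (a) $M$ is $(d,1)$-genalgebrable and $(d,1)$-$C^*$-genalgebrable for every $d\in\mathbb{N}$; $(\mathfrak{c},\kappa)$-$C^*$-genalgebrable for every cardinal $1\le\kappa\le\mathfrak{c}$; $(\aleph_0,\kappa)$-genalgebrable for every cardinal $1\le\kappa\le\aleph_0$; and $(\kappa,\kappa)$-genalgebrable for every cardinal $\aleph_0<\kappa\le\mathfrak{c}$. (b) $M$ is $(d,n)$-algebrable and $(d,m)$-$C^*$-algebrable for all $d,m,n\in\mathbb{N}$ with $d\ge m$ and $d\ge n$; $(\mathfrak{c},\kappa)$-$C^*$-algebrable for every cardinal $1\le\kappa\le\mathfrak{c}$; $(\aleph_0,\kappa)$-algebrable for every cardinal $1\le\kappa\le\aleph_0$; and $(\kappa,\kappa)$-algebrable for every cardinal $\aleph_0<\kappa\le\mathfrak{c}$.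
   Context: $\ell_\infty$ is the $C^*$-algebra of bounded complex sequences, $c$ the convergent sequences; $B(\ell_2)$ is the algebra of bounded operators on the complex Hilbert space $\ell_2=\ell_2(\mathbb{N})$, $\mathcal{K}(\ell_2)$ the compact operators, and $\widetilde{\mathcal{K}}(\ell_2)=\mathcal{K}(\ell_2)\oplus\mathbb{C}1$, where $1$ is the identity operator. $\mathbb{N}=\{1,2,\dots\}$; $\dim$ is the algebraic (Hamel) dimension over $\mathbb{C}$. For a nonempty subset $S$ of an algebra, $A(S)$ denotes the linear span of all finite products $s_1\cdots s_n$ ($n\ge1$, $s_i\in S$). $S$ generates an algebra $B$ as an algebra if $S\subseteq B$ and $A(S)=B$. A nonempty set $S\subseteq B_{sa}=\{b\in B:b=b^*\}$ generates an abelian $C^*$-algebra $B$ as a $C^*$-algebra if $\overline{A(S)}=B$. Convention: for $C^*$-algebras and for self-adjoint ($*$-closed) subalgebras of $C^*$-algebras only generating sets consisting of self-adjoint elements are considered. $\mathrm{gen}(B)$ (respectively $\mathrm{gen}_{C^*}(B)$) is the least cardinality of a set generating $B$ as an algebra (respectively, as a $C^*$-algebra). A generating set is minimal if no proper subset of it generates (in the same sense). Let $\alpha,\beta$ be cardinals, $A$ a $C^*$-algebra and $M\subset A$. $M$ is $(\alpha,\beta)$-genalgebrable (respectively $(\alpha,\beta)$-algebrable) if there is a subalgebra $B$ of $A$ (not necessarily closed) with $B\subseteq M\cup\{0\}$, $\dim(B)=\alpha$ and $\mathrm{gen}(B)=\beta$ (respectively, $B$ has a minimal generating set as an algebra of cardinality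 $\beta$). $M$ is $(\alpha,\beta)$-$C^*$-genalgebrable (respectively $(\alpha,\beta)$-$C^*$-algebrable) if there is a $C^*$-subalgebra $B$ of $A$ with $B\subseteq M\cup\{0\}$, $\dim(B)=\alpha$ and $\mathrm{gen}_{C^*}(B)=\beta$ (respectively, $B$ has a minimal generating set as a $C^*$-algebra of cardinality $\beta$). *)

(* Defs.v *)
From HB Require Import structures.
From mathcomp Require Import all_boot all_order all_algebra.
From mathcomp Require Import complex.
From mathcomp Require Import all_classical all_reals all_analysis.
From mathcomp Require Import ring lra.

Set Implicit Arguments.
Unset Strict Implicit.
Unset Printing Implicit Defensive.

Import Order.TTheory GRing.Theory Num.Theory.
Import numFieldNormedType.Exports.

Local Open Scope classical_set_scope.
Local Open Scope complex_scope.
Local Open Scope ring_scope.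
Local Open Scope card_scope.

Definition norm_cauchy (R : realType) (V : zmodType) (N : V -> R)
    (u : nat -> V) :=
  forall e : R, 0 < e -> exists k, forall m n,
    (k <= m)%N -> (k <= n)%N -> N (u m - u n) < e.

Definition norm_cvg (R : realType) (V : zmodType) (N : V -> R)
    (u : nat -> V) (l : V) :=
  forall e : R, 0 < e -> exists k, forall n, (k <= n)%N -> N (u n - l) < e.

(* MathComp norms take their values in the scalar field; this is the real
   number behind the norm. *)
Definition rnorm (R : realType) (V : normedZmodType R[i]) (x : V) : R :=
  complex.Re `|x|.

Section RealNorm.
Context {R : realType}.

Section NormedZmod.
Context {V : normedZmodType R[i]}.
Implicit Types x y : V.

Lemma rnormE x : `|x| = (rnorm x)%:C.
Proof. by rewrite /rnorm RRe_real // ger0_real. Qed.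

Lemma rnorm_ge0 x : 0 <= rnorm x.
Proof. by rewrite -ler0c -rnormE. Qed.

Lemma rnormD x y : rnorm (x + y) <= rnorm x + rnorm y.
Proof. by rewrite -lecR rmorphD/= -!rnormE ler_normD. Qed.

Lemma rnorm0 : rnorm (0 : V) = 0.
Proof. by rewrite /rnorm normr0. Qed.

Lemma rnorm0_eq0 x : rnorm x = 0 -> x = 0.
Proof. by move=> x0; apply/normr0_eq0; rewrite rnormE x0. Qed.

Lemma rnormN x : rnorm (- x) = rnorm x.
Proof. by rewrite /rnorm normrN. Qed.

Lemma rnormB x y : rnorm (x - y) = rnorm (y - x).
Proof. by rewrite /rnorm distrC. Qed.

End NormedZmod.

Lemma rnormZ (V : normedModType R[i]) (a : R[i]) (x : V) :
  rnorm (a *: x) = rnorm a * rnorm x.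
Proof. by apply: complexI; rewrite rmorphM /= -!rnormE normrZ. Qed.

Lemma rnormM (a b : R[i]) : rnorm (a * b) = rnorm a * rnorm b.
Proof. by apply: complexI; rewrite rmorphM /= -!rnormE normrM. Qed.

Lemma rnorm_conj (a : R[i]) : rnorm a^* = rnorm a.
Proof. by rewrite /rnorm normcJ. Qed.

Lemma rnorm_real (a : R) : rnorm a%:C = `|a|.
Proof. by rewrite /rnorm normc_def /= expr0n addr0 sqrtr_sqr. Qed.

Lemma mul_conj (a : R[i]) : a * a^* = (rnorm a ^+ 2)%:C.
Proof. by rewrite -sqr_normc rnormE rmorphXn. Qed.

Lemma homogeneous_norm (V : lmodType R[i]) (N : V -> R) :
  (forall x, 0 <= N x) ->
  (forall (a : R[i]) x, N (a *: x) <= rnorm a * N x) ->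
  forall (a : R[i]) x, N (a *: x) = rnorm a * N x.
Proof.
move=> N0 le a x; apply/eqP; rewrite eq_le le/=.
have [->|a0] := eqVneq a 0; first by rewrite rnorm0 mul0r N0.
have a_gt0 : 0 < rnorm a.
  rewrite lt_neqAle rnorm_ge0 andbT eq_sym; apply: contra_neq a0.
  exact: rnorm0_eq0.
have aV : rnorm a^-1 = (rnorm a)^-1.
  apply: (mulfI (lt0r_neq0 a_gt0)); rewrite -rnormM (divff a0).
  by rewrite (divff (lt0r_neq0 a_gt0)) rnorm_real normr1.
have := le a^-1 (a *: x); rewrite scalerA mulVf// scale1r aV.
by rewrite mulrC ler_pdivlMr// mulrC.
Qed.

Lemma Re_le_rnorm (a : R[i]) : `|complex.Re a| <= rnorm a.
Proof. by rewrite -lecR -rnormE normc_ge_Re. Qed.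

Lemma Im_le_rnorm (a : R[i]) : `|complex.Im a| <= rnorm a.
Proof.
case: a => a b /=; rewrite /rnorm normc_def /= -sqrtr_sqr ler_sqrt.
  by rewrite lerDr sqr_ge0.
by rewrite addr_ge0 ?sqr_ge0.
Qed.

Lemma rnorm_le_ReIm (a : R[i]) :
  rnorm a <= `|complex.Re a| + `|complex.Im a|.
Proof.
rewrite -[a in rnorm a]/(a) {1}(complexE a) (le_trans (rnormD _ _))//.
rewrite rnormM !rnorm_real lerD2l ler_piMl//.
by rewrite /rnorm normc_def /= expr0n expr1n add0r sqrtr1.
Qed.

Lemma posc_real (e : R[i]) : 0 < e -> exists2 r : R, 0 < r & e = r%:C.
Proof.
move=> e0; exists (complex.Re e); last by rewrite RRe_real// gtr0_real.
by rewrite -ltcR RRe_real// gtr0_real.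
Qed.

Lemma cvg_rnorm (V : normedModType R[i]) (F : set_system V) (y : V) :
  Filter F -> (forall e : R, 0 < e -> F [set x | rnorm (y - x) <= e]) ->
  F --> y.
Proof.
move=> FF Fy; apply/cvgrPdist_le => e /posc_real[r r0 ->].
by apply: filterS (Fy _ r0) => x /=; rewrite rnormE lecR.
Qed.

Lemma complex_cvg_subproof (F : set_system (R[i]^o)) :
  ProperFilter F -> (forall e : R, 0 < e ->
    exists x0 : R[i]^o, F [set x | rnorm (x0 - x) < e]) ->
  exists y : R[i]^o, forall e : R, 0 < e -> F [set x | rnorm (y - x) <= e].
Proof.
move=> FF Fc.
have H (f : R[i] -> R) : (forall x y, f (x - y) = f x - f y) ->
    (forall x, `|f x| <= rnorm x) ->
    exists l : R, forall e : R, 0 < e -> F [set x | `|l - f x| <= e].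
  move=> fB fle; have : cauchy (f @ F).
    apply/cauchyP => e e0; have [x0 Fx0] := Fc _ e0.
    exists (f x0); apply: (@filterS _ F _ _ _ _ Fx0) => x /= xe.
    by have := le_lt_trans (fle _) xe; rewrite fB; apply.
  move/R_complete => /cvg_ex[l fl]; exists l => e e0.
  by move/cvgrPdist_le : fl => /(_ _ e0).
have [a Fa] := H _ (fun x y : R[i] => raddfB (@complex.Re R : Rcomplex R -> R) x y)
  Re_le_rnorm.
have [b Fb] := H _ (fun x y : R[i] => raddfB (@complex.Im R : Rcomplex R -> R) x y)
  Im_le_rnorm.
exists (a +i* b) => e e0.
have e2 : 0 < e / 2 by rewrite divr_gt0.
apply: filterS2 (Fa _ e2) (Fb _ e2) => -[x y] /= ax by_.
by rewrite (le_trans (rnorm_le_ReIm _))//= (splitr e) lerD.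
Qed.

Lemma complex_complete (u : nat -> R[i]) :
  norm_cauchy (@rnorm R R[i]) u -> exists l, norm_cvg (@rnorm R R[i]) u l.
Proof.
move=> uc; have [e e0|l ul] := @complex_cvg_subproof (u @ \oo) _.
  have [k uk] := uc _ e0; exists (u k); exists k => // n /= kn.
  exact: uk.
exists l => e e0; have [|k _ uk] := ul (e / 2); first by rewrite divr_gt0.
exists k => n /uk /= /le_lt_trans; rewrite rnormB; apply.
by rewrite ltr_pdivrMr// ltr_pMr// ltr1n.
Qed.

Lemma cvg_rnorm_le (V : normedModType R[i]) (u : nat -> V) (l : V) (r : R) :
  u @ \oo --> l -> (forall n, rnorm (u n) <= r) -> rnorm l <= r.
Proof.
move=> ul ur; apply/ler_addgt0Pr => e e0.
have /cvgrPdist_le/(_ e%:C) : u @ \oo --> l by [].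
rewrite ltcR => /(_ e0)[k _ /(_ k (leqnn k))] /=.
rewrite rnormE lecR => le; rewrite -(subrK (u k) l) addrC.
by rewrite (le_trans (rnormD _ _))// lerD.
Qed.

Lemma cvg_real_complex (u : nat -> R) (l : R) : u @ \oo --> l ->
  (fun n => (u n)%:C : R[i]^o) @ \oo --> (l%:C : R[i]^o).
Proof.
move=> ul; apply: cvg_rnorm => e e0.
move/cvgrPdist_le : ul => /(_ _ e0)[k _ uk]; exists k => // n /= kn.
by rewrite -raddfB rnorm_real uk.
Qed.

Lemma cvg_ReIm (u : nat -> R[i]) (a b : R) :
  (fun n => complex.Re (u n)) @ \oo --> a ->
  (fun n => complex.Im (u n)) @ \oo --> b ->
  (u : nat -> R[i]^o) @ \oo --> (a +i* b : R[i]^o).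
Proof.
move=> ua ub; apply: cvg_rnorm => e e0.
have e2 : 0 < e / 2 by rewrite divr_gt0.
move/cvgrPdist_le : ua => /(_ _ e2); move/cvgrPdist_le : ub => /(_ _ e2).
apply: filterS2 => n /= bn an.
rewrite (le_trans (rnorm_le_ReIm _))// (splitr e).
by move: an bn; case: (u n) => x y /= an bn; rewrite lerD.
Qed.

End RealNorm.

(* Ambient C*-algebras are unital; subalgebras below need not be. *)
HB.mixin Record isCstarAlgebra (R : realType) A & GRing.Algebra R[i] A := {
  cnorm : A -> R;
  star : A -> A;
  cnormD : forall x y : A, cnorm (x + y) <= cnorm x + cnorm y;
  cnormZ : forall (a : R[i]) (x : A), cnorm (a *: x) = rnorm a * cnorm x;
  cnorm0_eq0 : forall x : A, cnorm x = 0 -> x = 0;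
  cnormM : forall x y : A, cnorm (x * y) <= cnorm x * cnorm y;
  cnorm_complete : forall u : nat -> A,
    norm_cauchy cnorm u -> exists l, norm_cvg cnorm u l;
  star_semilinear : forall (a : R[i]) (x y : A),
    star (a *: x + y) = a^* *: star x + star y;
  starM : forall x y : A, star (x * y) = star y * star x;
  starK : involutive star;
  cnorm_starM : forall x : A, cnorm (star x * x) = cnorm x ^+ 2
}.

#[short(type="cstarAlgType")]
HB.structure Definition CstarAlgebra (R : realType) :=
  {A of GRing.Algebra R[i] A & isCstarAlgebra R A}.

(* The library has no join of its algebras with its metric spaces, so the
   norm topology of a C*-algebra lives on an alias of the carrier. *)
Definition normTopology (R : realType) (A : cstarAlgType R) : Type := A.

Section NormTopology.
Context {R : realType} {A : cstarAlgType R}.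
Implicit Types x y z : A.

Lemma cnorm0 : cnorm (0 : A) = 0.
Proof. by rewrite -(scale0r (0 : A)) cnormZ rnorm0 mul0r. Qed.

Lemma cnormN x : cnorm (- x) = cnorm x.
Proof. by rewrite -scaleN1r cnormZ rnormN /rnorm normr1 mul1r. Qed.

Let mdist_subproof x y := cnorm (x - y).

Let mdistxx_subproof x : mdist_subproof x x = 0.
Proof. by rewrite /mdist_subproof subrr cnorm0. Qed.

Let mdist_positivity_subproof x y : mdist_subproof x y = 0 -> x = y.
Proof. by move=> /cnorm0_eq0/eqP; rewrite subr_eq0 => /eqP. Qed.

Let mdist_sym_subproof x y : mdist_subproof x y = mdist_subproof y x.
Proof. by rewrite /mdist_subproof -opprB cnormN. Qed.

Let mdist_triangle_subproof y x z :
  mdist_subproof x z <= mdist_subproof x y + mdist_subproof y z.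
Proof. by rewrite /mdist_subproof -(subrKA y) cnormD. Qed.

HB.instance Definition _ := Choice.on (normTopology A).
HB.instance Definition _ := @isMetric.Build R (normTopology A) mdist_subproof
  mdistxx_subproof mdist_positivity_subproof mdist_sym_subproof
  mdist_triangle_subproof.

End NormTopology.

Section Generation.
Context {R : realType} {A : cstarAlgType R}.
Implicit Types S B E M : set A.

Definition linear_span S : set A :=
  [set x | exists n (a : 'I_n -> R[i]) (s : 'I_n -> A),
    (forall i, S (s i)) /\ x = \sum_i a i *: s i].

Definition finite_products S : set A :=
  [set x | exists l : seq A,
    [/\ l <> [::], forall s, s \in l -> S s & x = \prod_(s <- l) s]].

Definition alg_span S : set A := linear_span (finite_products S).

Definition linearly_independent E : Prop :=
  forall n (a : 'I_n -> R[i]) (e : 'I_n -> A),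
    injective e -> (forall i, E (e i)) -> \sum_i a i *: e i = 0 ->
    forall i, a i = 0.

(* Not required to contain the unit of [A], nor to be closed. *)
Definition subalgebra B : Prop :=
  [/\ B 0, forall (a : R[i]) x y, B x -> B y -> B (a *: x + y)
    & forall x y, B x -> B y -> B (x * y)].

Definition star_closed B : Prop := forall x, B x -> B (star x).

Definition Cstar_subalgebra B : Prop :=
  [/\ subalgebra B, star_closed B & @closed (normTopology A) B].

Definition self_adjoint : set A := [set x | star x = x].

(* Generating sets of *-closed subalgebras consist of self-adjoint elements;
   those of other subalgebras are arbitrary. *)
Definition alg_generates B S : Prop :=
  [/\ S !=set0, S `<=` B, star_closed B -> S `<=` self_adjoint
    & alg_span S = B].

Definition Cstar_generates B S : Prop :=
  [/\ S !=set0, S `<=` B `&` self_adjoint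
    & @closure (normTopology A) (alg_span S) = B].

(* Cardinals are represented by sets, compared by [#=] and [#<=]. *)
Definition has_dim (T : Type) B (alpha : set T) : Prop :=
  exists E, [/\ linearly_independent E, linear_span E = B & E #= alpha].

Definition least_card (T : Type) (gens : set A -> Prop) (beta : set T) : Prop :=
  (exists2 S, gens S & S #= beta) /\ (forall S, gens S -> beta #<= S).

Definition minimal_of_card (T : Type) (gens : set A -> Prop) (beta : set T) :
    Prop :=
  exists S, [/\ gens S, forall S', S' `<` S -> ~ gens S' & S #= beta].

Definition genalgebrable (T U : Type) (alpha : set T) (beta : set U) M : Prop :=
  exists B, [/\ subalgebra B, B `<=` M `|` [set 0], has_dim B alpha
              & least_card (alg_generates B) beta].

Definition algebrable (T U : Type) (alpha : set T) (beta : set U) M : Prop :=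
  exists B, [/\ subalgebra B, B `<=` M `|` [set 0], has_dim B alpha
              & minimal_of_card (alg_generates B) beta].

Definition Cstar_genalgebrable (T U : Type) (alpha : set T) (beta : set U) M :
    Prop :=
  exists B, [/\ Cstar_subalgebra B, B `<=` M `|` [set 0], has_dim B alpha
              & least_card (Cstar_generates B) beta].

Definition Cstar_algebrable (T U : Type) (alpha : set T) (beta : set U) M :
    Prop :=
  exists B, [/\ Cstar_subalgebra B, B `<=` M `|` [set 0], has_dim B alpha
              & minimal_of_card (Cstar_generates B) beta].

End Generation.

Definition card_lt (T U : Type) (A : set T) (B : set U) : bool :=
  (A #<= B) && ~~ (B #<= A).

Definition aleph0 : set nat := [set: nat].

Definition continuum : set (set nat) := [set: set nat].

Section Linfty.
Context {R : realType}.

Definition bounded_seq (x : nat -> R[i]) : Prop :=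
  exists M : R, forall n, rnorm (x n) <= M.

Definition linfty_pred : {pred nat -> R[i]} := fun x => `[< bounded_seq x >].

Record linfty := Linfty {
  linfty_val :> nat -> R[i];
  _ : linfty_val \in linfty_pred }.

HB.instance Definition _ := [isSub for linfty_val].
HB.instance Definition _ := [Choice of linfty by <:].

Lemma linfty_submod : submod_closed linfty_pred.
Proof.
split; first by rewrite inE; exists 0 => n; rewrite rnorm0.
move=> a x y; rewrite !inE => -[M xM] [N yN]; exists (rnorm a * M + N) => n.
rewrite (le_trans (rnormD _ _))// lerD// rnormM ler_wpM2l ?rnorm_ge0//.
Qed.

HB.instance Definition _ :=
  GRing.isSubmodClosed.Build R[i] (nat -> R[i]) linfty_pred linfty_submod.
HB.instance Definition _ := [SubChoice_isSubLmodule of linfty by <:].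

Lemma linftyP (x : linfty) : bounded_seq x.
Proof. by have := valP x; rewrite inE. Qed.

Lemma bounded1 : (cst 1 : nat -> R[i]) \in linfty_pred.
Proof. by rewrite inE; exists 1 => n; rewrite rnorm_real normr1. Qed.

Lemma boundedM (x y : linfty) : (fun n => x n * y n) \in linfty_pred.
Proof.
rewrite inE; have [[M xM] [N yN]] := (linftyP x, linftyP y).
by exists (M * N) => n; rewrite rnormM ler_pM ?rnorm_ge0.
Qed.

Lemma bounded_conj (x : linfty) : (fun n => (x n)^*) \in linfty_pred.
Proof.
by rewrite inE; have [M xM] := linftyP x; exists M => n; rewrite rnorm_conj.
Qed.

Definition linfty_one := Linfty bounded1.
Definition linfty_mul x y := Linfty (boundedM x y).
Definition linfty_star x := Linfty (bounded_conj x).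
Definition linfty_norm (x : linfty) : R := sup (range (fun n => rnorm (x n))).

Lemma linftyE (x y : linfty) : (forall n, x n = y n) -> x = y.
Proof. by move=> xy; apply/val_inj/funext. Qed.

Lemma linfty_mulA : associative linfty_mul.
Proof. by move=> x y z; apply: linftyE => n /=; rewrite mulrA. Qed.

Lemma linfty_mul1 : left_id linfty_one linfty_mul.
Proof. by move=> x; apply: linftyE => n /=; rewrite mul1r. Qed.

Lemma linfty_1mul : right_id linfty_one linfty_mul.
Proof. by move=> x; apply: linftyE => n /=; rewrite mulr1. Qed.

Lemma linfty_mulDl : left_distributive linfty_mul +%R.
Proof. by move=> x y z; apply: linftyE => n /=; rewrite mulrDl. Qed.

Lemma linfty_mulDr : right_distributive linfty_mul +%R.
Proof. by move=> x y z; apply: linftyE => n /=; rewrite mulrDr. Qed.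

Lemma linfty_one_neq0 : linfty_one != 0.
Proof.
apply/eqP => /(congr1 (fun x : linfty => x 0%N)) /eqP /=.
by rewrite oner_eq0.
Qed.

HB.instance Definition _ := GRing.Zmodule_isNzRing.Build linfty
  linfty_mulA linfty_mul1 linfty_1mul linfty_mulDl linfty_mulDr
  linfty_one_neq0.

Lemma linfty_scaleAl (a : R[i]) (x y : linfty) : a *: (x * y) = (a *: x) * y.
Proof. by apply: linftyE => n; exact: mulrA. Qed.

HB.instance Definition _ :=
  GRing.Lmodule_isLalgebra.Build R[i] linfty linfty_scaleAl.

Lemma linfty_scaleAr (a : R[i]) (x y : linfty) : a *: (x * y) = x * (a *: y).
Proof. by apply: linftyE => n; exact: mulrCA. Qed.

HB.instance Definition _ :=
  GRing.Lalgebra_isAlgebra.Build R[i] linfty linfty_scaleAr.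

Lemma le_linfty_norm (x : linfty) n : rnorm (x n) <= linfty_norm x.
Proof.
apply: ub_le_sup; last by exists n.
by have [M xM] := linftyP x; exists M => _ [m _ <-].
Qed.

Lemma linfty_norm_le (x : linfty) r :
  (forall n, rnorm (x n) <= r) -> linfty_norm x <= r.
Proof.
by move=> xr; apply: ge_sup => [|_ [m _ <-]//]; exists (rnorm (x 0%N)), 0%N.
Qed.

Lemma linfty_norm_ge0 x : 0 <= linfty_norm x.
Proof. exact: le_trans (rnorm_ge0 _) (le_linfty_norm x 0%N). Qed.

Lemma linfty_normD x y : linfty_norm (x + y) <= linfty_norm x + linfty_norm y.
Proof.
apply: linfty_norm_le => n; rewrite (le_trans (rnormD _ _))//.
by rewrite lerD ?le_linfty_norm.
Qed.

Lemma linfty_normZ (a : R[i]) x : linfty_norm (a *: x) = rnorm a * linfty_norm x.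
Proof.
apply: homogeneous_norm => [|b y]; first exact: linfty_norm_ge0.
apply: linfty_norm_le => n.
by rewrite [_ n](_ : _ = b * y n)// rnormM ler_wpM2l ?rnorm_ge0 ?le_linfty_norm.
Qed.

Lemma linfty_norm0_eq0 x : linfty_norm x = 0 -> x = 0.
Proof.
move=> x0; apply: linftyE => n; apply: rnorm0_eq0; apply/eqP.
by rewrite eq_le rnorm_ge0 andbT -x0 le_linfty_norm.
Qed.

Lemma linfty_normM x y : linfty_norm (x * y) <= linfty_norm x * linfty_norm y.
Proof.
apply: linfty_norm_le => n /=.
by rewrite rnormM ler_pM ?rnorm_ge0 ?le_linfty_norm.
Qed.

Lemma linfty_complete (u : nat -> linfty) :
  norm_cauchy linfty_norm u -> exists l, norm_cvg linfty_norm u l.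
Proof.
move=> uc.
have unc n : norm_cauchy (@rnorm R R[i]) (fun k => u k n).
  move=> e /uc[k uk]; exists k => m p km kp.
  exact: le_lt_trans (le_linfty_norm (u m - u p) n) (uk _ _ km kp).
have [l ul] := choice (fun n => complex_complete (unc n)).
have near (e : R) : 0 < e -> exists k, forall m, (k <= m)%N ->
    forall n, rnorm (u m n - l n) <= e.
  move=> e0; have [k uk] := uc _ e0; exists k => m km n.
  apply/ler_addgt0Pr => d d0; have [p up] := ul n _ d0.
  rewrite -(subrKA (u (maxn k p) n)) (le_trans (rnormD _ _))// lerD//.
    apply: le_trans (le_linfty_norm (u m - u (maxn k p)) n) (ltW _).
    by apply: uk; rewrite ?leq_maxl.
  by rewrite ltW// up// leq_maxr.
have lb : l \in linfty_pred.
  rewrite inE; have [k /(_ k (leqnn k)) uk] := near 1 ltr01.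
  exists (linfty_norm (u k) + 1) => n; rewrite -(subrK (u k n) (l n)) addrC.
  by rewrite (le_trans (rnormD _ _))// lerD ?le_linfty_norm// rnormB.
exists (Linfty lb) => e e0; have [|k uk] := near (e / 2).
  by rewrite divr_gt0.
exists k => n kn; apply: (@le_lt_trans _ _ (e / 2)).
  by apply: linfty_norm_le => i; exact: uk.
by rewrite ltr_pdivrMr// ltr_pMr// ltr1n.
Qed.

Lemma linfty_star_semilinear (a : R[i]) (x y : linfty) :
  linfty_star (a *: x + y) = a^* *: linfty_star x + linfty_star y.
Proof. by apply: linftyE => n /=; rewrite rmorphD rmorphM. Qed.

Lemma linfty_starM (x y : linfty) :
  linfty_star (x * y) = linfty_star y * linfty_star x.
Proof. by apply: linftyE => n /=; rewrite rmorphM mulrC. Qed.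

Lemma linfty_starK : involutive linfty_star.
Proof. by move=> x; apply: linftyE => n /=; rewrite conjCK. Qed.

Lemma linfty_norm_starM (x : linfty) :
  linfty_norm (linfty_star x * x) = linfty_norm x ^+ 2.
Proof.
apply/eqP; rewrite eq_le; apply/andP; split.
  rewrite expr2 (le_trans (linfty_normM _ _))// ler_wpM2r ?linfty_norm_ge0//.
  by apply: linfty_norm_le => n /=; rewrite rnorm_conj le_linfty_norm.
rewrite -[leRHS]sqr_sqrtr ?linfty_norm_ge0// ler_sqr ?nnegrE ?sqrtr_ge0//.
  apply: linfty_norm_le => n; rewrite -(ger0_norm (rnorm_ge0 (x n))).
  rewrite -sqrtr_sqr ler_sqrt ?linfty_norm_ge0//.
  apply: le_trans (le_linfty_norm _ n) => /=.
  by rewrite rnormM rnorm_conj.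
exact: linfty_norm_ge0.
Qed.

HB.instance Definition _ := isCstarAlgebra.Build R linfty linfty_normD
  linfty_normZ linfty_norm0_eq0 linfty_normM linfty_complete
  linfty_star_semilinear linfty_starM linfty_starK linfty_norm_starM.

End Linfty.

Arguments linfty R : clear implicits.

Section FiniteMinkowski.
Context {R : realType}.
Implicit Types a b : nat -> R.

Lemma finite_cauchy_schwarz a b n :
  (forall k, 0 <= a k) -> (forall k, 0 <= b k) ->
  \sum_(0 <= k < n) a k * b k <=
  Num.sqrt (\sum_(0 <= k < n) a k ^+ 2) *
  Num.sqrt (\sum_(0 <= k < n) b k ^+ 2).
Proof.
move=> a0 b0; elim: n => [|n IHn]; first by rewrite !big_geq// sqrtr0 mul0r.
rewrite !big_nat_recr//=.
set s := \sum_(0 <= k < n) a k ^+ 2; set t := \sum_(0 <= k < n) b k ^+ 2.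
have s0 : 0 <= s by apply: sumr_ge0 => k _; rewrite sqr_ge0.
have t0 : 0 <= t by apply: sumr_ge0 => k _; rewrite sqr_ge0.
apply: (@le_trans _ _ (Num.sqrt s * Num.sqrt t + a n * b n)).
  by rewrite lerD2r.
have sE := sqr_sqrtr s0; have tE := sqr_sqrtr t0.
have ps : 0 <= Num.sqrt s by rewrite sqrtr_ge0.
have pt : 0 <= Num.sqrt t by rewrite sqrtr_ge0.
rewrite -[leRHS]sqrtrM ?addr_ge0 ?sqr_ge0// -[leLHS]ger0_norm; last first.
  by rewrite addr_ge0 ?mulr_ge0.
rewrite -sqrtr_sqr ler_sqrt; last by rewrite mulr_ge0 ?addr_ge0 ?sqr_ge0.
rewrite -{2}sE -{2}tE.
move: (Num.sqrt s) (Num.sqrt t) (a n) (b n) => p q x y.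
have : 0 <= (p * y - q * x) ^+ 2 by rewrite sqr_ge0.
nra.
Qed.

Lemma finite_minkowski a b n :
  (forall k, 0 <= a k) -> (forall k, 0 <= b k) ->
  Num.sqrt (\sum_(0 <= k < n) (a k + b k) ^+ 2) <=
  Num.sqrt (\sum_(0 <= k < n) a k ^+ 2) +
  Num.sqrt (\sum_(0 <= k < n) b k ^+ 2).
Proof.
move=> a0 b0; have := finite_cauchy_schwarz n a0 b0.
set s := \sum_(0 <= k < n) a k ^+ 2; set t := \sum_(0 <= k < n) b k ^+ 2.
have s0 : 0 <= s by apply: sumr_ge0 => k _; rewrite sqr_ge0.
have t0 : 0 <= t by apply: sumr_ge0 => k _; rewrite sqr_ge0.
have -> : \sum_(0 <= k < n) (a k + b k) ^+ 2 =
    s + (\sum_(0 <= k < n) a k * b k) *+ 2 + t.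
  rewrite -sumrMnl -!big_split/=; apply: eq_bigr => k _.
  by rewrite sqrrD.
move: (\sum_(0 <= k < n) a k * b k) => c cst.
rewrite -[leRHS]ger0_norm ?addr_ge0 ?sqrtr_ge0// -sqrtr_sqr ler_sqrt ?sqr_ge0//.
rewrite sqrrD !sqr_sqrtr// lerD2r lerD2l.
by rewrite lerMn2r.
Qed.

End FiniteMinkowski.

Section EllTwo.
Context {R : realType}.

Definition square_summable (x : nat -> R[i]) : Prop :=
  cvgn (series (fun n => rnorm (x n) ^+ 2)).

Definition ell2_pred : {pred nat -> R[i]} := fun x => `[< square_summable x >].

(* Sequences are indexed from 0. *)
Record ell2 := Ell2 {
  ell2_val :> nat -> R[i];
  _ : ell2_val \in ell2_pred }.

HB.instance Definition _ := [isSub for ell2_val].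
HB.instance Definition _ := [Choice of ell2 by <:].

Definition partial_norm (x : nat -> R[i]) n : R :=
  Num.sqrt (\sum_(0 <= k < n) rnorm (x k) ^+ 2).

Lemma sum_sqr_ge0 (x : nat -> R[i]) n :
  0 <= \sum_(0 <= k < n) rnorm (x k) ^+ 2.
Proof. by apply: sumr_ge0 => k _; rewrite sqr_ge0. Qed.

Lemma partial_normD (x y : nat -> R[i]) n :
  partial_norm (x + y) n <= partial_norm x n + partial_norm y n.
Proof.
apply: le_trans (finite_minkowski n (fun k => rnorm_ge0 (x k))
  (fun k => rnorm_ge0 (y k))).
rewrite ler_sqrt; last by apply: sumr_ge0 => k _; rewrite sqr_ge0.
apply: ler_sum => k _; rewrite lerXn2r ?nnegrE ?addr_ge0 ?rnorm_ge0//.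
exact: rnormD.
Qed.

Lemma partial_normZ (a : R[i]) x n :
  partial_norm (a *: x) n = rnorm a * partial_norm x n.
Proof.
rewrite /partial_norm -[in RHS](ger0_norm (rnorm_ge0 a)) -sqrtr_sqr.
rewrite -sqrtrM ?sqr_ge0// mulr_sumr; congr Num.sqrt; apply: eq_bigr => k _.
by rewrite [(a *: x) k](_ : _ = a * x k)// rnormM exprMn.
Qed.

Lemma coord_le_partial_norm x n : rnorm (x n) <= partial_norm x n.+1.
Proof.
rewrite -[leLHS](ger0_norm (rnorm_ge0 _)) -sqrtr_sqr ler_sqrt ?sum_sqr_ge0//.
by rewrite big_nat_recr//= lerDr sum_sqr_ge0.
Qed.

Lemma partial_norm_le_sum x n :
  partial_norm x n <= \sum_(0 <= k < n) rnorm (x k).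
Proof.
have s0 m : 0 <= \sum_(0 <= k < m) rnorm (x k).
  by apply: sumr_ge0 => k _; rewrite rnorm_ge0.
rewrite -(ger0_norm (s0 n)) -sqrtr_sqr ler_sqrt ?sqr_ge0//.
elim: n => [|n IHn]; first by rewrite !big_geq// expr0n.
rewrite !big_nat_recr//= sqrrD -addrA lerD// lerDr.
by rewrite mulrn_wge0// mulr_ge0 ?rnorm_ge0.
Qed.

Lemma series_sqr_nd (x : nat -> R[i]) :
  nondecreasing_seq (series (fun n => rnorm (x n) ^+ 2)).
Proof. by apply: nondecreasing_series => n _ _; rewrite sqr_ge0. Qed.

Lemma square_summable_of_partial (x : nat -> R[i]) r :
  (forall n, partial_norm x n <= r) -> square_summable x.
Proof.
move=> xr; apply: nondecreasing_is_cvgn; first exact: series_sqr_nd.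
exists (r ^+ 2) => _ [n _ <-]; rewrite /series/= -(sqr_sqrtr (sum_sqr_ge0 x n)).
by rewrite lerXn2r ?nnegrE ?sqrtr_ge0// (le_trans _ (xr n)) ?sqrtr_ge0.
Qed.

Definition ell2_norm (x : nat -> R[i]) : R :=
  Num.sqrt (limn (series (fun n => rnorm (x n) ^+ 2))).

Lemma partial_norm_le (x : nat -> R[i]) n :
  square_summable x -> partial_norm x n <= ell2_norm x.
Proof.
move=> xs; have := nondecreasing_cvgn_le (series_sqr_nd x) xs n => le.
by rewrite ler_sqrt// (le_trans _ le)// sum_sqr_ge0.
Qed.

Lemma ell2_norm_le (x : nat -> R[i]) r :
  (forall n, partial_norm x n <= r) -> ell2_norm x <= r.
Proof.
move=> xr; have r0 : 0 <= r by rewrite (le_trans _ (xr 0%N)) ?sqrtr_ge0.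
rewrite -(ger0_norm r0) -sqrtr_sqr ler_sqrt ?sqr_ge0//.
apply: limr_le; first exact: square_summable_of_partial xr.
near=> n; rewrite /series/= -(sqr_sqrtr (sum_sqr_ge0 x n)).
by rewrite lerXn2r ?nnegrE ?sqrtr_ge0// xr.
Unshelve. all: by end_near. Qed.

Lemma ell2_norm_ge0 x : 0 <= ell2_norm x.
Proof. exact: sqrtr_ge0. Qed.

Lemma ell2_submod : submod_closed ell2_pred.
Proof.
split.
  rewrite inE; apply: (@square_summable_of_partial _ 0) => n.
  by rewrite /partial_norm big1 ?sqrtr0// => k _; rewrite rnorm0 expr0n.
move=> a x y; rewrite !inE => xs ys.
apply: (@square_summable_of_partial _
  (rnorm a * ell2_norm x + ell2_norm y)) => n.
rewrite (le_trans (partial_normD _ _ _))// lerD ?partial_norm_le//.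
by rewrite partial_normZ ler_wpM2l ?rnorm_ge0// partial_norm_le.
Qed.

HB.instance Definition _ :=
  GRing.isSubmodClosed.Build R[i] (nat -> R[i]) ell2_pred ell2_submod.
HB.instance Definition _ := [SubChoice_isSubLmodule of ell2 by <:].

Implicit Types x y z : ell2.

Lemma ell2P x : square_summable x.
Proof. by have := valP x; rewrite inE. Qed.

Lemma ell2E x y : (forall n, x n = y n) -> x = y.
Proof. by move=> xy; apply/val_inj/funext. Qed.

Lemma coord_le_ell2_norm x n : rnorm (x n) <= ell2_norm x.
Proof.
by rewrite (le_trans (coord_le_partial_norm _ _))// partial_norm_le//; exact: ell2P.
Qed.

Let normC x : R[i] := (ell2_norm x)%:C.

Let normC_D x y : normC (x + y) <= normC x + normC y.
Proof.
rewrite /normC -rmorphD lecR; apply: ell2_norm_le => n.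
by rewrite (le_trans (partial_normD _ _ _))// lerD ?partial_norm_le//; exact: ell2P.
Qed.

Let normC_Z (a : R[i]) x : normC (a *: x) = `|a| * normC x.
Proof.
rewrite /normC rnormE -rmorphM; congr real_complex_def.
apply: (@homogeneous_norm R ell2 (fun x => ell2_norm x)) => [y|b y].
  exact: ell2_norm_ge0.
apply: ell2_norm_le => n; rewrite partial_normZ.
by rewrite ler_wpM2l ?rnorm_ge0// partial_norm_le//; exact: ell2P.
Qed.

Let normC_0_eq0 x : normC x = 0 -> x = 0.
Proof.
move=> /complexI x0; apply: ell2E => n; apply: rnorm0_eq0; apply/eqP.
by rewrite eq_le rnorm_ge0 andbT -x0 coord_le_ell2_norm.
Qed.

HB.instance Definition _ :=
  Lmodule_isNormed.Build R[i] ell2 normC_D normC_Z normC_0_eq0.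

Lemma rnorm_ell2 x : rnorm x = ell2_norm x.
Proof. by apply: complexI; rewrite -rnormE. Qed.

Lemma partial_norm_rnorm x n : partial_norm x n <= rnorm x.
Proof. by rewrite rnorm_ell2 partial_norm_le//; exact: ell2P. Qed.

Lemma rnorm_ell2_le x r : (forall n, partial_norm x n <= r) -> rnorm x <= r.
Proof. by rewrite rnorm_ell2; exact: ell2_norm_le. Qed.

Lemma coord_le_rnorm x n : rnorm (x n) <= rnorm x.
Proof. by rewrite rnorm_ell2 coord_le_ell2_norm. Qed.

Lemma ell2_complete (u : nat -> ell2) :
  norm_cauchy (@rnorm R ell2) u -> exists l, norm_cvg (@rnorm R ell2) u l.
Proof.
move=> uc.
have unc n : norm_cauchy (@rnorm R R[i]) (fun k => u k n).
  move=> e /uc[k uk]; exists k => m p km kp.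
  exact: le_lt_trans (coord_le_rnorm (u m - u p) n) (uk _ _ km kp).
have [l ul] := choice (fun n => complex_complete (unc n)).
have near (e : R) : 0 < e -> exists k, forall m, (k <= m)%N ->
    forall n, partial_norm (\val (u m) - l) n <= e.
  move=> e0; have [k uk] := uc _ e0; exists k => m km n.
  apply/ler_addgt0Pr => d d0.
  have dn : 0 < d / n.+1%:R by rewrite divr_gt0// ltr0Sn.
  have [p up] := choice (fun i => ul i _ dn).
  pose q := maxn k (\max_(i < n) p i).
  have uq i : (i < n)%N -> rnorm (u q i - l i) <= d / n.+1%:R.
    move=> ni; apply/ltW/up; rewrite leq_max.
    by rewrite (leq_bigmax (Ordinal ni)) orbT.
  rewrite -(subrKA (\val (u q)) (\val (u m))) (le_trans (partial_normD _ _ _))//.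
  rewrite lerD//.
    apply: le_trans (partial_norm_rnorm (u m - u q) n) (ltW _).
    by apply: uk; rewrite ?leq_maxl.
  rewrite (le_trans (partial_norm_le_sum _ _))// big_mkord.
  apply: (@le_trans _ _ (\sum_(i < n) d / n.+1%:R)).
    by apply: ler_sum => i _; exact: uq.
  rewrite sumr_const card_ord -[leLHS]mulr_natr mulrAC ler_pdivrMr ?ltr0Sn//.
  by rewrite ler_wpM2l ?(ltW d0)// ler_nat.
have ls : l \in ell2_pred.
  rewrite inE; have [k /(_ k (leqnn k)) uk] := near 1 ltr01.
  apply: (@square_summable_of_partial _ (rnorm (u k) + 1)) => n.
  rewrite -(subrK (\val (u k)) l) addrC (le_trans (partial_normD _ _ _))//.
  rewrite lerD ?partial_norm_rnorm// -opprB -scaleN1r partial_normZ.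
  by rewrite rnormN /rnorm normr1 mul1r.
exists (Ell2 ls) => e e0; have [|k uk] := near (e / 2).
  by rewrite divr_gt0.
exists k => n kn; apply: (@le_lt_trans _ _ (e / 2)).
  by apply: rnorm_ell2_le => i; exact: uk.
by rewrite ltr_pdivrMr// ltr_pMr// ltr1n.
Qed.

End EllTwo.

Arguments ell2 R : clear implicits.

Section InnerProduct.
Context {R : realType}.

Definition inner (x y : nat -> R[i]) : R[i] :=
  limn (series (fun n => x n * (y n)^*) : nat -> R[i]^o).

Lemma series_ReE (z : nat -> R[i]) n :
  complex.Re (series z n) = series (fun n => complex.Re (z n)) n.
Proof.
by rewrite /series /=; apply: (big_morph (@complex.Re R)) => // -[? ?] [? ?].
Qed.

Lemma series_ImE (z : nat -> R[i]) n :
  complex.Im (series z n) = series (fun n => complex.Im (z n)) n.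
Proof.
by rewrite /series /=; apply: (big_morph (@complex.Im R)) => // -[? ?] [? ?].
Qed.

Lemma dominated_cvg (z : nat -> R[i]) (v : nat -> R) :
  cvgn (series v) -> (forall n, rnorm (z n) <= v n) ->
  cvgn (series z : nat -> R[i]^o).
Proof.
move=> vc zv.
have H (f : R[i] -> R) : (forall x, `|f x| <= rnorm x) ->
    cvgn (series (fun n => f (z n))).
  move=> fle; apply: normed_cvg; apply: series_le_cvg vc => //= n.
    exact: le_trans (rnorm_ge0 _) (zv n).
  exact: le_trans (fle _) (zv n).
have /cvg_ex[a za] := H _ Re_le_rnorm.
have /cvg_ex[b zb] := H _ Im_le_rnorm.
apply/cvg_ex; exists (a +i* b); apply: cvg_ReIm.
  by rewrite (_ : (fun n => _) = series (fun n => complex.Re (z n)))//;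
     apply/funext => n; exact: series_ReE.
by rewrite (_ : (fun n => _) = series (fun n => complex.Im (z n)))//;
   apply/funext => n; exact: series_ImE.
Qed.

Implicit Types x y z : ell2 R.

Lemma inner_cvg x y :
  (series (fun n => x n * (y n)^*) : nat -> R[i]^o) @ \oo --> (inner x y : R[i]^o).
Proof.
apply: (@dominated_cvg _ (fun n => rnorm (x n) ^+ 2 + rnorm (y n) ^+ 2)).
  by apply: is_cvg_seriesD; exact: ell2P.
move=> n; rewrite rnormM rnorm_conj.
have := rnorm_ge0 (x n); have := rnorm_ge0 (y n).
move: (rnorm (x n)) (rnorm (y n)) => a b a0 b0.
have : 0 <= (a - b) ^+ 2 by rewrite sqr_ge0.
nra.
Qed.

Lemma inner_unique x y (l : R[i]) :
  (series (fun n => x n * (y n)^*) : nat -> R[i]^o) @ \oo --> (l : R[i]^o) ->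
  inner x y = l.
Proof. by apply: (@cvg_lim (R[i]^o)); exact: norm_hausdorff. Qed.

Lemma inner_linear_l (a : R[i]) x y z :
  inner (a *: x + y) z = a * inner x z + inner y z.
Proof.
apply: inner_unique.
rewrite (_ : series _ = (fun n => a *:
    (series (fun n => x n * (z n)^*) n : R[i]^o) +
    (series (fun n => y n * (z n)^*) n : R[i]^o))).
  by apply: cvgD; [apply: cvgZr|]; exact: inner_cvg.
apply/funext => n; transitivity (a * series (fun n => x n * (z n)^*) n +
  series (fun n => y n * (z n)^*) n) => //.
rewrite /series /= mulr_sumr -big_split /=.
by apply: eq_bigr => k _; rewrite mulrDl mulrA.
Qed.

Lemma inner_conj x y : inner y x = (inner x y)^*.
Proof.
apply: inner_unique; apply: cvg_rnorm => e e0.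
have /cvgrPdist_le/(_ e%:C) := @inner_cvg x y.
rewrite ltcR => /(_ e0); apply: filterS => n /=.
rewrite rnormE lecR; congr (_ <= _); rewrite -[LHS]rnorm_conj rmorphB/=.
congr (rnorm (_ - _)); rewrite /series /= rmorph_sum/=.
by apply: eq_bigr => k _; rewrite rmorphM/= conjCK mulrC.
Qed.

Lemma inner_linear_r (a : R[i]) x y z :
  inner z (a *: x + y) = a^* * inner z x + inner z y.
Proof.
by rewrite inner_conj inner_linear_l rmorphD rmorphM/= -!inner_conj.
Qed.

Lemma innerBl x y z : inner (x - y) z = inner x z - inner y z.
Proof.
have := inner_linear_l (-1) y x z.
by rewrite scaleN1r mulN1r addrC [RHS]addrC.
Qed.

Lemma cauchy_schwarz x y : rnorm (inner x y) <= rnorm x * rnorm y.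
Proof.
apply: cvg_rnorm_le (@inner_cvg x y) _ => n.
apply: (@le_trans _ _ (\sum_(0 <= k < n) rnorm (x k) * rnorm (y k))).
  rewrite /series /=; elim: n => [|n IHn]; first by rewrite !big_geq// rnorm0.
  rewrite !big_nat_recr//= (le_trans (rnormD _ _))// lerD//.
  by rewrite rnormM rnorm_conj.
apply: le_trans (finite_cauchy_schwarz n (fun k => rnorm_ge0 (x k))
  (fun k => rnorm_ge0 (y k))) _.
by rewrite ler_pM ?sqrtr_ge0//; exact: partial_norm_rnorm.
Qed.

Lemma inner_self x : inner x x = (rnorm x ^+ 2)%:C.
Proof.
have S0 : 0 <= limn (series (fun n => rnorm (x n) ^+ 2)).
  have le := nondecreasing_cvgn_le (series_sqr_nd x) (@ell2P R x) 0%N.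
  by rewrite (le_trans _ le)// sum_sqr_ge0.
apply: inner_unique; rewrite rnorm_ell2 /ell2_norm sqr_sqrtr//.
rewrite (_ : series _ = (fun n => (series (fun n => rnorm (x n) ^+ 2) n)%:C)).
  by apply: cvg_real_complex; exact: ell2P.
apply/funext => n; rewrite /series/= rmorph_sum.
by apply: eq_bigr => k _; rewrite mul_conj.
Qed.

Lemma basis_subproof k : (fun n => (n == k)%:R : R[i]) \in @ell2_pred R.
Proof.
rewrite inE; apply: (@square_summable_of_partial _ _ 1) => n.
rewrite (le_trans (partial_norm_le_sum _ _))//.
suff -> : \sum_(0 <= j < n) rnorm ((j == k)%:R : R[i]) = (k < n)%:R.
  by case: (k < n)%N.
elim: n => [|n IHn]; first by rewrite big_geq.
rewrite big_nat_recr//= IHn ltnS [(k <= n)%N]leq_eqVlt.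
case: (eqVneq n k) => [->|nk] /=; last by rewrite rnorm0 addr0.
by rewrite ltnn add0r /rnorm normr1.
Qed.

Definition basis k : ell2 R := Ell2 (basis_subproof k).

Lemma inner_basis_r x k : inner x (basis k) = x k.
Proof.
apply: inner_unique; apply: cvg_rnorm => e e0; exists k.+1 => // n /= kn.
suff -> : series (fun n => x n * ((n == k)%:R)^*) n = x k.
  by rewrite subrr rnorm0 ltW.
rewrite /series /=.
suff -> : forall m, \sum_(0 <= j < m) x j * ((j == k)%:R)^* =
    if (k < m)%N then x k else 0 by rewrite kn.
elim=> [|m IHm]; first by rewrite big_geq.
rewrite big_nat_recr//= IHm ltnS [(k <= m)%N]leq_eqVlt.
case: (eqVneq m k) => [->|mk] /=; last by rewrite conjC0 mulr0 addr0.
by rewrite ltnn conjC1 mulr1 add0r.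
Qed.

Lemma inner_inj y z : (forall x, inner x y = inner x z) -> y = z.
Proof.
move=> yz; apply: ell2E => n; rewrite -!inner_basis_r.
by rewrite inner_conj yz -inner_conj.
Qed.

Definition truncation x n : ell2 R := \sum_(0 <= k < n) x k *: basis k.

Lemma truncationE x n k : truncation x n k = if (k < n)%N then x k else 0.
Proof.
rewrite /truncation; elim: n => [|n IHn]; first by rewrite big_geq.
rewrite big_nat_recr//= [LHS](_ : _ = (\sum_(0 <= k < n) x k *: basis k) k +
  x n * (k == n)%:R)// IHn ltnS [(k <= n)%N]leq_eqVlt.
case: (eqVneq k n) => [->|kn] /=; last by rewrite mulr0 addr0.
by rewrite ltnn mulr1 add0r.
Qed.

Lemma truncation_cvg x (e : R) : 0 < e ->
  exists n, rnorm (x - truncation x n) <= e.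
Proof.
move=> e0; have e2 : 0 < e ^+ 2 by rewrite exprn_gt0.
have /cvgrPdist_le/(_ _ e2)[n _ /(_ n (leqnn n))/=] := @ell2P R x.
set S := limn _ => Sn; exists n; apply: rnorm_ell2_le => m.
rewrite -[leRHS](ger0_norm (ltW e0)) -sqrtr_sqr ler_sqrt ?sqr_ge0//.
apply: le_trans (le_trans (ler_norm _) Sn); rewrite lerBrDr.
have -> : \sum_(0 <= k < m) rnorm ((x - truncation x n) k) ^+ 2 =
    \sum_(0 <= k < m) if (k < n)%N then 0 else rnorm (x k) ^+ 2.
  apply: eq_bigr => k _; rewrite [(x - _) k](_ : _ = x k - truncation x n k)//.
  by rewrite truncationE; case: ifP; rewrite ?subr0// subrr rnorm0 expr0n.
have le := nondecreasing_cvgn_le (series_sqr_nd x) (@ell2P R x) (maxn n m).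
rewrite (le_trans _ le)// /series /=.
have -> : \sum_(0 <= k < n) rnorm (x k) ^+ 2 =
    \sum_(0 <= k < maxn n m) if (k < n)%N then rnorm (x k) ^+ 2 else 0.
  rewrite [RHS](big_cat_nat _ (leq_maxl n m))//= [X in _ + X]big_nat_cond.
  rewrite [X in _ + X]big1 ?addr0; last first.
    by move=> k /andP[/andP[nk _] _]; rewrite ltnNge nk.
  by apply: eq_big_nat => k /andP[_ ->].
apply: (@le_trans _ _ (
    \sum_(0 <= k < maxn n m) (if (k < n)%N then 0 else rnorm (x k) ^+ 2) +
    \sum_(0 <= k < maxn n m) if (k < n)%N then rnorm (x k) ^+ 2 else 0)).
  rewrite lerD2r [leRHS](big_cat_nat _ (leq_maxr n m))//= lerDl.
  by apply: sumr_ge0 => k _; case: ifP => // _; rewrite sqr_ge0.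
rewrite -big_split /=; apply: ler_sum => k _.
by case: ifP; rewrite ?addr0 ?add0r.
Qed.

End InnerProduct.

Section BoundedOperators.
Context {R : realType}.
Implicit Types x y z : ell2 R.

Definition bounded_operator (f : ell2 R -> ell2 R) : Prop :=
  linear f /\ exists M : R, forall x, rnorm (f x) <= M * rnorm x.

Definition bop_pred : {pred ell2 R -> ell2 R} :=
  fun f => `[< bounded_operator f >].

Record bop := Bop {
  bop_val :> ell2 R -> ell2 R;
  _ : bop_val \in bop_pred }.

HB.instance Definition _ := [isSub for bop_val].
HB.instance Definition _ := [Choice of bop by <:].

Lemma bop_submod : submod_closed bop_pred.
Proof.
split.
  rewrite inE; split=> [a x y|]; first by rewrite scaler0 addr0.
  by exists 0 => x; rewrite rnorm0 mul0r.
move=> a f g; rewrite !inE => -[fl [M fM]] [gl [N gN]]; split.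
  move=> b x y; rewrite [LHS](_ : _ = a *: f (b *: x + y) + g (b *: x + y))//.
  rewrite fl gl [RHS](_ : _ = b *: (a *: f x + g x) + (a *: f y + g y))//.
  by rewrite !scalerDr !scalerA (mulrC b) addrACA.
exists (rnorm a * M + N) => x.
rewrite (le_trans (rnormD _ _))// mulrDl lerD// rnormZ -mulrA.
by rewrite ler_wpM2l ?rnorm_ge0.
Qed.

HB.instance Definition _ :=
  GRing.isSubmodClosed.Build R[i] (ell2 R -> ell2 R) bop_pred bop_submod.
HB.instance Definition _ := [SubChoice_isSubLmodule of bop by <:].

Implicit Types S T U : bop.

Lemma bopP T : bounded_operator T.
Proof. by have := valP T; rewrite inE. Qed.

Lemma bop_linear T : linear T.
Proof. by have [] := bopP T. Qed.

Lemma bopE S T : (forall x, S x = T x) -> S = T.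
Proof. by move=> ST; apply/val_inj/funext. Qed.

Lemma bop0 T : T 0 = 0.
Proof.
have := bop_linear T (-1) 0 0; rewrite scaler0 addr0 => ->.
by rewrite scaleN1r addNr.
Qed.

Lemma bopD T x y : T (x + y) = T x + T y.
Proof. by rewrite -[x in LHS]scale1r bop_linear scale1r. Qed.

Lemma bopZ T (a : R[i]) x : T (a *: x) = a *: T x.
Proof. by rewrite -[a *: x]addr0 bop_linear bop0 addr0. Qed.

Lemma bopB T x y : T (x - y) = T x - T y.
Proof. by rewrite addrC -scaleN1r bop_linear scaleN1r addrC. Qed.

Lemma bop1_subproof : (id : ell2 R -> ell2 R) \in bop_pred.
Proof. by rewrite inE; split=> //; exists 1 => x; rewrite mul1r. Qed.

Lemma bopM_subproof S T : (S \o T : ell2 R -> ell2 R) \in bop_pred.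
Proof.
rewrite inE; split=> [a x y|] /=; first by rewrite !bop_linear.
have [[_ [M SM]] [_ [N TN]]] := (bopP S, bopP T).
exists (`|M| * N) => x /=; rewrite (le_trans (SM _))//.
rewrite (@le_trans _ _ (`|M| * rnorm (T x)))//.
  by rewrite ler_wpM2r ?rnorm_ge0 ?ler_norm.
by rewrite -mulrA ler_wpM2l.
Qed.

Definition bop_one := Bop bop1_subproof.
Definition bop_mul S T := Bop (bopM_subproof S T).

Lemma bop_mulA : associative bop_mul.
Proof. by move=> S T U; exact: bopE. Qed.

Lemma bop_mul1 : left_id bop_one bop_mul.
Proof. by move=> S; exact: bopE. Qed.

Lemma bop_1mul : right_id bop_one bop_mul.
Proof. by move=> S; exact: bopE. Qed.

Lemma bop_mulDl : left_distributive bop_mul +%R.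
Proof. by move=> S T U; exact: bopE. Qed.

Lemma bop_mulDr : right_distributive bop_mul +%R.
Proof. by move=> S T U; apply: bopE => x; exact: (bopD S (T x) (U x)). Qed.

Lemma bop_one_neq0 : bop_one != 0.
Proof.
apply/eqP => T0; have := congr1 (fun T : bop => T (basis 0%N) 0%N) T0.
rewrite [X in X = _ -> _](_ : _ = 1)// [X in _ = X -> _](_ : _ = 0)//.
by move/eqP; rewrite oner_eq0.
Qed.

HB.instance Definition _ := GRing.Zmodule_isNzRing.Build bop
  bop_mulA bop_mul1 bop_1mul bop_mulDl bop_mulDr bop_one_neq0.

Lemma bop_scaleAl (a : R[i]) S T : a *: (S * T) = (a *: S) * T.
Proof. exact: bopE. Qed.

HB.instance Definition _ := GRing.Lmodule_isLalgebra.Build R[i] bop bop_scaleAl.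

Lemma bop_scaleAr (a : R[i]) S T : a *: (S * T) = S * (a *: T).
Proof. by apply: bopE => x; exact: esym (bopZ S a (T x)). Qed.

HB.instance Definition _ := GRing.Lalgebra_isAlgebra.Build R[i] bop bop_scaleAr.

Definition bop_norm (T : bop) : R :=
  sup [set rnorm (T x) | x in [set x | rnorm x <= 1]].

Lemma bop_norm_unit T x : rnorm x <= 1 -> rnorm (T x) <= bop_norm T.
Proof.
move=> x1; apply: ub_le_sup; last by exists x.
have [_ [M TM]] := bopP T; exists `|M| => _ [y y1 <-].
rewrite (le_trans (TM y))// (@le_trans _ _ (`|M| * rnorm y))//.
  by rewrite ler_wpM2r ?rnorm_ge0 ?ler_norm.
by rewrite ler_piMr.
Qed.

Lemma bop_norm_le T r :
  (forall x, rnorm x <= 1 -> rnorm (T x) <= r) -> bop_norm T <= r.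
Proof.
move=> Tr; apply: ge_sup => [|_ [x x1 <-]]; last exact: Tr.
by exists (rnorm (T 0)), 0 => //=; rewrite rnorm0.
Qed.

Lemma bop_norm_ge0 T : 0 <= bop_norm T.
Proof.
by rewrite (le_trans (rnorm_ge0 (T 0)))// bop_norm_unit// rnorm0.
Qed.

Lemma le_bop_norm T x : rnorm (T x) <= bop_norm T * rnorm x.
Proof.
have [->|x0] := eqVneq x 0; first by rewrite bop0 !rnorm0 mulr0.
have x_gt0 : 0 < rnorm x.
  rewrite lt_neqAle rnorm_ge0 andbT eq_sym; apply: contra_neq x0.
  exact: rnorm0_eq0.
have r1 : rnorm ((rnorm x)^-1%:C : R[i]) = (rnorm x)^-1.
  by rewrite rnorm_real ger0_norm// invr_ge0 ltW.
have := @bop_norm_unit T (((rnorm x)^-1)%:C *: x).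
rewrite bopZ !rnormZ r1 mulVf ?gt_eqF// => /(_ (lexx _)).
by rewrite mulrC ler_pdivrMr.
Qed.

Lemma bop_norm_le_bound T r : 0 <= r ->
  (forall x, rnorm (T x) <= r * rnorm x) -> bop_norm T <= r.
Proof.
move=> r0 Tr; apply: bop_norm_le => x x1; rewrite (le_trans (Tr x))//.
by rewrite ler_piMr.
Qed.

Lemma bop_normD S T : bop_norm (S + T) <= bop_norm S + bop_norm T.
Proof.
apply: bop_norm_le => x x1; apply: le_trans (rnormD (S x) (T x)) _.
by apply: lerD; exact: bop_norm_unit.
Qed.

Lemma bop_normZ (a : R[i]) T : bop_norm (a *: T) = rnorm a * bop_norm T.
Proof.
apply: homogeneous_norm => [|b S]; first exact: bop_norm_ge0.
apply: bop_norm_le => x x1; rewrite [_ x](_ : _ = b *: S x)//.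
by rewrite rnormZ; apply: ler_wpM2l; [exact: rnorm_ge0|exact: bop_norm_unit].
Qed.

Lemma bop_norm0_eq0 T : bop_norm T = 0 -> T = 0.
Proof.
move=> T0; apply: bopE => x; apply: rnorm0_eq0; apply/eqP.
by rewrite eq_le rnorm_ge0 andbT (le_trans (le_bop_norm T x))// T0 mul0r.
Qed.

Lemma bop_normM S T : bop_norm (S * T) <= bop_norm S * bop_norm T.
Proof.
apply: bop_norm_le => x x1; apply: le_trans (le_bop_norm S (T x)) _.
by apply: ler_wpM2l; [exact: bop_norm_ge0|exact: bop_norm_unit].
Qed.

Lemma bop_complete (u : nat -> bop) :
  norm_cauchy bop_norm u -> exists l, norm_cvg bop_norm u l.
Proof.
move=> uc.
have uxc x : norm_cauchy (@rnorm R (ell2 R)) (fun k => u k x).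
  move=> e e0; have x1 : 0 < rnorm x + 1 by rewrite ltr_wpDl ?rnorm_ge0.
  have [k uk] := uc _ (divr_gt0 e0 x1); exists k => m n km kn.
  apply: le_lt_trans (le_bop_norm (u m - u n) x) _.
  apply: (@le_lt_trans _ _ (e / (rnorm x + 1) * rnorm x)).
    by rewrite ler_wpM2r ?rnorm_ge0// ltW// uk.
  by rewrite mulrAC ltr_pdivrMr// ltr_pM2l// ltrDl.
have [l ul] := choice (fun x => ell2_complete (uxc x)).
have near (e : R) : 0 < e -> exists k, forall m, (k <= m)%N ->
    forall x, rnorm (u m x - l x) <= e * rnorm x.
  move=> e0; have [k uk] := uc _ e0; exists k => m km x.
  apply/ler_addgt0Pr => d d0; have [p up] := ul x _ d0.
  rewrite -(subrKA (u (maxn k p) x)) (le_trans (rnormD _ _))// lerD//.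
    apply: le_trans (le_bop_norm (u m - u (maxn k p)) x) _.
    by rewrite ler_wpM2r ?rnorm_ge0// ltW// uk ?leq_maxl.
  by rewrite ltW// up// leq_maxr.
have lb : l \in bop_pred.
  rewrite inE; split=> [a x y|].
    apply/subr0_eq/rnorm0_eq0/eqP; rewrite eq_le rnorm_ge0 andbT.
    apply/ler_addgt0Pr => e e0; rewrite add0r.
    have d0 : 0 < e / (rnorm a + 2).
      by rewrite divr_gt0// ltr_wpDl ?rnorm_ge0.
    have [[[p up] [q uq]] [r ur]] :=
      (ul (a *: x + y) _ d0, ul x _ d0, ul y _ d0).
    pose k := maxn p (maxn q r).
    have /up kp : (p <= k)%N by rewrite leq_maxl.
    have /uq kq : (q <= k)%N by rewrite /k maxnCA leq_maxl.
    have /ur kr : (r <= k)%N by rewrite /k maxnA leq_maxr.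
    rewrite rnormB.
    have -> : a *: l x + l y - l (a *: x + y) = u k (a *: x + y) -
        l (a *: x + y) - a *: (u k x - l x) - (u k y - l y).
      rewrite bop_linear scalerBr !opprB -[RHS]addrA.
      by rewrite [X in _ = _ + X]addrACA -opprD [RHS]addrC subrKA.
    rewrite (le_trans (rnormD _ _))// (le_trans (lerD (rnormD _ _) (lexx _)))//.
    rewrite !rnormN rnormZ.
    have -> : e = e / (rnorm a + 2) + rnorm a * (e / (rnorm a + 2)) +
        e / (rnorm a + 2).
      have : rnorm a + 2 != 0 by rewrite gt_eqF// ltr_wpDl ?rnorm_ge0.
      by move=> a2; field.
    apply: lerD; last exact: ltW.
    by apply: lerD; [exact: ltW|rewrite ler_wpM2l ?rnorm_ge0// ltW].
  have [k /(_ k (leqnn k)) uk] := near 1 ltr01.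
  exists (1 + bop_norm (u k)) => x; rewrite -(subrK (u k x) (l x)).
  apply: le_trans (rnormD (l x - u k x) (u k x)) _; rewrite mulrDl.
  by apply: lerD; [rewrite rnormB; exact: uk|exact: le_bop_norm].
exists (Bop lb) => e e0; have [|k uk] := near (e / 2).
  by rewrite divr_gt0.
exists k => n kn; apply: (@le_lt_trans _ _ (e / 2)).
  by apply: bop_norm_le_bound => [|x]; [rewrite ltW// divr_gt0|exact: uk].
by rewrite ltr_pdivrMr// ltr_pMr// ltr1n.
Qed.

(* [<T^* y, e_k> = <y, T e_k>] gives the coordinates of [T^* y]; the adjoint
   identity on all of ell2 is [inner_bop_star]. *)
Definition adjoint_seq T y : nat -> R[i] := fun k => inner y (T (basis k)).

Lemma inner_bop_truncation T x y n :
  inner (T (truncation x n)) y =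
  \sum_(0 <= k < n) x k * (adjoint_seq T y k)^*.
Proof.
rewrite /truncation; elim: n => [|n IHn].
  rewrite !big_geq// bop0; have := inner_linear_l (-1) 0 0 y.
  by rewrite scaler0 addr0 mulN1r addNr.
rewrite !big_nat_recr//= addrC bop_linear inner_linear_l IHn addrC.
by rewrite -inner_conj.
Qed.

Lemma adjoint_partial_norm T y n :
  partial_norm (adjoint_seq T y) n <= bop_norm T * rnorm y.
Proof.
set c := adjoint_seq T y; set p := partial_norm c n.
have p0 : 0 <= p by exact: sqrtr_ge0.
pose t := \sum_(0 <= k < n) c k *: basis k.
have tE k : t k = if (k < n)%N then c k else 0.
  rewrite /t; elim: n {p p0 t} => [|n IHn]; first by rewrite big_geq.
  rewrite big_nat_recr//= [LHS](_ : _ = (\sum_(0 <= k < n) c k *: basis k) k +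
    c n * (k == n)%:R)// IHn ltnS [(k <= n)%N]leq_eqVlt.
  case: (eqVneq k n) => [->|kn] /=; last by rewrite mulr0 addr0.
  by rewrite ltnn mulr1 add0r.
have tt : truncation t n = t.
  by apply: ell2E => k; rewrite truncationE !tE; case: (k < n)%N.
have tp : rnorm t <= p.
  apply: rnorm_ell2_le => m; rewrite ler_sqrt ?sum_sqr_ge0//.
  apply: (@le_trans _ _ (\sum_(0 <= k < maxn n m) rnorm (t k) ^+ 2)).
    rewrite [leRHS](big_cat_nat _ (leq_maxr n m))//= lerDl.
    by apply: sumr_ge0 => k _; rewrite sqr_ge0.
  rewrite (big_cat_nat _ (leq_maxl n m))//= [X in _ + X]big_nat_cond.
  rewrite [X in _ + X]big1 ?addr0; last first.
    by move=> k /andP[/andP[nk _] _]; rewrite tE ltnNge nk rnorm0 expr0n.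
  by rewrite le_eqVlt; apply/orP; left; apply/eqP;
     apply: eq_big_nat => k /andP[_ kn]; rewrite tE kn.
have : p ^+ 2 <= bop_norm T * rnorm y * p.
  have <- : rnorm (inner (T t) y) = p ^+ 2.
    rewrite -tt inner_bop_truncation.
    rewrite (eq_big_nat _ _ (F2 := fun k => (rnorm (c k) ^+ 2)%:C)).
      rewrite -rmorph_sum rnorm_real ger0_norm ?sum_sqr_ge0//.
      by rewrite sqr_sqrtr ?sum_sqr_ge0.
    by move=> k /andP[_ kn]; rewrite tE kn mul_conj.
  rewrite (le_trans (cauchy_schwarz _ _))// mulrAC ler_wpM2r ?rnorm_ge0//.
  rewrite (le_trans (le_bop_norm _ _))// ler_wpM2l ?bop_norm_ge0//.
have [->|pn0] := eqVneq p 0; first by rewrite mulr_ge0 ?bop_norm_ge0 ?rnorm_ge0.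
by rewrite expr2 ler_pM2r// lt_neqAle eq_sym pn0.
Qed.

Lemma adjoint_subproof T y : adjoint_seq T y \in @ell2_pred R.
Proof.
rewrite inE; apply: square_summable_of_partial => n.
exact: adjoint_partial_norm.
Qed.

Definition adjoint_fun T y : ell2 R := Ell2 (adjoint_subproof T y).

Lemma bop_star_subproof T : adjoint_fun T \in bop_pred.
Proof.
rewrite inE; split=> [a x y|].
  by apply: ell2E => k; exact: inner_linear_l.
exists (bop_norm T) => y; apply: rnorm_ell2_le => n.
exact: adjoint_partial_norm.
Qed.

Definition bop_star T := Bop (bop_star_subproof T).

Lemma inner_bop_star T x y : inner (T x) y = inner x (bop_star T y).
Proof.
apply/subr0_eq/rnorm0_eq0/eqP; rewrite eq_le rnorm_ge0 andbT.
apply/ler_addgt0Pr => e e0; rewrite add0r.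
pose M := bop_norm T * rnorm y + rnorm (bop_star T y) + 1.
have M0 : 0 < M.
  by rewrite ltr_wpDl// addr_ge0 ?mulr_ge0 ?bop_norm_ge0 ?rnorm_ge0.
have [n xn] := truncation_cvg x (divr_gt0 e0 M0).
set t := truncation x n in xn.
have tT : inner (T t) y = inner t (bop_star T y).
  rewrite /t inner_bop_truncation /truncation; elim: (n) => [|m IHm].
    rewrite !big_geq//; have := inner_linear_l (-1) 0 0 (bop_star T y).
    by rewrite scaler0 addr0 mulN1r addNr.
  have -> : \sum_(0 <= k < m.+1) x k *: basis k =
      x m *: basis m + \sum_(0 <= k < m) x k *: basis k.
    by rewrite big_nat_recr//= addrC.
  rewrite inner_linear_l big_nat_recr//= IHm [LHS]addrC.
  suff <- : inner (basis m) (bop_star T y) = (adjoint_seq T y m)^* by [].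
  by rewrite inner_conj inner_basis_r.
have ->: inner (T x) y - inner x (bop_star T y) =
    inner (T (x - t)) y - inner (x - t) (bop_star T y).
  by rewrite bopB !innerBl tT opprB addrA subrK.
rewrite (le_trans (rnormD _ _))// rnormN.
apply: (@le_trans _ _ (M * rnorm (x - t))); last first.
  by rewrite mulrC -ler_pdivlMr.
rewrite !mulrDl mul1r -addrA lerD//.
  rewrite (le_trans (cauchy_schwarz _ _))// mulrAC ler_wpM2r ?rnorm_ge0//.
  exact: le_bop_norm.
rewrite (le_trans (cauchy_schwarz _ _))// mulrC lerDl rnorm_ge0//.
Qed.

Lemma bop_starP S T :
  (forall x y, inner (T x) y = inner x (S y)) -> bop_star T = S.
Proof.
move=> TS; apply: bopE => y; apply: inner_inj => x.
by rewrite -inner_bop_star TS.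
Qed.

Lemma bop_starK : involutive bop_star.
Proof.
move=> T; apply: bop_starP => x y.
by rewrite inner_conj -inner_bop_star -inner_conj.
Qed.

Lemma bop_star_semilinear (a : R[i]) S T :
  bop_star (a *: S + T) = a^* *: bop_star S + bop_star T.
Proof.
apply: bop_starP => x y.
rewrite [LHS](_ : _ = inner (a *: S x + T x) y)//.
rewrite [RHS](_ : _ = inner x (a^* *: bop_star S y + bop_star T y))//.
by rewrite inner_linear_l inner_linear_r conjCK !inner_bop_star.
Qed.

Lemma bop_starM S T : bop_star (S * T) = bop_star T * bop_star S.
Proof. by apply: bop_starP => x y; rewrite -!inner_bop_star. Qed.

Lemma bop_norm_star T : bop_norm (bop_star T) <= bop_norm T.
Proof.
apply: bop_norm_le_bound => [|y]; first exact: bop_norm_ge0.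
apply: rnorm_ell2_le => n; exact: adjoint_partial_norm.
Qed.

Lemma bop_norm_starM T : bop_norm (bop_star T * T) = bop_norm T ^+ 2.
Proof.
apply/eqP; rewrite eq_le; apply/andP; split.
  rewrite expr2 (le_trans (bop_normM _ _))// ler_wpM2r ?bop_norm_ge0//.
  exact: bop_norm_star.
rewrite -[leRHS]sqr_sqrtr ?bop_norm_ge0// ler_sqr ?nnegrE ?sqrtr_ge0//;
  last exact: bop_norm_ge0.
apply: bop_norm_le => x x1; rewrite -[leLHS](ger0_norm (rnorm_ge0 _)).
rewrite -sqrtr_sqr ler_sqrt ?bop_norm_ge0//.
rewrite -[leLHS]ger0_norm ?sqr_ge0// -rnorm_real -inner_self inner_bop_star.
rewrite (le_trans (cauchy_schwarz _ _))//.
rewrite -[leRHS]mul1r ler_pM ?rnorm_ge0//.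
exact: (@bop_norm_unit (bop_star T * T)).
Qed.

HB.instance Definition _ := isCstarAlgebra.Build R bop bop_normD bop_normZ
  bop_norm0_eq0 bop_normM bop_complete bop_star_semilinear bop_starM bop_starK
  bop_norm_starM.

End BoundedOperators.

Arguments bop R : clear implicits.

Section ConsideredSets.
Context {R : realType}.

Definition convergent_sequences : set (linfty R) :=
  [set x | cvgn (fun n => x n : R[i]^o)].

Definition compact_operators : set (bop R) :=
  [set T | precompact [set T x | x in [set x : ell2 R | `|x| <= 1]]].

Definition compact_plus_scalars : set (bop R) :=
  [set S | exists2 T, compact_operators T & exists a : R[i], S = T + a%:A].

End ConsideredSets.

Inductive considered_set (R : realType) :
    forall A : cstarAlgType R, set A -> Prop :=
| Noncompact_operators :
    considered_set (~` @compact_operators R `|` [set 0] : set (bop R))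
| Divergent_sequences :
    considered_set (~` @convergent_sequences R `|` [set 0] : set (linfty R))
| Nonscalar_mod_compact_operators :
    considered_set (~` @compact_plus_scalars R `|` [set 0] : set (bop R)).

(* Main.v *)
From mathcomp Require Import all_boot all_order all_algebra.
From mathcomp Require Import complex.
From mathcomp Require Import all_classical all_reals all_analysis.
From mathcomp Require Import ring lra zify.
Require Import Defs.

Set Implicit Arguments.
Unset Strict Implicit.
Unset Printing Implicit Defensive.
Import Order.TTheory GRing.Theory Num.Theory.
Import numFieldNormedType.Exports.
Local Open Scope classical_set_scope.
Local Open Scope complex_scope.
Local Open Scope ring_scope.
Local Open Scope card_scope.

(** The three sets come down to a single one.  Repeat every entry of a bounded
    sequence infinitely often and interleave zeros: the result diverges unless
    it is 0, and the diagonal operator that it defines is not a compact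
    perturbation of a scalar unless it is 0.  This gives an isometric
    star-homomorphism from the bounded sequences into the ambient algebra with
    all its values in [M] ([considered_embedding]).  Subalgebras, Hamel
    dimensions and generating sets are transported by it, so it is enough to
    find, inside the bounded sequences and without any constraint, algebras with
    the required dimensions and numbers of generators.

    Upper bounds and minimality.  A set [S] of bounded sequences is called
    independent when any [s] in [S] separates two indices that a given finite
    part of the rest of [S] does not.  All elements of the closed algebra
    generated by [S] are uniformly continuous for the uniformity that [S]
    induces on the indices ([uniform_over_generated]); hence an independent set
    is a minimal generating set, algebraically and as a set of generators of a
    C*-algebra, and it is linearly independent.  Three independent sets of
    self-adjoint elements are used.
    - Blocks in the algebra of sequences supported by the first [d] indices: any
      number [n <= d] of generators for the dimension [d].
    - Coordinates of a cube, indexed by subsets of the naturals: finitely many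
      of them take arbitrary grid values simultaneously ([cube_point]).  They
      generate C*-algebras of dimension the continuum, and algebras of dimension
      aleph_0 when there are countably many of them.
    - Indicators of rational cuts.  They form a chain of projections, so the
      algebra they generate is their linear span and its dimension is the number
      of cuts.

    Lower bounds.  If [T] is an infinite generating set of the same algebra as
    an independent [S], each element of [T] is controlled by countably many
    elements of [S], and these must exhaust [S], whence [S #<= T]
    ([card_bigcup_countable]).  If [T] is finite and [S] consists of [n] > #|T|
    coordinates of the cube, then the cube of dimension [n] would be uniformly
    embedded in a Euclidean space of smaller dimension.  This is refuted by
    Lebesgue's covering argument ([invariance_of_dimension]), whose
    combinatorial core is Kuhn's lemma on labelled cubical grids, obtained here
    from a cup product modulo 2 ([kuhn]). *)

(** * Kuhn's lemma for labelled cubical grids *)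

Section Kuhn.
Variable D : finType.
Implicit Types (v w : D -> nat) (J : {set D}) (j l : D).

Definition upd v j a : D -> nat := fun i => if i == j then a else v i.

Definition succ v j : D -> nat := upd v j (v j).+1.

Lemma updC v j l a b : j != l -> upd (upd v j a) l b = upd (upd v l b) j a.
Proof.
move=> jl; apply/funext => i; rewrite /upd.
by case: (eqVneq i l) => [->|//]; rewrite eq_sym (negbTE jl).
Qed.

Lemma upd_upd v j a b : upd (upd v j a) j b = upd v j b.
Proof. by apply/funext => i; rewrite /upd; case: eqP. Qed.

Lemma succ_neq v j l : l != j -> succ v j l = v l.
Proof. by rewrite /succ /upd => /negbTE ->. Qed.

Lemma succC v j l : succ (succ v j) l = succ (succ v l) j.
Proof.
have [->//|jl] := eqVneq j l.
by rewrite {1}/succ succ_neq 1?eq_sym// {1}/succ updC// [RHS]/succ succ_neq.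
Qed.

Lemma succ_upd v j a : succ (upd v j a) j = upd v j a.+1.
Proof. by rewrite /succ upd_upd {2}/upd eqxx. Qed.

Notation cochain := ((D -> nat) -> {set D} -> 'F_2).
Implicit Types (c : cochain) (u : (D -> nat) -> 'F_2).

Lemma F2_addrr (x : 'F_2) : x + x = 0.
Proof. by rewrite -mulr2n -mulr_natr pchar_Fp_0 ?mulr0. Qed.

Lemma F2_oppr (x : 'F_2) : - x = x.
Proof. by apply/eqP; rewrite -subr_eq0 -opprD F2_addrr oppr0. Qed.

(** The terms for [(j, l)] and [(l, j)] cancel modulo 2. *)
Lemma sum_sym_offdiag (J : {set D}) (f : D -> D -> 'F_2) :
  (forall j l, f j l = f l j) -> \sum_(j in J) \sum_(l in J :\ j) f j l = 0.
Proof.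
move=> fC.
have -> : \sum_(j in J) \sum_(l in J :\ j) f j l =
    \sum_(j in J) \sum_(l in J | (enum_rank l < enum_rank j)%N) f j l +
    \sum_(j in J) \sum_(l in J | (enum_rank j < enum_rank l)%N) f j l.
  rewrite -big_split; apply: eq_bigr => j jJ /=.
  rewrite (bigID (fun l => enum_rank l < enum_rank j)%N) /=; congr (_ + _).
    apply: eq_bigl => l; rewrite !inE; have [->|] //= := eqVneq l j.
    by rewrite ltnn andbF.
  apply: eq_bigl => l; rewrite !inE -leqNgt leq_eqVlt.
  rewrite (inj_eq val_inj) (inj_eq enum_rank_inj) [j == l]eq_sym.
  by have [->|] //= := eqVneq l j; rewrite ltnn andbF.
rewrite [X in _ + X](exchange_big_dep [in J])/=; last first.
  by move=> ? ? ? /andP[].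
rewrite -big_split big1 // => j jJ /=.
rewrite [X in _ + X](eq_big (fun l => (l \in J) && (enum_rank l < enum_rank j)%N)
  (fun l => f j l)); first exact: F2_addrr.
- by move=> l; rewrite jJ /=.
- by move=> l _; rewrite fC.
Qed.

(** A cochain takes its value on the cube with least vertex [v] and with edges
    in the directions of [J].  Coefficients modulo 2 avoid orientations. *)
Definition coboundary c : cochain := fun v J =>
  \sum_(j in J) (c (succ v j) (J :\ j) - c v (J :\ j)).

(** Mixed second differences are symmetric in their two directions, so they
    cancel in pairs modulo 2. *)
Lemma coboundaryK c v J : coboundary (coboundary c) v J = 0.
Proof.
rewrite /coboundary; under eq_bigr do rewrite -sumrB.
apply: sum_sym_offdiag => j l.
have -> : J :\ j :\ l = J :\ l :\ j.
  by apply/setP => i; rewrite !inE andbCA.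
rewrite succC !opprB !F2_oppr.
rewrite -!addrA; congr (_ + _); rewrite addrCA [RHS]addrCA; congr (_ + _).
exact: addrC.
Qed.

(** The cup product of cubical cochains, when its left factor is the
    coboundary of the 0-cochain [u]. *)
Definition cup_d u c : cochain := fun v J =>
  \sum_(j in J) (u (succ v j) - u v) * c (succ v j) (J :\ j).

(** The Leibniz rule for a product with a 0-cochain. *)
Lemma coboundaryM u c v J :
  coboundary (fun v J => u v * c v J) v J =
  cup_d u c v J + u v * coboundary c v J.
Proof.
rewrite /coboundary /cup_d mulr_sumr -big_split; apply: eq_bigr => j _ /=.
by rewrite mulrBl mulrBr addrA subrK.
Qed.

(** The product of the coboundaries of the functions in the list; on an
    [n]-cube it sums, over the monotone edge paths [v_0, ..., v_n] across the
    cube, the products of the increments [us_i v_(i+1) - us_i v_i]. *)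
Fixpoint cup (us : seq ((D -> nat) -> 'F_2)) : cochain :=
  if us is u :: us' then cup_d u (cup us') else fun _ J => (J == finset.set0)%:R.

Lemma coboundary_cup us v J : coboundary (cup us) v J = 0.
Proof.
elim: us v J => [|u us IHus] v J /=.
  by rewrite /coboundary big1// => j _; rewrite subrr.
have cE : cup_d u (cup us) = coboundary (fun v J => u v * cup us v J).
  apply/funext => w; apply/funext => K.
  by rewrite coboundaryM IHus mulr0 addr0.
by rewrite cE coboundaryK.
Qed.

(** A product of coboundaries is closed, hence its product with one more
    coboundary is exact: its sum over a box is a sum over the boundary. *)
Lemma cup_cons u us v J :
  cup (u :: us) v J = coboundary (fun v J => u v * cup us v J) v J.
Proof. by rewrite coboundaryM coboundary_cup mulr0 addr0. Qed.

Variable k : nat.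

Fixpoint box_sum (s : seq D) (f : (D -> nat) -> 'F_2) v : 'F_2 :=
  if s is j :: s' then \sum_(0 <= a < k) box_sum s' f (upd v j a) else f v.

Lemma eq_box_sum s g f v : f =1 g -> box_sum s f v = box_sum s g v.
Proof.
move=> fg; elim: s v => [|j s IHs] v //=.
by apply: eq_bigr => a _; exact: IHs.
Qed.

Lemma box_sum0 s v : box_sum s (fun=> 0) v = 0.
Proof. by elim: s v => [|j s IHs] v //=; rewrite big1. Qed.

Lemma box_sumD s f g v :
  box_sum s (fun v => f v + g v) v = box_sum s f v + box_sum s g v.
Proof.
elim: s v => [|j s IHs] v //=; rewrite -big_split.
by apply: eq_bigr => a _; exact: IHs.
Qed.

Lemma box_sum_sum (r : seq D) s (F : D -> (D -> nat) -> 'F_2) v :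
  box_sum s (fun v => \sum_(j <- r) F j v) v = \sum_(j <- r) box_sum s (F j) v.
Proof.
elim: r => [|j r IHr].
  rewrite big_nil -[RHS](box_sum0 s v).
  by apply: eq_box_sum => w; rewrite big_nil.
rewrite big_cons -IHr -box_sumD.
by apply: eq_box_sum => w; rewrite big_cons.
Qed.

Lemma box_sum_upd s f v j a : j \notin s ->
  box_sum s f (upd v j a) = box_sum s (fun w => f (upd w j a)) v.
Proof.
elim: s v => [|l s IHs] v //=; rewrite in_cons negb_or => /andP[jl js].
by apply: eq_bigr => b _; rewrite updC// IHs.
Qed.

Lemma box_sum_telescope s j (h : (D -> nat) -> 'F_2) v : uniq s -> j \in s ->
  box_sum s (fun w => h (succ w j) - h w) v =
  box_sum (rem j s) (fun w => h (upd w j k) - h (upd w j 0)) v.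
Proof.
elim: s v => [//|l s IHs] v /= /andP[ls us].
rewrite in_cons; have [-> _|jl /= js] := eqVneq j l.
  under eq_bigr do rewrite box_sum_upd//.
  pose F a w := h (upd w l a).
  have tel n : \sum_(0 <= a < n)
      box_sum s (fun w => h (succ (upd w l a) l) - h (upd w l a)) v =
      box_sum s (fun w => F n w - F 0 w) v.
    elim: n => [|n IHn].
      rewrite big_geq// -[LHS](box_sum0 s v).
      by apply: eq_box_sum => w; rewrite subrr.
    rewrite big_nat_recr//= IHn -box_sumD; apply: eq_box_sum => w.
    by rewrite succ_upd addrC addrA subrK.
  exact: tel.
by apply: eq_bigr => a _; exact: IHs.
Qed.

Lemma box_sum_neq0 s f v : box_sum s f v != 0 -> exists w, f w != 0.
Proof.
elim: s v => [|j s IHs] v /=; first by exists v.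
apply: contra_neqP => /forallNP f0; rewrite big1// => a _.
apply/eqP; apply: contraT => /IHs[w fw]; exfalso; exact: (f0 w).
Qed.

Variable u : D -> (D -> nat) -> 'F_2.
(* Outside the box, [u j] is continued constantly. *)
Hypothesis u0 : forall j v, v j = 0%N -> u j v = 0.
Hypothesis u1 : forall j v, (k <= v j)%N -> u j v = 1.

(** On a cube lying in a side of the box orthogonal to [j], the function [u j]
    is constant, and its coboundary is one of the factors. *)
Lemma cup_side s j (w : D -> nat) J : j \in s -> j \notin J ->
  (w j = 0 \/ k <= w j)%N -> cup (map u s) w J = 0.
Proof.
elim: s w J => [//|l s IHs] w J; rewrite in_cons => + jJ wj.
rewrite /= /cup_d => jls; rewrite big1// => i iJ.
have wi : succ w i j = w j.
  by rewrite succ_neq//; apply: contraNneq jJ => ->.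
move/orP: jls => [/eqP <-|js].
  rewrite [_ - _](_ : _ = 0) ?mul0r//.
  by case: wj => wj; [rewrite !u0 ?wi// subrr|rewrite !u1 ?wi// subrr].
rewrite IHs ?mulr0// ?wi// !inE negb_and (negbTE jJ) orbT//.
Qed.

(** Induction on the dimension: the sum is carried by the boundary, and the
    only side that contributes is the one orthogonal to the first direction [i]
    on which [u i] is 1; there the next, lower-dimensional, product appears. *)
Lemma box_sum_cup s v : uniq s ->
  box_sum s (fun w => cup (map u s) w [set j in s]) v = 1.
Proof.
elim: s v => [|i s IHs] v us.
  by rewrite /= [_ == _](_ : _ = true)//; apply/eqP/setP => j; rewrite !inE.
pose J := [set j in i :: s].
pose h (j : D) w := u i w * cup (map u s) w (J :\ j).
rewrite (@eq_box_sum _ (fun w => \sum_(j <- i :: s) (h j (succ w j) - h j w))).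
  (* Sides orthogonal to the remaining directions [j] contribute nothing. *)
  rewrite box_sum_sum big_cons big1_seq ?addr0; last first.
    move=> j /andP[_ js]; rewrite (@box_sum_telescope _ j (h j))//; last first.
      by rewrite in_cons js orbT.
    rewrite -[RHS](box_sum0 (rem j (i :: s)) v); apply: eq_box_sum => w.
    rewrite /h !(@cup_side s j) ?mulr0 ?subrr//.
    - by rewrite !inE eqxx.
    - by left; rewrite /upd eqxx.
    - by rewrite !inE eqxx.
    - by right; rewrite /upd eqxx.
  rewrite (@box_sum_telescope _ i (h i))// ?mem_head//= eqxx.
  have /= /andP[iNs us'] := us.
  rewrite -[RHS](IHs (upd v i k) us') box_sum_upd//; apply: eq_box_sum => w.
  rewrite /h u1 ?u0 ?/upd ?eqxx// mul0r subr0 mul1r.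
  congr (cup _ _ _); apply/setP => j; rewrite !inE.
  by have [->|] := eqVneq j i; rewrite ?(negbTE iNs).
move=> w; rewrite map_cons cup_cons [RHS]big_uniq//=; apply: eq_bigl => j.
by rewrite inE.
Qed.

Definition in_cell v w := forall j, (v j <= w j <= (v j).+1)%N.

Lemma cup_neq0 s v w J : uniq s -> cup (map u s) w J != 0 ->
  (forall j, v j <= w j <= (v j).+1)%N ->
  (forall j, j \in J -> w j = v j) ->
  forall i, i \in s -> exists w1 w2,
    [/\ in_cell v w1, in_cell v w2 & u i w1 != u i w2].
Proof.
elim: s w J => [//|l s IHs] w J /= /andP[ls us] cn0 vw wJ i.
have [j jJ] : exists2 j, j \in J &
    (u l (succ w j) - u l w) * cup (map u s) (succ w j) (J :\ j) != 0.
  move: cn0; rewrite /cup_d; apply: contra_neqP => /exists2P/forallNP f0.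
  rewrite big1// => j jJ; apply/eqP; apply: contraT => ne; exfalso.
  by apply: (f0 j).
rewrite mulf_eq0 negb_or subr_eq0 => /andP[un cn].
have vsw : in_cell v (succ w j).
  move=> b; have [->|bj] := eqVneq b j; last by rewrite succ_neq.
  by rewrite /succ /upd eqxx wJ// leqnSn leqnn.
rewrite in_cons => /orP[/eqP ->|ins]; first by exists (succ w j), w.
apply: (IHs _ _ us cn) => // b; rewrite !inE => /andP[bj bJ].
by rewrite succ_neq// wJ.
Qed.

(** A discrete form of the Poincare-Miranda theorem: if [u i] separates the two
    sides of the box orthogonal to [i], then some cell has all the [u i] non
    constant.  Otherwise all terms of the sum of [box_sum_cup] would vanish. *)
Lemma kuhn : exists v, forall i, exists w1 w2,
  [/\ in_cell v w1, in_cell v w2 & u i w1 != u i w2].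
Proof.
have : box_sum (enum D) (fun w => cup (map u (enum D)) w [set j in enum D])
    (fun=> 0%N) != 0 by rewrite box_sum_cup ?enum_uniq.
move=> /box_sum_neq0[v cn]; exists v => i.
apply: (@cup_neq0 _ v v _ (enum_uniq D) cn) => [j|//|]; last by rewrite mem_enum.
by rewrite leqnn leqnSn.
Qed.

End Kuhn.

(** * Cardinalities of unions of countable sets *)

Lemma injection_card_le (T U : Type) (A : set T) (B : set U) (f : T -> U) :
  (forall x, A x -> B (f x)) -> (forall x y, A x -> A y -> f x = f y -> x = y) ->
  A #<= B.
Proof.
move=> fB finj; have fi : {in A &, injective f}.
  by move=> x y /set_mem Ax /set_mem Ay; exact: finj.
rewrite -(card_le_eql (inj_card_eq fi)); apply: subset_card_le.
by move=> _ [x Ax <-]; exact: fB.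
Qed.

Lemma card_le_injection (T U : Type) (A : set T) (B : set U) (u0 : U) :
  A #<= B -> exists f : T -> U, (forall x, A x -> B (f x)) /\
    (forall x y, A x -> A y -> f x = f y -> x = y).
Proof.
move=> AB; have /card_leP[f] := AB.
pose g x := if pselect (A x) is left Ax then val (f (SigSub (mem_set Ax))) else u0.
exists g; split=> [x Ax|x y Ax Ay]; rewrite /g.
  by case: pselect => // p; exact: set_valP.
case: pselect => // p; case: pselect => // q /val_inj.
move/(@inj _ _ _ f); rewrite !inE => /(_ I I).
by move/(congr1 val).
Qed.

Lemma countable_enum (T : Type) (A : set T) (x0 : T) : countable A ->
  exists e : nat -> T, A `<=` range e.
Proof.
move=> /countable_injP[f fi]; pose P n x := A x /\ f x = n.
have /choice[e eP] : forall n, exists x, (exists y, P n y) -> P n x.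
  move=> n; have [[y Py]|no] := pselect (exists y, P n y); first by exists y.
  by exists x0.
exists e => x Ax; exists (f x) => //.
have [|Ae fe] := eP (f x); first by exists x.
by apply: fi => //; exact/mem_set.
Qed.

(** By Zorn, an infinite set is, up to finitely many points, a disjoint union
    of countably infinite sets; the countable sets over one such piece can be
    indexed by that piece, and those over the remaining points also fit into
    one piece. *)
Lemma card_bigcup_countable (J U : Type) (T : set J) (C : J -> set U) :
  infinite_set T -> (forall i, T i -> countable (C i)) ->
  \bigcup_(i in T) C i #<= T.
Proof.
move=> Tinf Cc; have [i0 Ti0] := infinite_setN0 Tinf.
have [[x0 Cx0]|C0] := pselect (\bigcup_(i in T) C i !=set0); last first.
  rewrite (_ : \bigcup_(i in T) C i = set0) ?card_ge0//.
  by apply/seteqP; split=> // x Cx; apply: C0; exists x.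
pose P (F : set (nat -> J)) :=
  (forall f, F f -> injective f /\ forall k, T (f k)) /\
  (forall f g k l, F f -> F g -> f k = g l -> f = g).
have [F [[Finj Fdisj] Fmax]] : exists F, P F /\ forall G, F `<` G -> ~ P G.
  apply: Zorn_bigcup => FF FFP tot; split=> [f [F FFF Ff]|].
    by have [+ _] := FFP _ FFF; apply.
  move=> f g k l [F FFF Ff] [G FFG Gg] fg.
  have [/(_ _ Ff) Gf|/(_ _ Gg) Fg] := tot _ _ FFF FFG.
    by have [_ H] := FFP _ FFG; exact: H Gf Gg fg.
  by have [_ H] := FFP _ FFF; exact: H Ff Fg fg.
pose W := \bigcup_(f in F) range f.
have WT : finite_set (T `\` W).
  apply: contrapT => /infiniteP/(card_le_injection i0)[f [fT fi]].
  have Ff : ~ F f.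
    by move=> Ff; have [_ +] := fT 0%N I; apply; exists f => //; exists 0%N.
  apply: (Fmax (F `|` [set f])).
    by split=> [|/(_ f)/(_ (or_intror erefl))//]; left.
  split=> [g [/Finj//|->]|g h k l].
    by split=> [k l|k]; [exact: fi|have [] := fT k I].
  move=> [Fg|->] [Fh|->] // gh; first exact: Fdisj gh.
    by have [_ []] := fT l I; exists g => //; exists k.
  by have [_ []] := fT k I; exists h => //; exists l.
have [f0 Ff0] : F !=set0.
  apply: contrapT => F0; apply: Tinf; apply: sub_finite_set WT => i Ti.
  by split=> // -[f Ff _]; apply: F0; exists f.
have [e' Ce'] := @countable_enum _ (\bigcup_(i in T `\` W) C i) x0
  (bigcup_countable (finite_set_countable WT) (fun i Hi => Cc i Hi.1)).
have /choice[e eC] i : exists e : nat -> U, T i -> C i `<=` range e.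
  have [Ti|nT] := pselect (T i); last by exists (fun=> x0).
  by have [e Ce] := @countable_enum _ (C i) x0 (Cc i Ti); exists e.
(* [val f] runs through the sets over the points of the range of [f], at the
   positive first components, and through those over [T `\` W], at 0. *)
pose val (f : nat -> J) (k : nat) : U :=
  if unpickle k is Some (a, b) then
    if a is a'.+1 then e (f a') b else e' b
  else x0.
have /choice[q qP] : forall x, exists fk : (nat -> J) * nat,
    (\bigcup_(i in T) C i) x -> F fk.1 /\ val fk.1 fk.2 = x.
  move=> x; have [[i Ti Cix]|no] := pselect ((\bigcup_(i in T) C i) x); last first.
    by exists (f0, 0%N).
  have [[f Ff [k _ fk]]|nW] := pselect (W i).
    have [b _ eb] := eC i Ti x Cix.
    exists (f, pickle (k.+1, b)) => _; split=> //=.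
    by rewrite /val pickleK fk.
  have [|b _ eb] := Ce' x; first by exists i.
  exists (f0, pickle (0%N, b)) => _; split=> //=.
  by rewrite /val pickleK.
apply: (@injection_card_le _ _ _ _ (fun x => (q x).1 (q x).2)) => [x Cx|x y Cx Cy].
  by have [Ff _] := qP x Cx; have [_] := Finj _ Ff; apply.
have [Fx vx] := qP x Cx; have [Fy vy] := qP y Cy => fg.
have E := Fdisj _ _ _ _ Fx Fy fg; rewrite -vx -vy -E; congr val.
by apply: (Finj _ Fx).1; rewrite fg E.
Qed.

Lemma card_bigcup_uncountable (J U : Type) (T : set J) (C : J -> set U) S :
  ~ countable S -> (forall i, T i -> countable (C i)) ->
  S `<=` \bigcup_(i in T) C i -> S #<= T.
Proof.
move=> Sunc Cc SC; have [Tfin|Tinf] := pselect (finite_set T).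
  exfalso; apply: Sunc; apply: sub_countable (subset_card_le SC) _.
  by apply: bigcup_countable => //; exact: finite_set_countable.
exact: card_le_trans (subset_card_le SC) (card_bigcup_countable Tinf Cc).
Qed.

(** * Spans, generated subalgebras and norm closures *)

Section Spans.
Context {R : realType} {A : cstarAlgType R}.
Implicit Types (S B V : set A) (x y : A).

Definition linear_subspace V := V 0 /\ forall (a : R[i]) x y, V x -> V y -> V (a *: x + y).

Lemma linear_subspace_sum V n (a : 'I_n -> R[i]) (s : 'I_n -> A) :
  linear_subspace V -> (forall i, V (s i)) -> V (\sum_i a i *: s i).
Proof.
move=> [V0 VD] Vs; elim/big_rec: _ => // i x _ Vx.
exact: VD.
Qed.

Lemma linear_span_sub S : S `<=` linear_span S.
Proof.
move=> x Sx; exists 1%N, (fun=> 1), (fun=> x); split=> //.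
by rewrite big_ord1 scale1r.
Qed.

Lemma linear_span_subspace S : linear_subspace (linear_span S).
Proof.
split.
  by exists 0%N, (fun=> 0), (fun=> 0); split=> [[]//|]; rewrite big_ord0.
move=> c _ _ [m [a [s [Ss ->]]]] [n [b [t [St ->]]]].
exists (m + n)%N, (fun i => match fintype.split i with inl j => c * a j | inr j => b j end),
  (fun i => match fintype.split i with inl j => s j | inr j => t j end).
split=> [i|]; first by case: fintype.split.
rewrite big_split_ord scaler_sumr /=; congr (_ + _); apply: eq_bigr => i _.
  by rewrite (unsplitK (inl i)) scalerA.
by rewrite (unsplitK (inr i)).
Qed.

Lemma linear_span_min S V : linear_subspace V -> S `<=` V -> linear_span S `<=` V.
Proof.
move=> Vs SV _ [n [a [s [Ss ->]]]]; apply: linear_subspace_sum => // i.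
exact: SV.
Qed.

Lemma linear_spanS S T : S `<=` T -> linear_span S `<=` linear_span T.
Proof.
move=> ST; apply: linear_span_min; first exact: linear_span_subspace.
exact: subset_trans ST (@linear_span_sub T).
Qed.

Lemma subalgebra_subspace B : subalgebra B -> linear_subspace B.
Proof. by case. Qed.

Lemma finite_products_sub S : S `<=` finite_products S.
Proof.
move=> x Sx; exists [:: x]; split=> // [s|]; last by rewrite big_seq1.
by rewrite inE => /eqP ->.
Qed.

Lemma finite_productsM S x y :
  finite_products S x -> finite_products S y -> finite_products S (x * y).
Proof.
move=> [l [l0 Sl ->]] [m [m0 Sm ->]]; exists (l ++ m); split.
- by case: (l) l0.
- by move=> s; rewrite mem_cat => /orP[/Sl|/Sm].
- by rewrite big_cat.
Qed.

Lemma finite_products_min S B :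
  (forall x y, B x -> B y -> B (x * y)) -> S `<=` B -> finite_products S `<=` B.
Proof.
move=> BM SB _ [l [l0 Sl ->]].
elim: l l0 Sl => [//|x [|y l] IHl] _ Sl.
  by rewrite big_seq1; apply/SB/Sl; rewrite inE.
rewrite big_cons; apply: BM; first by apply/SB/Sl; rewrite mem_head.
by apply: IHl => // s sl; apply: Sl; rewrite inE sl orbT.
Qed.

Lemma alg_span_sub S : S `<=` alg_span S.
Proof.
exact: subset_trans (@finite_products_sub S) (@linear_span_sub _).
Qed.

Lemma alg_span_min S B : subalgebra B -> S `<=` B -> alg_span S `<=` B.
Proof.
move=> Bs SB; apply: linear_span_min; first exact: subalgebra_subspace.
by apply: finite_products_min => //; case: Bs.
Qed.

Lemma alg_span_subalgebra S : subalgebra (alg_span S).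
Proof.
have [s0 sD] := linear_span_subspace (finite_products S).
split=> // x y Sx Sy; move: x Sx.
apply: linear_span_min => [|p Sp].
  split=> [|a x x' xS x'S]; first by rewrite mul0r.
  by rewrite mulrDl -scalerAl; exact: sD.
move: y Sy; apply: linear_span_min => [|q Sq].
  split=> [|a x x' xS x'S]; first by rewrite mulr0.
  by rewrite mulrDr -scalerAr; exact: sD.
by apply: linear_span_sub; exact: finite_productsM.
Qed.

Lemma star0 : star (0 : A) = 0.
Proof.
have := star_semilinear (-1) (0 : A) 0; rewrite scaler0 addr0 => ->.
by rewrite rmorphN rmorph1 scaleN1r addNr.
Qed.

Lemma starD x y : star (x + y) = star x + star y.
Proof. by rewrite -[x in LHS]scale1r star_semilinear rmorph1 scale1r. Qed.

Lemma starZ (a : R[i]) x : star (a *: x) = a^* *: star x.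
Proof. by rewrite -[a *: x]addr0 star_semilinear star0 addr0. Qed.

Lemma starB x y : star (x - y) = star x - star y.
Proof. by rewrite starD -scaleN1r starZ rmorphN rmorph1 scaleN1r. Qed.

Lemma alg_span_star S : S `<=` self_adjoint -> star_closed (alg_span S).
Proof.
move=> Ssa; have sS := alg_span_subalgebra S.
suff : alg_span S `<=` [set x | alg_span S (star x) /\ alg_span S x].
  by move=> H x /H[].
apply: alg_span_min => [|x Sx]; last first.
  by rewrite /= (Ssa x Sx); split; exact: alg_span_sub.
have [s0 sD sM] := sS; split=> /=; first by rewrite star0.
- move=> a x y [Sx' Sx] [Sy' Sy]; rewrite star_semilinear.
  by split; exact: sD.
- by move=> x y [Sx' Sx] [Sy' Sy]; rewrite starM; split; exact: sM.
Qed.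

Lemma cnorm_ge0 x : 0 <= cnorm x.
Proof.
have := cnormD x (- x); rewrite subrr cnorm0 cnormN -mulr2n.
by rewrite pmulrn_lge0.
Qed.

Lemma cnormB x y : cnorm (x - y) = cnorm (y - x).
Proof. by rewrite -opprB cnormN. Qed.

Lemma cnorm_star x : cnorm (star x) = cnorm x.
Proof.
have le y : cnorm y <= cnorm (star y).
  have := cnormM (star y) y; rewrite cnorm_starM expr2.
  have := cnorm_ge0 y; rewrite le_eqVlt => /orP[/eqP <- _|y0].
    exact: cnorm_ge0.
  by rewrite ler_pM2r.
by apply/eqP; rewrite eq_le le -{2}(starK x) le.
Qed.

Definition norm_closure B : set A := @closure (normTopology A) B.

Lemma norm_closureP B x : norm_closure B x <->
  forall e : R, 0 < e -> exists2 y, B y & cnorm (x - y) < e.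
Proof.
split=> [Bx e e0|H U].
  have [|y [By xy]] := Bx (ball (x : normTopology A) e).
    exact: nbhsx_ballx.
  by exists y.
rewrite nbhs_ballP => -[e /= e0 xU]; have [y By xy] := H e e0.
by exists y; split=> //; exact: xU.
Qed.

Lemma norm_closure_sub B : B `<=` norm_closure B.
Proof.
by move=> x Bx; apply/norm_closureP => e e0; exists x; rewrite // subrr cnorm0.
Qed.

Lemma norm_closureS B V : B `<=` V -> norm_closure B `<=` norm_closure V.
Proof.
move=> BV x /norm_closureP Bx; apply/norm_closureP => e /Bx[y /BV Vy xy].
by exists y.
Qed.

Lemma closed_norm_closure B :
  @closed (normTopology A) B <-> norm_closure B = B.
Proof.
split=> [/closure_id/esym//|<-].
exact: (@closed_closure (normTopology A)).
Qed.

Lemma norm_closure_subalgebra B : subalgebra B -> subalgebra (norm_closure B).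
Proof.
move=> [B0 BD BM]; split.
- exact: norm_closure_sub.
- move=> a x y /norm_closureP Bx /norm_closureP By; apply/norm_closureP => e e0.
  have e2 : 0 < e / 2 by rewrite divr_gt0.
  have a1 : 0 < rnorm a + 1 by rewrite ltr_wpDl ?rnorm_ge0.
  have [x' Bx' xx'] := Bx (e / 2 / (rnorm a + 1)) (divr_gt0 e2 a1).
  have [y' By' yy'] := By _ e2.
  exists (a *: x' + y'); first exact: BD.
  rewrite opprD addrACA -scalerBr (le_lt_trans (cnormD _ _))//.
  rewrite [ltRHS](splitr e) ler_ltD// cnormZ.
  rewrite (@le_trans _ _ ((rnorm a + 1) * cnorm (x - x')))//.
    by rewrite ler_wpM2r ?cnorm_ge0// lerDl.
  by rewrite mulrC -ler_pdivlMr// ltW.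
- move=> x y /norm_closureP Bx /norm_closureP By; apply/norm_closureP => e e0.
  have e2 : 0 < e / 2 by rewrite divr_gt0.
  have y1 : 0 < cnorm y + 1 by rewrite ltr_wpDl ?cnorm_ge0.
  have [x' Bx' xx'] := Bx (e / 2 / (cnorm y + 1)) (divr_gt0 e2 y1).
  have x1 : 0 < cnorm x' + 1 by rewrite ltr_wpDl ?cnorm_ge0.
  have [y' By' yy'] := By (e / 2 / (cnorm x' + 1)) (divr_gt0 e2 x1).
  exists (x' * y'); first exact: BM.
  have -> : x * y - x' * y' = (x - x') * y + x' * (y - y').
    by rewrite mulrBl mulrBr addrA subrK.
  rewrite (le_lt_trans (cnormD _ _))// [ltRHS](splitr e) ler_ltD//.
    rewrite (le_trans (cnormM _ _))//.
    rewrite (@le_trans _ _ (cnorm (x - x') * (cnorm y + 1)))//.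
      by rewrite ler_wpM2l ?cnorm_ge0// lerDl.
    by rewrite -ler_pdivlMr// ltW.
  rewrite (le_lt_trans (cnormM _ _))//.
  rewrite (@le_lt_trans _ _ ((cnorm x' + 1) * cnorm (y - y')))//.
    by rewrite ler_wpM2r ?cnorm_ge0// lerDl.
  by rewrite mulrC -ltr_pdivlMr.
Qed.

Lemma norm_closure_star B : star_closed B -> star_closed (norm_closure B).
Proof.
move=> Bs x /norm_closureP Bx; apply/norm_closureP => e /Bx[y By xy].
by exists (star y); [exact: Bs|rewrite -starB cnorm_star].
Qed.

Lemma Cstar_subalgebra_closure S : S `<=` self_adjoint ->
  Cstar_subalgebra (norm_closure (alg_span S)).
Proof.
move=> Ssa; split.
- exact/norm_closure_subalgebra/alg_span_subalgebra.
- exact/norm_closure_star/alg_span_star.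
- exact: (@closed_closure (normTopology A)).
Qed.

End Spans.

(** * Hamel bases *)

Section Bases.
Context {R : realType} {A : cstarAlgType R}.
Implicit Types (E G S : set A).

Lemma linearly_independentU1 E g : linearly_independent E ->
  ~ linear_span E g -> linearly_independent (E `|` [set g]).
Proof.
move=> Eind Eg [|n] a e einj Ee ae0; first by case.
have [[i0 ei0]|ng] := pselect (exists i, e i = g); last first.
  by apply: Eind einj _ ae0 => i; case: (Ee i) => // eg; case: ng; exists i.
have Ee' i : E (e (lift i0 i)).
  case: (Ee (lift i0 i)) => // /= eg.
  by have /eqP := einj _ _ (etrans ei0 (esym eg)); rewrite (negbTE (neq_lift _ _)).
move: ae0; rewrite (bigD1_ord i0)//= ei0 => ae0.
have a0 : a i0 = 0.
  apply: contrapT => /eqP a0; apply: Eg.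
  have -> : g = - (a i0)^-1 *: (\sum_i a (lift i0 i) *: e (lift i0 i)) + 0.
    have /eqP := ae0; rewrite addr_eq0 => /eqP ag.
    by rewrite addr0 -[RHS]opprK scaleNr opprK -scalerN -ag scalerA mulVf ?scale1r.
  have Es := linear_span_subspace E; apply: Es.2 Es.1.
  by apply: (linear_subspace_sum _ Es) => i; exact: linear_span_sub.
move: ae0; rewrite a0 scale0r add0r => ae0 i.
case: (unliftP i0 i) => [j|] ->//.
by apply: (Eind _ (a \o lift i0) (e \o lift i0) _ Ee' ae0) => k l /einj/lift_inj.
Qed.

(** The basis is squeezed between [E0] and [G], which is how its cardinality
    gets computed: from below by independent vectors at hand, from above by [G]. *)
Lemma basis_extension E0 G : E0 `<=` G -> linearly_independent E0 ->
  exists E, [/\ E0 `<=` E, E `<=` G, linearly_independent E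
              & linear_span E = linear_span G].
Proof.
move=> E0G E0ind.
pose P X := X `<=` G /\ linearly_independent (E0 `|` X).
have [X [[XG Xind] Xmax]] : exists X, P X /\ forall Y, X `<` Y -> ~ P Y.
  apply: Zorn_bigcup => F FP tot; split=> [x [X FX Xx]|n a e einj Ee].
    by have [XG _] := FP _ FX; exact: XG.
  have [[X0 FX0]|F0] := pselect (F !=set0); last first.
    apply: E0ind einj _ => i; case: (Ee i) => // -[X FX _].
    by case: F0; exists X.
  have [X FX eX] : exists2 X, F X & forall i, (E0 `|` X) (e i).
    suff [X FX eX] : exists2 X, F X & forall i, i \in enum 'I_n -> (E0 `|` X) (e i).
      by exists X => // i; apply: eX; rewrite mem_enum.
    elim: (enum 'I_n) => [|i s [X FX eX]]; first by exists X0.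
    case: (Ee i) => [E0i|[Y FY Yi]].
      exists X => // j; rewrite inE => /orP[/eqP ->|/eX//].
      by left.
    have [XY|YX] := tot _ _ FX FY.
      exists Y => // j; rewrite inE => /orP[/eqP ->|/eX[|/XY]]; by [left|right].
    exists X => // j; rewrite inE => /orP[/eqP ->|/eX//].
    by right; exact: YX.
  by have [_] := FP _ FX; apply.
exists (E0 `|` X); split=> //.
  by move=> x [/E0G|/XG].
apply/seteqP; split.
  by apply: linear_spanS => x [/E0G|/XG].
apply: linear_span_min; first exact: linear_span_subspace.
move=> g Gg; apply: contrapT => Xg.
apply: (Xmax (X `|` [set g])).
  split=> [|/(_ g (or_intror erefl)) Xg']; first by left.
  by apply: Xg; apply: linear_span_sub; right.
split=> [x [/XG//|->//]|].
by rewrite setUA; exact: linearly_independentU1.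
Qed.

End Bases.

(** * Uniform control and independence of bounded sequences *)

Section Uniform.
Context {R : realType}.
Notation linfty := (linfty R).
Implicit Types (S T C : set linfty) (L : seq linfty) (x y s f : linfty).

Lemma le_cnorm x n : rnorm (x n) <= cnorm x.
Proof. exact: le_linfty_norm. Qed.

Definition close_on L (d : R) (p q : nat) :=
  forall s, s \in L -> rnorm (s p - s q) < d.

Lemma close_on_cat L1 L2 d1 d2 p q :
  close_on (L1 ++ L2) (Num.min d1 d2) p q -> close_on L1 d1 p q /\ close_on L2 d2 p q.
Proof.
move=> H; split=> s sL; have := H s; rewrite mem_cat sL ?orbT => /(_ isT).
  by rewrite lt_min => /andP[].
by rewrite lt_min => /andP[].
Qed.

(** Uniform continuity of [y] for the initial uniformity that the sequences in
    [S] induce on the index set.  It replaces continuous functions on the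
    spectrum of the algebra generated by [S]. *)
Definition uniform_over S y := forall e : R, 0 < e -> exists L d,
  [/\ 0 < d, forall s, s \in L -> S s
    & forall p q, close_on L d p q -> rnorm (y p - y q) < e].

Lemma uniform_over_sub S : S `<=` uniform_over S.
Proof.
move=> s Ss e e0; exists [:: s], e; split=> // [t|p q].
  by rewrite inE => /eqP ->.
by apply; rewrite inE.
Qed.

Lemma uniform_overS S T : S `<=` T -> uniform_over S `<=` uniform_over T.
Proof.
move=> ST y Sy e /Sy[L [d [d0 LS H]]]; exists L, d; split=> // s /LS.
exact: ST.
Qed.

Lemma uniform_over_seq S L : (forall s, s \in L -> uniform_over S s) -> forall e : R, 0 < e ->
  exists L' d, [/\ 0 < d, forall s, s \in L' -> S s
    & forall p q, close_on L' d p q -> close_on L e p q].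
Proof.
elim: L => [|x L IHL] LS e e0; first by exists [::], 1; split.
have [|L1 [d1 [d10 L1S H1]]] := IHL _ e e0.
  by move=> s sL; apply: LS; rewrite inE sL orbT.
have [|L2 [d2 [d20 L2S H2]]] := LS x _ e e0; first by rewrite mem_head.
exists (L1 ++ L2), (Num.min d1 d2); split=> [|s|p q /close_on_cat[pq1 pq2]].
- by rewrite lt_min d10.
- by rewrite mem_cat => /orP[/L1S|/L2S].
- by move=> s; rewrite inE => /orP[/eqP ->|]; [exact: H2|exact: H1].
Qed.

Lemma uniform_over_trans S T : T `<=` uniform_over S -> uniform_over T `<=` uniform_over S.
Proof.
move=> TS y Ty e /Ty[L [d [d0 LT H]]].
have [|L' [d' [d'0 L'S H']]] := @uniform_over_seq S L _ d d0; first by move=> s /LT/TS.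
by exists L', d'; split=> // p q /H'/H.
Qed.

Lemma uniform_over_subalgebra S : subalgebra (uniform_over S).
Proof.
split.
- by move=> e e0; exists [::], 1; split=> // p q _; rewrite subrr rnorm0.
- move=> a x y Sx Sy e e0; have e2 : 0 < e / 2 by rewrite divr_gt0.
  have a1 : 0 < rnorm a + 1 by rewrite ltr_wpDl ?rnorm_ge0.
  have [L1 [d1 [d10 L1S H1]]] := Sx _ (divr_gt0 e2 a1).
  have [L2 [d2 [d20 L2S H2]]] := Sy _ e2.
  exists (L1 ++ L2), (Num.min d1 d2); split=> [|s|p q /close_on_cat[pq1 pq2]].
  + by rewrite lt_min d10.
  + by rewrite mem_cat => /orP[/L1S|/L2S].
  rewrite [X in rnorm X](_ : _ = a * (x p - x q) + (y p - y q)); last first.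
    by rewrite mulrBr addrACA -opprD.
  rewrite (le_lt_trans (rnormD _ _))// [ltRHS](splitr e) ler_ltD ?H2// rnormM.
  rewrite (@le_trans _ _ ((rnorm a + 1) * rnorm (x p - x q)))//.
    by rewrite ler_wpM2r ?rnorm_ge0// lerDl.
  by rewrite mulrC -ler_pdivlMr// ltW// H1.
- move=> x y Sx Sy e e0; have e2 : 0 < e / 2 by rewrite divr_gt0.
  have x1 : 0 < cnorm x + 1 by rewrite ltr_wpDl ?cnorm_ge0.
  have y1 : 0 < cnorm y + 1 by rewrite ltr_wpDl ?cnorm_ge0.
  have [L1 [d1 [d10 L1S H1]]] := Sx _ (divr_gt0 e2 y1).
  have [L2 [d2 [d20 L2S H2]]] := Sy _ (divr_gt0 e2 x1).
  exists (L1 ++ L2), (Num.min d1 d2); split=> [|s|p q /close_on_cat[pq1 pq2]].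
  + by rewrite lt_min d10.
  + by rewrite mem_cat => /orP[/L1S|/L2S].
  rewrite [X in rnorm X](_ : _ = (x p - x q) * y p + x q * (y p - y q)); last first.
    by rewrite mulrBl mulrBr addrA subrK.
  rewrite (le_lt_trans (rnormD _ _))// [ltRHS](splitr e) ler_ltD// rnormM.
    rewrite (@le_trans _ _ (rnorm (x p - x q) * (cnorm y + 1)))//.
      rewrite ler_wpM2l ?rnorm_ge0//.
      by rewrite (le_trans (le_cnorm y p))// lerDl.
    by rewrite -ler_pdivlMr// ltW// H1.
  rewrite (@le_lt_trans _ _ ((cnorm x + 1) * rnorm (y p - y q)))//.
    rewrite ler_wpM2r ?rnorm_ge0//.
    by rewrite (le_trans (le_cnorm x q))// lerDl.
  by rewrite mulrC -ltr_pdivlMr// H2.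
Qed.

Lemma uniform_over_closed S : norm_closure (uniform_over S) `<=` uniform_over S.
Proof.
move=> y /norm_closureP Sy e e0; have e3 : 0 < e / 3 by rewrite divr_gt0.
have [x Sx xy] := Sy _ e3; have [L [d [d0 LS H]]] := Sx _ e3.
exists L, d; split=> // p q /H xpq.
have -> : y p - y q = (y - x) p + (x p - x q) - (y - x) q.
  rewrite [(y - x) p](_ : _ = y p - x p)// [(y - x) q](_ : _ = y q - x q)//.
  ring.
rewrite (le_lt_trans (rnormD _ _))// rnormN.
have -> : e = e / 3 + e / 3 + e / 3 by field.
rewrite ler_ltD// ?(le_lt_trans (le_cnorm _ _))//.
rewrite (le_trans (rnormD _ _))// lerD// ltW//.
exact: le_lt_trans (le_cnorm _ _) xy.
Qed.

(** The bounded sequences that are uniformly continuous over [S] form a closed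
    subalgebra. *)
Lemma uniform_over_generated S : norm_closure (alg_span S) `<=` uniform_over S.
Proof.
apply: subset_trans (@uniform_over_closed S); apply: norm_closureS.
by apply: alg_span_min; [exact: uniform_over_subalgebra|exact: uniform_over_sub].
Qed.

(** One finite subset of [S] for each tolerance [1 / n.+1]. *)
Lemma uniform_over_countable S y : uniform_over S y ->
  exists C, [/\ C `<=` S, countable C & uniform_over C y].
Proof.
move=> Sy; have /choice[F FP] : forall n : nat, exists Ld : seq linfty * R,
    [/\ 0 < Ld.2, forall s, s \in Ld.1 -> S s & forall p q,
     close_on Ld.1 Ld.2 p q -> rnorm (y p - y q) < n.+1%:R^-1].
  by move=> n; have [|L [d H]] := Sy n.+1%:R^-1; [rewrite invr_gt0|exists (L, d)].
exists (\bigcup_n [set` (F n).1]); split.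
- by move=> s [n _ /= sF]; have [_ + _] := FP n; apply.
- by apply: bigcup_countable => // n _; apply: finite_set_countable; exact: finite_seq.
- move=> e e0; have [n ne] : exists n : nat, n.+1%:R^-1 < e.
    have [n _ /(_ n (leqnn n))] := near_infty_natSinv_lt (PosNum e0).
    by exists n.
  have [d0 _ H] := FP n; exists (F n).1, (F n).2; split=> // [s sF|p q /H].
    by exists n.
  by move/lt_trans; apply.
Qed.

(** The gap is at least 1, not merely nonzero, because uniform continuity
    provides [L] after the tolerance has been chosen, and [p], [q] depend on
    [L]. *)
Definition independent S := forall s L, S s ->
  (forall f, f \in L -> S f /\ f != s) ->
  exists p q, (forall f, f \in L -> f p = f q) /\ 1 <= rnorm (s p - s q).

Lemma independent_uniform_over S T s :
  independent S -> T `<=` S -> S s -> uniform_over T s -> T s.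
Proof.
move=> Sind TS Ss /(_ 1 ltr01)[L [d [d0 LT H]]]; apply: contrapT => Ts.
have [|p [q [Lpq]]] := Sind s L Ss.
  by move=> f /LT Tf; split; [exact: TS|apply: contra_notN Ts => /eqP <-].
rewrite leNgt => /negP; apply; apply: H => f /Lpq ->.
by rewrite subrr rnorm0.
Qed.

Lemma linfty_sumE n (a : 'I_n -> R[i]) (e : 'I_n -> linfty) p :
  (\sum_i a i *: e i : linfty) p = \sum_i a i * e i p.
Proof.
by elim/big_rec2: _ => [//|i _ x _ <-].
Qed.

(** Evaluation at [p] minus evaluation at [q] is a linear form that isolates one
    vector. *)
Lemma independent_linearly S : independent S -> linearly_independent S.
Proof.
move=> Sind n a e einj Se ae0 i; apply: contrapT => /eqP ai0.
pose L := [seq e j | j <- enum 'I_n & j != i].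
have [|p [q [Lpq]]] := Sind (e i) L (Se i).
  move=> f /mapP[j]; rewrite mem_filter => /andP[ji _] ->; split=> //.
  by apply: contra_neq ji => /einj.
suff -> : e i p = e i q by rewrite subrr rnorm0 ler10.
have H r : e i r = - (a i)^-1 * \sum_(j | j != i) a j * e j r.
  have := congr1 (fun x : linfty => x r) ae0; rewrite linfty_sumE.
  rewrite (bigD1 i)//= => /eqP; rewrite addr_eq0 => /eqP H.
  by rewrite mulNr -mulrN -H mulKf.
rewrite !H; congr (_ * _); apply: eq_bigr => j ji; congr (_ * _).
by apply: Lpq; apply: map_f; rewrite mem_filter ji mem_enum.
Qed.

(** Each [t] in [T] is controlled by a countable part of [S]; if the union of
    these parts missed some [s], then [s] would be controlled by other members
    of [S]. *)
Lemma generators_cover S T : independent S -> T `<=` uniform_over S -> S `<=` uniform_over T ->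
  exists C : linfty -> set linfty,
    (forall t, T t -> countable (C t)) /\ S `<=` \bigcup_(t in T) C t.
Proof.
move=> Sind TS ST.
have /choice[C CP] : forall t, exists C, T t -> [/\ C `<=` S, countable C & uniform_over C t].
  move=> t; have [/TS/uniform_over_countable[C H]|nT] := pselect (T t); first by exists C.
  by exists set0.
exists C; split=> [t /CP[]//|s Ss].
apply: (@independent_uniform_over S) => //.
  by move=> f [t Tt Ctf]; have [CS _ _] := CP t Tt; exact: CS.
apply: (@uniform_over_trans _ T); last exact: ST.
move=> t Tt; have [_ _] := CP t Tt; apply: uniform_overS => f Ctf.
by exists t.
Qed.

(** Closures are used on both sides so that a bound obtained for C*-generators
    also covers algebraic ones. *)
Definition needs_card S := forall T, T !=set0 -> T `<=` self_adjoint ->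
  norm_closure (alg_span T) = norm_closure (alg_span S) -> S #<= T.

Lemma same_closure_uniform_over S T :
  norm_closure (alg_span T) = norm_closure (alg_span S) -> T `<=` uniform_over S.
Proof.
move=> TS; apply: subset_trans (@uniform_over_generated S); rewrite -TS.
exact: subset_trans (@alg_span_sub _ _ T) (@norm_closure_sub _ _ _).
Qed.

Lemma infinite_generators S T : independent S -> infinite_set T ->
  norm_closure (alg_span T) = norm_closure (alg_span S) -> S #<= T.
Proof.
move=> Sind Tinf TS.
have [C [Cc SC]] := generators_cover Sind (same_closure_uniform_over TS)
  (same_closure_uniform_over (esym TS)).
exact: card_le_trans (subset_card_le SC) (card_bigcup_countable Tinf Cc).
Qed.

Lemma uncountable_needs_card S : independent S -> ~ countable S -> needs_card S.
Proof.
move=> Sind Sunc T _ _ TS.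
have [C [Cc SC]] := generators_cover Sind (same_closure_uniform_over TS)
  (same_closure_uniform_over (esym TS)).
exact: card_bigcup_uncountable Sunc Cc SC.
Qed.

Lemma proper_not_generating S T : independent S -> T `<` S ->
  norm_closure (alg_span T) <> norm_closure (alg_span S).
Proof.
move=> Sind [TS ST] E; apply: ST => s Ss; apply: (independent_uniform_over Sind) => //.
exact: same_closure_uniform_over (esym E) _ Ss.
Qed.

(** An independent generating set is minimal: an element controlled by a subset
    belongs to it. *)
Lemma independent_algebrable (X Y : Type) (alpha : set X) (beta : set Y) S :
  S !=set0 -> S `<=` self_adjoint -> independent S -> S #= beta ->
  has_dim (alg_span S) alpha ->
  algebrable alpha beta [set: linfty] /\
  (needs_card S -> genalgebrable alpha beta [set: linfty]).
Proof.
move=> S0 Ssa Sind Sb Sdim.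
have gS : alg_generates (alg_span S) S.
  by split=> //; exact: alg_span_sub.
have Sstar := alg_span_star Ssa.
split=> [|Scard]; exists (alg_span S); split=> //.
- exact: alg_span_subalgebra.
- by left.
- exists S; split=> // T TS [_ _ _ TE].
  by apply: (proper_not_generating Sind TS); rewrite TE.
- exact: alg_span_subalgebra.
- by left.
- split; first by exists S.
  move=> T [T0 _ Tsa TE]; rewrite -(card_le_eql Sb).
  by apply: Scard => //; [exact: Tsa|rewrite TE].
Qed.

Lemma independent_Cstar_algebrable (X Y : Type) (alpha : set X) (beta : set Y) S :
  S !=set0 -> S `<=` self_adjoint -> independent S -> S #= beta ->
  has_dim (norm_closure (alg_span S)) alpha ->
  Cstar_algebrable alpha beta [set: linfty] /\
  (needs_card S -> Cstar_genalgebrable alpha beta [set: linfty]).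
Proof.
move=> S0 Ssa Sind Sb Sdim.
have gS : Cstar_generates (norm_closure (alg_span S)) S.
  split=> // s Ss; split; last exact: Ssa.
  exact/norm_closure_sub/alg_span_sub.
split=> [|Scard]; exists (norm_closure (alg_span S)); split=> //.
- exact: Cstar_subalgebra_closure.
- by left.
- exists S; split=> // T TS [_ _ TE].
  exact: (proper_not_generating Sind TS).
- exact: Cstar_subalgebra_closure.
- by left.
- split; first by exists S.
  move=> T [T0 TB TE]; rewrite -(card_le_eql Sb).
  by apply: Scard => // t /TB[].
Qed.

End Uniform.

(** * Transport along isometric star-homomorphisms *)

Section Transport.
Context {R : realType} {A1 A2 : cstarAlgType R}.
Variable phi : A1 -> A2.
Hypothesis phi_linear : forall (a : R[i]) x y, phi (a *: x + y) = a *: phi x + phi y.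
Hypothesis phiM : forall x y, phi (x * y) = phi x * phi y.
Hypothesis phi_star : forall x, phi (star x) = star (phi x).
Hypothesis phi_norm : forall x, cnorm (phi x) = cnorm x.
Implicit Types (S B : set A1) (T : set A2).

Lemma phi0 : phi 0 = 0.
Proof.
by have := phi_linear (-1) 0 0; rewrite scaler0 addr0 => ->; rewrite scaleN1r addNr.
Qed.

Lemma phiB x y : phi (x - y) = phi x - phi y.
Proof. by rewrite addrC -scaleN1r phi_linear scaleN1r addrC. Qed.

Lemma phi_inj : injective phi.
Proof.
move=> x y xy; apply/subr0_eq/cnorm0_eq0.
by rewrite -phi_norm phiB xy subrr cnorm0.
Qed.

Lemma phi_sum n (a : 'I_n -> R[i]) (e : 'I_n -> A1) :
  phi (\sum_i a i *: e i) = \sum_i a i *: phi (e i).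
Proof.
elim/big_rec2: _ => [|i _ x _ <-]; first exact: phi0.
exact: phi_linear.
Qed.

Lemma card_phi_image S : phi @` S #= S.
Proof. by apply: inj_card_eq => x y _ _; exact: phi_inj. Qed.

Lemma phi_image_inj S B : phi @` S = phi @` B -> S = B.
Proof.
suff H X Y : phi @` X = phi @` Y -> X `<=` Y by move=> E; apply/seteqP; split; exact: H.
move=> E x Xx; have : (phi @` X) (phi x) by exists x.
by rewrite E => -[y Yy /phi_inj <-].
Qed.

Lemma phi_preimage T B : T `<=` phi @` B -> T = phi @` (phi @^-1` T).
Proof.
move=> TB; apply/seteqP; split=> [t Tt|_ [x Tx <-]//].
by have [x _ xt] := TB t Tt; exists x; rewrite //= xt.
Qed.

Lemma linear_subspace_image V : linear_subspace V -> linear_subspace (phi @` V).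
Proof.
move=> [V0 VD]; split; first by exists 0 => //; exact: phi0.
by move=> a _ _ [x Vx <-] [y Vy <-]; exists (a *: x + y); [exact: VD|exact: phi_linear].
Qed.

Lemma linear_subspace_preimage (V : set A2) : linear_subspace V -> linear_subspace (phi @^-1` V).
Proof.
move=> [V0 VD]; split=> /= [|a x y Vx Vy]; first by rewrite phi0.
by rewrite phi_linear; exact: VD.
Qed.

Lemma subalgebra_image B : subalgebra B -> subalgebra (phi @` B).
Proof.
move=> Bs; have [? ?] := linear_subspace_image (subalgebra_subspace Bs).
have [_ _ BM] := Bs; split=> //.
by move=> _ _ [x Bx <-] [y By <-]; exists (x * y); [exact: BM|exact: phiM].
Qed.

Lemma subalgebra_preimage (B : set A2) : subalgebra B -> subalgebra (phi @^-1` B).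
Proof.
move=> Bs; have [? ?] := linear_subspace_preimage (subalgebra_subspace Bs).
have [_ _ BM] := Bs; split=> //= x y Bx By.
by rewrite phiM; exact: BM.
Qed.

Lemma linear_span_image S : linear_span (phi @` S) = phi @` (linear_span S).
Proof.
apply/seteqP; split.
  apply: linear_span_min; first exact/linear_subspace_image/linear_span_subspace.
  by apply: image_subset; exact: linear_span_sub.
rewrite image_sub; apply: linear_span_min.
  exact/linear_subspace_preimage/linear_span_subspace.
by move=> s Ss; apply: linear_span_sub; exists s.
Qed.

Lemma alg_span_image S : alg_span (phi @` S) = phi @` (alg_span S).
Proof.
apply/seteqP; split.
  apply: alg_span_min; first exact/subalgebra_image/alg_span_subalgebra.
  by apply: image_subset; exact: alg_span_sub.
rewrite image_sub; apply: alg_span_min.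
  exact/subalgebra_preimage/alg_span_subalgebra.
by move=> s Ss; apply: alg_span_sub; exists s.
Qed.

(** The domain being complete, a limit of images is the image of a limit. *)
Lemma norm_closure_image B : norm_closure (phi @` B) = phi @` (norm_closure B).
Proof.
apply/seteqP; split=> [y|_ [x /norm_closureP Bx <-]]; last first.
  apply/norm_closureP => e /Bx[z Bz xz]; exists (phi z); first by exists z.
  by rewrite -phiB phi_norm.
move=> /norm_closureP By; have /choice[u uP] : forall n : nat, exists x,
    B x /\ cnorm (y - phi x) < n.+1%:R^-1.
  by move=> n; have [|_ [x Bx <-] yx] := By n.+1%:R^-1; [rewrite invr_gt0|exists x].
have yu (e : R) : 0 < e -> exists k, forall n, (k <= n)%N -> cnorm (y - phi (u n)) < e.
  move=> e0; have [k _ H] := near_infty_natSinv_lt (PosNum e0); exists k => n kn.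
  exact: lt_trans (uP n).2 (H n kn).
have [|l ul] := @cnorm_complete R A1 u.
  move=> e e0; have e2 : 0 < e / 2 by rewrite divr_gt0.
  have [k uk] := yu _ e2.
  exists k => m n /uk ym /uk yn; rewrite -phi_norm phiB.
  have -> : phi (u m) - phi (u n) = (y - phi (u n)) - (y - phi (u m)).
    by rewrite opprB [RHS]addrC addrA subrK.
  by rewrite (le_lt_trans (cnormD _ _))// cnormN [ltRHS](splitr e) ltrD.
exists l.
  apply/norm_closureP => e /ul[k H]; exists (u k); first exact: (uP k).1.
  by rewrite cnormB; exact: H.
apply/subr0_eq/cnorm0_eq0/eqP; rewrite eq_le cnorm_ge0 andbT.
apply/ler_addgt0Pr => e e0; rewrite add0r; have e2 : 0 < e / 2 by rewrite divr_gt0.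
have [k uk] := yu _ e2; have [m um] := ul _ e2.
pose n := maxn k m; have -> : phi l - y = (phi l - phi (u n)) - (y - phi (u n)).
  by rewrite opprB addrA subrK.
rewrite (le_trans (cnormD _ _))// cnormN [leRHS](splitr e) lerD//.
  by rewrite -phiB phi_norm cnormB ltW// um// leq_maxr.
by rewrite ltW// uk// leq_maxl.
Qed.

Lemma self_adjoint_image S : phi @` S `<=` self_adjoint <-> S `<=` self_adjoint.
Proof.
rewrite image_sub; split=> H x /H; rewrite /self_adjoint /= -phi_star.
  exact: phi_inj.
by move=> ->.
Qed.

Lemma star_closed_image B : star_closed (phi @` B) <-> star_closed B.
Proof.
split=> H.
  move=> x Bx; have [|y By] := H (phi x); first by exists x.
  by rewrite -phi_star => /phi_inj <-.
by move=> _ [x Bx <-]; exists (star x); [exact: H|exact: phi_star].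
Qed.

Lemma linearly_independent_image S :
  linearly_independent S -> linearly_independent (phi @` S).
Proof.
move=> Sind n a e einj Se ae0.
have /choice[f fP] i : exists x, S x /\ phi x = e i by have [x ? <-] := Se i; exists x.
apply: (Sind n a f) => [i j fij|i|]; last first.
- apply: phi_inj; rewrite phi_sum phi0 -[RHS]ae0; apply: eq_bigr => i _.
  by rewrite (fP i).2.
- exact: (fP i).1.
- by apply: einj; rewrite -(fP i).2 -(fP j).2 fij.
Qed.

Lemma has_dim_image (X : Type) (alpha : set X) B :
  has_dim B alpha -> has_dim (phi @` B) alpha.
Proof.
move=> [E [Eind EB Ea]]; exists (phi @` E); split.
- exact: linearly_independent_image.
- by rewrite linear_span_image EB.
- exact: card_eq_trans (card_phi_image E) Ea.
Qed.

Lemma alg_generates_image B T :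
  alg_generates (phi @` B) T <-> exists2 S, T = phi @` S & alg_generates B S.
Proof.
split=> [[T0 TB Tsa TE]|[S -> [S0 SB Ssa SE]]].
  have E := phi_preimage TB; exists (phi @^-1` T) => //; split.
  - by have [t Tt] := T0; have [x _ xt] := TB t Tt; exists x; rewrite /= xt.
  - by move=> x /= /TB[y By /phi_inj <-].
  - by rewrite -star_closed_image => /Tsa; rewrite {1}E self_adjoint_image.
  - by apply: phi_image_inj; rewrite -alg_span_image -E.
split.
- by have [s Ss] := S0; exists (phi s), s.
- exact: image_subset.
- by rewrite star_closed_image self_adjoint_image.
- by rewrite alg_span_image SE.
Qed.

Lemma Cstar_generates_image B T :
  Cstar_generates (phi @` B) T <-> exists2 S, T = phi @` S & Cstar_generates B S.
Proof.
split=> [[T0 TB TE]|[S -> [S0 SB SE]]].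
  have TB' : T `<=` phi @` B by move=> t /TB[].
  have E := phi_preimage TB'; exists (phi @^-1` T) => //; split.
  - by have [t Tt] := T0; have [x _ xt] := TB' t Tt; exists x; rewrite /= xt.
  - move=> x /= Tx; split; first by have [y By /phi_inj <-] := TB' _ Tx.
    have : phi @` (phi @^-1` T) `<=` self_adjoint by rewrite -E => t /TB[].
    by rewrite self_adjoint_image; apply.
  - apply: phi_image_inj; rewrite -TE -/(norm_closure _) -norm_closure_image.
    by rewrite -alg_span_image -E.
split.
- by have [s Ss] := S0; exists (phi s), s.
- have sa : S `<=` self_adjoint by move=> s /SB[].
  move=> _ [s Ss <-]; split; first by exists s => //; have [] := SB s Ss.
  by move/self_adjoint_image : sa; apply; exists s.
- by rewrite alg_span_image -/(norm_closure _) norm_closure_image -SE.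
Qed.

Section Generating.
Variables (gens1 : set A1 -> Prop) (gens2 : set A2 -> Prop).
Hypothesis gens_image : forall T, gens2 T <-> exists2 S, T = phi @` S & gens1 S.

Lemma least_card_image (X : Type) (beta : set X) :
  least_card gens1 beta -> least_card gens2 beta.
Proof.
move=> [[S gS Sb] least]; split=> [|T /gens_image[S' -> /least]].
  exists (phi @` S); first by apply/gens_image; exists S.
  exact: card_eq_trans (card_phi_image S) Sb.
by rewrite (card_le_eqr (card_phi_image S')).
Qed.

Lemma minimal_of_card_image (X : Type) (beta : set X) :
  minimal_of_card gens1 beta -> minimal_of_card gens2 beta.
Proof.
move=> [S [gS Smin Sb]]; exists (phi @` S); split.
- by apply/gens_image; exists S.
- move=> T [TS ST] /gens_image[S' E gS']; apply: (Smin S') gS'; split.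
    by move=> x S'x; have [|y Sy /phi_inj <-//] := TS (phi x); rewrite E; exists x.
  by move=> SS'; apply: ST; rewrite E; exact: image_subset.
- exact: card_eq_trans (card_phi_image S) Sb.
Qed.

End Generating.

Lemma Cstar_subalgebra_image B : Cstar_subalgebra B -> Cstar_subalgebra (phi @` B).
Proof.
move=> [Bs Bstar Bcl]; split.
- exact: subalgebra_image.
- exact/star_closed_image.
- apply/closed_norm_closure; rewrite norm_closure_image.
  by move/closed_norm_closure : Bcl => ->.
Qed.

(* The whole image lies in [M], so that the constraint imposed by [M] on
   subalgebras disappears on the other side. *)
Variable M : set A2.
Hypothesis phi_range : forall x, M (phi x).
Variables (X Y : Type) (alpha : set X) (beta : set Y).

Let sub_M B : phi @` B `<=` M `|` [set 0].
Proof. by move=> _ [x _ <-]; left. Qed.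

Lemma genalgebrable_image :
  genalgebrable alpha beta [set: A1] -> genalgebrable alpha beta M.
Proof.
move=> [B [Bs _ Bdim Bgen]]; exists (phi @` B); split => //.
- exact: subalgebra_image.
- exact: has_dim_image.
- by apply: least_card_image Bgen => T; exact: alg_generates_image.
Qed.

Lemma algebrable_image :
  algebrable alpha beta [set: A1] -> algebrable alpha beta M.
Proof.
move=> [B [Bs _ Bdim Bgen]]; exists (phi @` B); split => //.
- exact: subalgebra_image.
- exact: has_dim_image.
- by apply: minimal_of_card_image Bgen => T; exact: alg_generates_image.
Qed.

Lemma Cstar_genalgebrable_image :
  Cstar_genalgebrable alpha beta [set: A1] -> Cstar_genalgebrable alpha beta M.
Proof.
move=> [B [Bs _ Bdim Bgen]]; exists (phi @` B); split => //.
- exact: Cstar_subalgebra_image.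
- exact: has_dim_image.
- by apply: least_card_image Bgen => T; exact: Cstar_generates_image.
Qed.

Lemma Cstar_algebrable_image :
  Cstar_algebrable alpha beta [set: A1] -> Cstar_algebrable alpha beta M.
Proof.
move=> [B [Bs _ Bdim Bgen]]; exists (phi @` B); split => //.
- exact: Cstar_subalgebra_image.
- exact: has_dim_image.
- by apply: minimal_of_card_image Bgen => T; exact: Cstar_generates_image.
Qed.

End Transport.

(** * Embedding bounded sequences into the considered sets *)

Section Embeddings.
Context {R : realType}.
Implicit Types (x y : linfty R) (v w : ell2 R).

(** Every index of a sequence occurs infinitely often among the values of
    [spread_index], and so does [None], to which the entry 0 is attached. *)
Definition spread_index (n : nat) : option nat :=
  if (unpickle n : option (nat * nat)) is Some (k.+1, _) then Some k else None.

Definition spread_seq (x : nat -> R[i]) n : R[i] :=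
  if spread_index n is Some k then x k else 0.

Definition frequent_value (z : nat -> R[i]) c :=
  exists2 f : nat -> nat, injective f & forall j, z (f j) = c.

Lemma spread_frequent x k : frequent_value (spread_seq x) (x k).
Proof.
exists (fun j => pickle (k.+1, j) : nat) => [i j /(pcan_inj pickleK)[]//|j].
by rewrite /spread_seq /spread_index pickleK.
Qed.

Lemma spread_frequent0 x : frequent_value (spread_seq x) 0.
Proof.
exists (fun j => pickle (0%N, j)) => [i j /(pcan_inj pickleK)[]//|j].
by rewrite /spread_seq /spread_index pickleK.
Qed.

Lemma spread_subproof x : spread_seq x \in @linfty_pred R.
Proof.
rewrite inE; exists (cnorm x) => n; rewrite /spread_seq.
by case: spread_index => [k|]; rewrite ?le_cnorm// rnorm0 cnorm_ge0.
Qed.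

Definition spread x : linfty R := Linfty (spread_subproof x).

Lemma spread_linear (a : R[i]) x y : spread (a *: x + y) = a *: spread x + spread y.
Proof.
apply: linftyE => n.
rewrite [RHS](_ : _ = a * spread_seq x n + spread_seq y n)//.
rewrite [LHS](_ : _ = spread_seq (a *: x + y) n)//.
by rewrite /spread_seq; case: spread_index => [k//|]; rewrite mulr0 addr0.
Qed.

Lemma spreadM x y : spread (x * y) = spread x * spread y.
Proof.
apply: linftyE => n; rewrite [RHS](_ : _ = spread_seq x n * spread_seq y n)//=.
by rewrite /spread_seq; case: spread_index => [k//|]; rewrite mulr0.
Qed.

Lemma spread_star x : spread (star x) = star (spread x).
Proof.
apply: linftyE => n; rewrite [RHS](_ : _ = (spread_seq x n)^*)//=.
by rewrite /spread_seq; case: spread_index => [k//|]; rewrite conjC0.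
Qed.

Lemma spread_norm x : cnorm (spread x) = cnorm x.
Proof.
apply/eqP; rewrite eq_le; apply/andP; split; apply: linfty_norm_le => n.
  rewrite /= /spread_seq.
  by case: spread_index => [k|]; rewrite ?le_cnorm// rnorm0 cnorm_ge0.
have [f _ /(_ 0%N) <-] := spread_frequent x n.
exact: (le_cnorm (spread x)).
Qed.

Lemma cvg_frequent (z : nat -> R[i]) (l c : R[i]) :
  (z : nat -> R[i]^o) @ \oo --> (l : R[i]^o) -> frequent_value z c -> c = l.
Proof.
move=> zl [f finj fc]; apply/esym/subr0_eq/rnorm0_eq0/eqP.
rewrite eq_le rnorm_ge0 andbT; apply/ler_addgt0Pr => e e0; rewrite add0r.
have /cvgrPdist_le/(_ e%:C) := zl; rewrite ltcR => /(_ e0)[N _ zN].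
have [j Nj] := injective_gtn finj N; have := zN (f j) (ltnW Nj).
by rewrite /= rnormE lecR fc.
Qed.

(** A convergent sequence has a single frequent value; those of [spread x] are
    0 and all the entries of [x]. *)
Lemma spread_divergent x : ~ convergent_sequences (spread x) \/ spread x = 0.
Proof.
have [/cvg_ex[l xl]|] := pselect (convergent_sequences (spread x)); last by left.
right; apply: linftyE => n; rewrite [RHS](_ : _ = 0)//=.
have l0 := cvg_frequent xl (spread_frequent0 x).
rewrite /spread_seq; case: spread_index => [k|//].
by rewrite (cvg_frequent xl (spread_frequent x k)) l0.
Qed.

Lemma diagonal_partial_norm x (v : nat -> R[i]) n :
  partial_norm (fun n => x n * v n) n <= cnorm x * partial_norm v n.
Proof.
rewrite /partial_norm -[in leRHS](ger0_norm (cnorm_ge0 x)) -sqrtr_sqr -sqrtrM ?sqr_ge0//.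
rewrite ler_sqrt ?mulr_ge0 ?cnorm_ge0 ?sum_sqr_ge0// mulr_sumr.
apply: ler_sum => k _; rewrite rnormM exprMn ler_wpM2r ?sqr_ge0//.
by rewrite lerXn2r ?nnegrE ?rnorm_ge0 ?cnorm_ge0// le_cnorm.
Qed.

Lemma diagonal_seq_bound x v n :
  partial_norm (fun n => x n * v n) n <= cnorm x * rnorm v.
Proof.
rewrite (le_trans (diagonal_partial_norm _ _ _))//.
by rewrite ler_wpM2l ?cnorm_ge0// partial_norm_rnorm.
Qed.

Lemma diagonal_seq_subproof x v : (fun n => x n * v n) \in @ell2_pred R.
Proof.
by rewrite inE; apply: square_summable_of_partial => n; exact: diagonal_seq_bound.
Qed.

Definition diagonal_fun x v : ell2 R := Ell2 (diagonal_seq_subproof x v).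

Lemma diagonal_subproof x : diagonal_fun x \in @bop_pred R.
Proof.
rewrite inE; split=> [a v w|].
  apply: ell2E => n.
  rewrite [LHS](_ : _ = x n * (a * v n + w n))//.
  rewrite [RHS](_ : _ = a * (x n * v n) + x n * w n)//.
  by rewrite mulrDr mulrCA.
exists (cnorm x) => v; apply: rnorm_ell2_le => n; exact: diagonal_seq_bound.
Qed.

Definition diagonal x : bop R := Bop (diagonal_subproof x).

Lemma diagonal_linear (a : R[i]) x y :
  diagonal (a *: x + y) = a *: diagonal x + diagonal y.
Proof.
apply: bopE => v; apply: ell2E => n.
rewrite [LHS](_ : _ = (a * x n + y n) * v n)//.
rewrite [RHS](_ : _ = a * (x n * v n) + y n * v n)//.
by rewrite mulrDl mulrA.
Qed.

Lemma diagonalM x y : diagonal (x * y) = diagonal x * diagonal y.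
Proof.
apply: bopE => v; apply: ell2E => n.
by rewrite [LHS](_ : _ = (x n * y n) * v n)// -mulrA.
Qed.

Lemma diagonal_star x : diagonal (star x) = star (diagonal x).
Proof.
apply/esym/bop_starP => v w; rewrite /inner.
have -> // : (fun n => diagonal x v n * (w n)^*) =
    (fun n => v n * (diagonal (star x) w n)^*).
by apply/funext => n /=; rewrite rmorphM/= conjCK mulrCA mulrA.
Qed.

Lemma rnorm_basis k : rnorm (basis k : ell2 R) = 1.
Proof.
have := inner_self (basis k : ell2 R); rewrite inner_basis_r /= eqxx.
move/complexI/esym/eqP; rewrite sqrp_eq1 ?rnorm_ge0//.
by move/eqP.
Qed.

Lemma diagonal_basis x k : diagonal x (basis k) = x k *: basis k.
Proof.
apply: ell2E => n; rewrite [LHS](_ : _ = x n * (n == k)%:R)//.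
rewrite [RHS](_ : _ = x k * (n == k)%:R)//.
by have [->//|] := eqVneq n k; rewrite !mulr0.
Qed.

Lemma diagonal_norm x : cnorm (diagonal x) = cnorm x.
Proof.
apply/eqP; rewrite eq_le; apply/andP; split.
  apply: bop_norm_le_bound => [|v]; first exact: cnorm_ge0.
  by apply: rnorm_ell2_le => n; exact: diagonal_seq_bound.
apply: linfty_norm_le => n; have := le_bop_norm (diagonal x) (basis n).
by rewrite diagonal_basis rnormZ !rnorm_basis !mulr1.
Qed.

(** If [c <> a], then the operator maps infinitely many basis vectors to
    multiples by [c - a] of themselves; these are uniformly separated vectors in
    a relatively compact set. *)
Lemma compact_frequent x (a c : R[i]) :
  compact_operators (diagonal x - a%:A) -> frequent_value x c -> c = a.
Proof.
move=> + [f finj fc]; set K := diagonal x - _ => Kc.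
apply: contrapT => /eqP ca; pose mu := c - a.
have mu0 : 0 < rnorm mu.
  rewrite lt_neqAle rnorm_ge0 andbT eq_sym; apply: contra_neq ca.
  by move/rnorm0_eq0/subr0_eq.
pose z j := mu *: basis (f j) : ell2 R.
have Kz j : K (basis (f j)) = z j.
  rewrite [LHS](_ : _ = diagonal x (basis (f j)) - a *: basis (f j))//.
  by rewrite diagonal_basis fc -scalerBl.
have zsep i j : i != j -> rnorm mu <= rnorm (z i - z j).
  move=> ij; apply: le_trans (coord_le_rnorm _ (f i)).
  rewrite [X in rnorm X](_ : _ = mu * (f i == f i)%:R - mu * (f i == f j)%:R)//.
  by rewrite eqxx (inj_eq finj) (negbTE ij) mulr0 subr0 mulr1.
have : compact (closure [set K v | v in [set v : ell2 R | `|v| <= 1]]).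
  by rewrite -precompactE.
move=> /(_ (z @ \oo) _)[|p [_ pz]].
  exists 0%N => // j _ /=; apply: subset_closure.
  by exists (basis (f j)); [rewrite /= rnormE rnorm_basis|exact: Kz].
have near N : exists2 j, (N <= j)%N & rnorm (p - z j) < rnorm mu / 2.
  have [||_ [[j /= Nj <-] pj]] :=
    pz [set z j | j in [set j | (N <= j)%N]] [set v | rnorm (p - v) < rnorm mu / 2].
  - by exists N => // j Nj; exists j.
  - have m2 : 0 < (rnorm mu / 2)%:C by rewrite ltcR divr_gt0.
    apply: filterS (nbhsx_ballx p _ m2) => v.
    by rewrite -ball_normE /= rnormE ltcR.
  by exists j.
have [i _ pi] := near 0%N; have [j ij pj] := near i.+1.
have := zsep i j; rewrite ltn_eqF// => /(_ isT); apply/negP; rewrite -ltNge.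
have -> : z i - z j = (p - z j) - (p - z i) by rewrite opprB [RHS]addrC addrA subrK.
by rewrite (le_lt_trans (rnormD _ _))// rnormN [ltRHS]splitr ltrD.
Qed.

Definition spread_diagonal x := diagonal (spread x).

Lemma spread_diagonal_noncompact x :
  ~ compact_plus_scalars (spread_diagonal x) \/ spread_diagonal x = 0.
Proof.
have [[K Kc [a E]]|] := pselect (compact_plus_scalars (spread_diagonal x)); last by left.
right; suff -> : spread_diagonal x = diagonal 0.
  by apply: bopE => v; apply: ell2E => n; exact: mul0r.
congr diagonal; apply: linftyE => n; rewrite [RHS](_ : _ = 0)//=.
have Kc' : compact_operators (diagonal (spread x) - a%:A).
  by rewrite -/(spread_diagonal x) E addrK.
rewrite /spread_seq; case: spread_index => [k|//].
by rewrite (compact_frequent Kc' (spread_frequent x k))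
  (compact_frequent Kc' (spread_frequent0 x)).
Qed.

Lemma compact_plus_scalars_sub : @compact_operators R `<=` compact_plus_scalars.
Proof. by move=> K Kc; exists K => //; exists 0; rewrite scale0r addr0. Qed.

Lemma considered_embedding (A : cstarAlgType R) (M : set A) : considered_set M ->
  exists phi : linfty R -> A,
  [/\ forall (a : R[i]) x y, phi (a *: x + y) = a *: phi x + phi y,
      forall x y, phi (x * y) = phi x * phi y,
      forall x, phi (star x) = star (phi x),
      forall x, cnorm (phi x) = cnorm x
    & forall x, M (phi x)].
Proof.
have spreads :
  [/\ forall (a : R[i]) x y, spread_diagonal (a *: x + y) =
        a *: spread_diagonal x + spread_diagonal y,
      forall x y, spread_diagonal (x * y) = spread_diagonal x * spread_diagonal y,
      forall x, spread_diagonal (star x) = star (spread_diagonal x)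
    & forall x, cnorm (spread_diagonal x) = cnorm x].
  rewrite /spread_diagonal; split=> *.
  - by rewrite spread_linear diagonal_linear.
  - by rewrite spreadM diagonalM.
  - by rewrite spread_star diagonal_star.
  - by rewrite diagonal_norm spread_norm.
case; [|exists spread; split| ].
- exists spread_diagonal; have [? ? ? ?] := spreads; split=> // x.
  have [xK|->] := spread_diagonal_noncompact x; last by right.
  by left=> /compact_plus_scalars_sub.
- exact: spread_linear.
- exact: spreadM.
- exact: spread_star.
- exact: spread_norm.
- by move=> x; have [?|->] := spread_divergent x; [left|right].
- exists spread_diagonal; have [? ? ? ?] := spreads; split=> // x.
  by have [?|->] := spread_diagonal_noncompact x; [left|right].
Qed.

End Embeddings.

(** * Finite-dimensional algebras *)

Section FiniteDimensional.
Context {R : realType}.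
Implicit Types (x y : linfty R) (B : set (linfty R)).

Lemma rnorm_nat (k : nat) : rnorm (k%:R : R[i]) = k%:R.
Proof. by rewrite -(rmorph_nat (real_complex R)) rnorm_real ger0_norm. Qed.

(** The factor [x n] makes up for the possible lack of a unit in [B]. *)
Lemma subalgebra_horner B x (p : {poly R[i]}) : subalgebra B -> B x ->
  exists2 y, B y & forall n, y n = x n * p.[x n].
Proof.
move=> [B0 BD BM] Bx; elim/poly_ind: p => [|p c [y By yE]].
  by exists 0 => // n; rewrite horner0 mulr0.
exists (c *: x + y * x); first by apply: BD => //; exact: BM.
move=> n; rewrite [LHS](_ : _ = c * x n + y n * x n)// yE !hornerE.
ring.
Qed.

Definition initial_seqs (d : nat) : set (linfty R) :=
  [set x | forall i, (d <= i)%N -> x i = 0].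

Lemma initial_seqs_subalgebra d : subalgebra (initial_seqs d).
Proof.
split=> //.
- move=> a x y xd yd i di.
  by rewrite [LHS](_ : _ = a * x i + y i)// xd// yd// mulr0 addr0.
- by move=> x y xd yd i di; rewrite [LHS](_ : _ = x i * y i)// xd// mul0r.
Qed.

Lemma initial_seqs_closed d : norm_closure (initial_seqs d) = initial_seqs d.
Proof.
apply/seteqP; split; last exact: norm_closure_sub.
move=> x /norm_closureP xd i di; apply/rnorm0_eq0/eqP.
rewrite eq_le rnorm_ge0 andbT; apply/ler_addgt0Pr => e e0; rewrite add0r.
have [y yd xy] := xd e e0; apply: le_trans (ltW xy).
by apply: le_trans (le_cnorm _ i); rewrite [(x - y) i](_ : _ = x i - y i)// yd// subr0.
Qed.

Lemma basis_bounded k : (fun n => (n == k)%:R : R[i]) \in @linfty_pred R.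
Proof. by rewrite inE; exists 1 => n; rewrite rnorm_nat; case: eqP. Qed.

Definition unit_seq k : linfty R := Linfty (basis_bounded k).

Lemma unit_seq_inj : injective unit_seq.
Proof.
move=> k l /(congr1 (fun x : linfty R => x k)) /= /eqP.
rewrite eqxx; have [//|_] := eqVneq k l.
by rewrite oner_eq0.
Qed.

Lemma initial_seqs_sum d x :
  initial_seqs d x -> x = \sum_(i < d) x i *: unit_seq i.
Proof.
move=> xd; apply: linftyE => n; rewrite linfty_sumE /=.
have [dn|nd] := leqP d n.
  rewrite xd// big1// => i _; rewrite gtn_eqF ?mulr0//.
  exact: leq_trans (ltn_ord i) dn.
rewrite (bigD1 (Ordinal nd))//= eqxx mulr1 big1 ?addr0// => i ni.
by rewrite (_ : (n == i) = false) ?mulr0//; rewrite eq_sym; apply/negbTE.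
Qed.

Lemma initial_seqs_dim d : has_dim (initial_seqs d) `I_d.
Proof.
exists (unit_seq @` `I_d); split.
- apply: independent_linearly => _ L [k kd <-] LE.
  exists k, d; split=> [f /LE[[l /= ld <-]]|]; last first.
    by rewrite /= eqxx gtn_eqF// subr0 /rnorm normr1.
  rewrite (inj_eq unit_seq_inj) /= => lk.
  by rewrite eq_sym (negbTE lk) gtn_eqF.
- apply/seteqP; split.
    apply: linear_span_min.
      exact/subalgebra_subspace/initial_seqs_subalgebra.
    move=> _ [k /= kd <-] i di /=.
    by rewrite gtn_eqF// (leq_trans kd).
  move=> x xd; rewrite (initial_seqs_sum xd).
  apply: linear_subspace_sum; first exact: linear_span_subspace.
  by move=> i; apply: linear_span_sub; exists i => //=.
- by apply: inj_card_eq => k l _ _; exact: unit_seq_inj.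
Qed.

(** The [d] coordinates are grouped into [n] blocks: singletons, and a last
    block holding the remaining ones.  Values on a block are distinct and
    nonzero, so that polynomials separate its points. *)
Definition block_fun n d j : nat -> R[i] :=
  fun i => if (i < d)%N && (minn i n.-1 == j) then i.+1%:R else 0.

Lemma block_subproof n d j : block_fun n d j \in @linfty_pred R.
Proof.
rewrite inE; exists d%:R => i; rewrite /block_fun; case: ifP => [/andP[id _]|_].
  by rewrite rnorm_nat ler_nat.
by rewrite rnorm0.
Qed.

Definition block n d j := Linfty (block_subproof n d j).

Variables n d : nat.
Hypotheses (n_gt0 : (0 < n)%N) (nd : (n <= d)%N).

Definition blocks := block n d @` `I_n.

Let minn_lt j : (j < n)%N -> minn j n.-1 = j.
Proof. by move=> jn; apply/minn_idPl; rewrite -ltnS prednK. Qed.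

Let block_diag j : (j < n)%N -> block n d j j = j.+1%:R.
Proof. by move=> jn; rewrite /= /block_fun (leq_trans jn nd) minn_lt// eqxx. Qed.

Let block_off i j : (i < n)%N -> i != j -> block n d j i = 0.
Proof. by move=> jn; rewrite /= /block_fun minn_lt// => /negbTE ->; rewrite andbF. Qed.

Lemma block_inj i j : (i < n)%N -> block n d i = block n d j -> i = j.
Proof.
move=> ni /(congr1 (fun x : linfty R => x i)); rewrite block_diag//.
have [//|ij] := eqVneq i j; rewrite block_off// => /eqP.
by rewrite pnatr_eq0.
Qed.

Lemma blocks_card : blocks #= `I_n.
Proof.
by apply: inj_card_eq => i j; rewrite !inE /= => ni nj; exact: block_inj.
Qed.

Lemma blocks_self_adjoint : blocks `<=` self_adjoint.
Proof.
move=> _ [j _ <-]; apply: linftyE => i /=; rewrite /block_fun.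
by case: ifP => _; rewrite ?conjC0// conjC_nat.
Qed.

Lemma blocks_independent : independent blocks.
Proof.
have block_d j : block n d j d = 0 by rewrite /= /block_fun ltnn.
move=> _ L [j /= jn <-] LS; exists j, d; split=> [f /LS[[i /= ni <-]] ij|].
  by rewrite block_d block_off//; apply: contra_neq ij => ->.
by rewrite block_diag// block_d subr0 rnorm_nat ler1n.
Qed.

Lemma alg_span_blocks : alg_span blocks = initial_seqs d.
Proof.
apply/seteqP; split.
  apply: alg_span_min; first exact: initial_seqs_subalgebra.
  by move=> _ [j _ <-] i di; rewrite /= /block_fun ltnNge di.
have Bs := alg_span_subalgebra blocks.
suff eB i : (i < d)%N -> alg_span blocks (unit_seq i).
  move=> x xd; rewrite (initial_seqs_sum xd).
  by apply: linear_subspace_sum; [exact: subalgebra_subspace|move=> i; exact: eB].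
move=> id; pose j := minn i n.-1.
have Bj : alg_span blocks (block n d j).
  apply: alg_span_sub; exists j => //=.
  by rewrite /j -[X in (_ < X)%N](prednK n_gt0) ltnS geq_minr.
(* The block and the roots of [p] leave the index [i] alone. *)
pose p : {poly R[i]} := \prod_(l < d | l != i :> nat) ('X - (l.+1%:R)%:P).
have [y By yE] := subalgebra_horner p Bs Bj.
have pE m : p.[m%:R] = \prod_(l < d | l != i :> nat) (m%:R - l.+1%:R).
  by rewrite horner_prod; apply: eq_bigr => l _; rewrite !hornerE.
have pi : (i.+1%:R : R[i]) * p.[i.+1%:R] != 0.
  rewrite mulf_neq0 ?pnatr_eq0// pE; apply/prodf_neq0 => l li.
  by rewrite subr_eq0 eqr_nat eqSS eq_sym.
have -> : unit_seq i = (i.+1%:R * p.[i.+1%:R])^-1 *: y + 0.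
  rewrite addr0; apply: linftyE => m.
  rewrite [RHS](_ : _ = (i.+1%:R * p.[i.+1%:R])^-1 * y m)// yE /= /block_fun.
  have [->|mi] := eqVneq m i; first by rewrite id eqxx /= mulVf.
  case: ifP => [/andP[md _]|_]; last by rewrite mul0r mulr0.
  by rewrite (pE m.+1) (bigD1 (Ordinal md) mi) /= subrr mul0r !mulr0.
by have [B0 BD _] := Bs; exact: BD.
Qed.

End FiniteDimensional.

(** * Chains of projections *)

Section ContinuumReals.
Context {R : realType}.

Definition ternary_sum (B : set nat) (N : nat) : R :=
  \sum_(0 <= k < N) (if `[< B k >] then 3^-1 ^+ k.+1 else 0).

Let third_gt0 k : 0 < (3^-1 : R) ^+ k. Proof. by rewrite exprn_gt0// invr_gt0. Qed.

Lemma ternary_sum_nd B m n : (m <= n)%N -> ternary_sum B m <= ternary_sum B n.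
Proof.
move=> mn; rewrite /ternary_sum [leRHS](big_cat_nat _ mn)//= lerDl sumr_ge0// => k _.
by case: ifP => // _; rewrite ltW.
Qed.

(** A new digit adds at most [3^-1 ^+ n.+1], which is what the second term
    loses. *)
Lemma ternary_sum_tail B m n : (m <= n)%N ->
  ternary_sum B n + 3^-1 ^+ n / 2 <= ternary_sum B m + 3^-1 ^+ m / 2.
Proof.
elim: n => [|n IHn]; first by rewrite leqn0 => /eqP ->.
rewrite leq_eqVlt => /orP[/eqP ->//|/IHn]; apply: le_trans.
rewrite /ternary_sum big_nat_recr//= -addrA lerD2l.
have := third_gt0 n; rewrite exprS; move: (3^-1 ^+ n) => t t0.
by case: ifP => _; lra.
Qed.

Definition ternary (B : set nat) : R := sup (range (ternary_sum B)).

Let ternary_ub B : has_ubound (range (ternary_sum B)).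
Proof.
exists (2^-1) => _ [n _ <-]; have := ternary_sum_tail B (leq0n n).
have := third_gt0 n; rewrite /ternary_sum [X in _ <= X + _]big_geq// expr0.
by set s := \sum_(_ <= _ < _) _; lra.
Qed.

Lemma ternary_ge B n : ternary_sum B n <= ternary B.
Proof. by apply: ub_le_sup => //; exists n. Qed.

Lemma ternary_le B n : ternary B <= ternary_sum B n + 3^-1 ^+ n / 2.
Proof.
apply: ge_sup => [|_ [m _ <-]]; first by exists (ternary_sum B 0), 0%N.
have [nm|mn] := leqP n m.
  by apply: le_trans (ternary_sum_tail B nm); rewrite lerDl divr_ge0// ltW.
apply: le_trans (ternary_sum_nd B (ltnW mn)) _.
by rewrite lerDl divr_ge0// ltW.
Qed.

(** At the first place where two digit sets differ, the unit gained by one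
    exceeds what the tail can bring to the other. *)
Lemma ternary_inj : injective ternary.
Proof.
have lt B C k : (forall i, (i < k)%N -> `[< B i >] = `[< C i >]) -> B k -> ~ C k ->
    ternary C < ternary B.
  move=> BC Bk Ck; apply: le_lt_trans (ternary_le C k.+1) _.
  apply: lt_le_trans (ternary_ge B k.+1).
  have sumS X : ternary_sum X k.+1 =
      ternary_sum X k + (if `[< X k >] then 3^-1 ^+ k.+1 else 0).
    by rewrite /ternary_sum big_nat_recr.
  have -> : ternary_sum C k.+1 = ternary_sum B k.
    rewrite sumS (asboolF Ck) addr0.
    by apply: eq_big_nat => i /andP[_ ik]; rewrite BC.
  rewrite sumS (asboolT Bk) ltrD2l ltr_pdivrMr//.
  by rewrite ltr_pMr// ltr1n.
move=> B C BC; apply: contrapT => /eqP nBC.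
have [k kP] : exists k, `[< B k >] != `[< C k >].
  apply: contra_neqP nBC => /forallNP H; apply/funext => i.
  have /negP := H i; rewrite negbK => /eqP E.
  apply: propext.
  by split=> /asboolT; [rewrite E|rewrite -E] => /asboolW.
have [m mP mmin] := ex_minnP (ex_intro (fun k => `[< B k >] != `[< C k >]) k kP).
have low i : (i < m)%N -> `[< B i >] = `[< C i >].
  by move=> im; apply/eqP; apply: contraTT im => /mmin; rewrite -leqNgt.
case: (asboolP (B m)) mP => Bm; case: (asboolP (C m)) => // Cm _.
  by have := lt _ _ _ low Bm Cm; rewrite BC ltxx.
have := lt C B m (fun i im => esym (low i im)) Cm Bm.
by rewrite BC ltxx.
Qed.

Lemma ternary_ge0 B : 0 <= ternary B.
Proof. by apply: le_trans (ternary_ge B 0); rewrite /ternary_sum big_geq. Qed.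

Lemma ternary_le_half B : ternary B <= 2^-1.
Proof.
have := ternary_le B 0; rewrite /ternary_sum big_geq// expr0.
by rewrite add0r mul1r.
Qed.

(** A bounded sequence is determined by the rational lower cuts of the real and
    imaginary parts of its entries. *)
Lemma card_linfty_continuum : [set: linfty R] #<= continuum.
Proof.
pose cut (x : linfty R) : set nat :=
  [set c | exists b n (q : rat), c = pickle (b, n, q) /\
    ratr q < (if b then complex.Re (x n) else complex.Im (x n))].
have cutE (x : linfty R) b n (q : rat) : cut x (pickle (b, n, q)) <->
    ratr q < (if b then complex.Re (x n) else complex.Im (x n)).
  split=> [[b' [n' [q' [/(pcan_inj pickleK)[-> -> ->]]]]]//|H].
  by exists b, n, q.
have le (r s : R) : (forall q : rat, ratr q < r -> ratr q < s) -> r <= s.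
  move=> rs; rewrite leNgt; apply/negP => /rat_in_itvoo[q].
  by rewrite in_itv/= => /andP[sq /rs]; rewrite ltNge ltW.
have eq (r s : R) : (forall q : rat, (ratr q < r) <-> (ratr q < s)) -> r = s.
  by move=> rs; apply/eqP; rewrite eq_le !le// => q; rewrite rs.
apply: (@injection_card_le _ _ _ _ cut) => // x y _ _ xy.
apply: linftyE => n; apply/eqP; rewrite eq_complex; apply/andP; split; apply/eqP.
  by apply: eq => q; rewrite -(cutE x true) xy; exact: (cutE y true).
by apply: eq => q; rewrite -(cutE x false) xy; exact: (cutE y false).
Qed.

End ContinuumReals.

Section Chain.
Context {R : realType}.
Implicit Types (r s : R) (D : set R).

(** The indicator of the rationals below [r], the index set being identified
    with the rationals: these projections form a chain of the order type of the
    reals. *)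
Definition cut_fun r : nat -> R[i] :=
  fun n => if unpickle n is Some q then (ratr (q : rat) < r)%R%:R else 0.

Lemma cut_subproof r : cut_fun r \in @linfty_pred R.
Proof.
rewrite inE; exists 1 => n; rewrite /cut_fun; case: unpickle => [q|].
  by rewrite rnorm_nat; case: (_ < _).
by rewrite rnorm0.
Qed.

Definition cut r := Linfty (cut_subproof r).

Lemma cutE r (q : rat) : cut r (pickle q) = (ratr q < r)%R%:R.
Proof. by rewrite /= /cut_fun pickleK. Qed.

Lemma cut_inj : injective cut.
Proof.
have le r s : cut r = cut s -> r <= s.
  move=> rs; rewrite leNgt; apply/negP => /rat_in_itvoo[q].
  rewrite in_itv/= => /andP[sq qr].
  have := congr1 (fun x : linfty R => x (pickle q)) rs; rewrite !cutE qr ltNge ltW//=.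
  by move/eqP; rewrite oner_eq0.
by move=> r s rs; apply/eqP; rewrite eq_le !le.
Qed.

Lemma cutM r s : cut r * cut s = cut (Num.min r s).
Proof.
apply: linftyE => n; rewrite [LHS](_ : _ = cut_fun r n * cut_fun s n)//=.
rewrite /cut_fun; case: unpickle => [q|]; last by rewrite mul0r.
by rewrite -natrM mulnb lt_min.
Qed.

Variable D : set R.

Lemma cuts_self_adjoint : cut @` D `<=` self_adjoint.
Proof.
move=> _ [r _ <-]; apply: linftyE => n /=; rewrite /cut_fun.
by case: unpickle => [q|]; rewrite ?conjC0// conjC_nat.
Qed.

Lemma cuts_card : cut @` D #= D.
Proof. by apply: inj_card_eq => r s _ _; exact: cut_inj. Qed.

(** Two rationals close to [r], one on each side, are separated by the cut at
    [r] and by no other cut from a given finite set. *)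
Lemma cuts_independent : independent (cut @` D).
Proof.
move=> _ L [r _ <-] LD.
have [a [b [ar rb ab]]] : exists a b, [/\ a < r, r < b &
    forall f (p q : rat), f \in L -> a < ratr p < b -> a < ratr q < b ->
    f (pickle p) = f (pickle q)].
  elim: L LD => [|f L IHL] LD; first by exists (r - 1), (r + 1); split; [lra|lra|].
  have [|a [b [ar rb ab]]] := IHL; first by move=> g gL; apply: LD; rewrite inE gL orbT.
  have [[s _ <-] sr] := LD f (mem_head _ _).
  have {}sr : s != r by apply: contra_neq sr => ->.
  have [rs|{}sr|/eqP] := ltgtP r s; last by rewrite eq_sym (negbTE sr).
    exists a, (Num.min b s); split=> [//||g p q]; first by rewrite lt_min rb.
    rewrite inE !lt_min => /orP[/eqP ->|gL] /and3P[ap pb ps] /and3P[aq qb qs].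
      by rewrite !cutE ps qs.
    by apply: ab => //; apply/andP.
  exists (Num.max a s), b; split=> [|//|g p q]; first by rewrite gt_max ar.
  rewrite inE !gt_max => /orP[/eqP ->|gL] /andP[/andP[ap sp] pb] /andP[/andP[aq sq] qb].
    by rewrite !cutE !ltNge !ltW.
  by apply: ab => //; apply/andP.
have [p] := rat_in_itvoo ar; rewrite in_itv/= => /andP[ap pr].
have [q] := rat_in_itvoo rb; rewrite in_itv/= => /andP[rq qb].
exists (pickle p), (pickle q); split=> [f fL|].
  by apply: ab => //; apply/andP; split=> //; [exact: lt_trans rb|exact: lt_trans rq].
by rewrite /cut_fun !pickleK pr ltNge (ltW rq)/= subr0 /rnorm normr1.
Qed.

(** A chain of projections is closed under products, so its span is already an
    algebra and its Hamel dimension is its cardinality. *)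
Lemma alg_span_cuts : alg_span (cut @` D) = linear_span (cut @` D).
Proof.
congr linear_span; apply/seteqP; split; last exact: finite_products_sub.
apply: finite_products_min => // _ _ [r Dr <-] [s Ds <-].
exists (Num.min r s); last by rewrite cutM.
by rewrite /Num.min; case: ifP.
Qed.

Lemma cuts_dim : has_dim (alg_span (cut @` D)) D.
Proof.
exists (cut @` D); split; last exact: cuts_card.
- exact/independent_linearly/cuts_independent.
- by rewrite alg_span_cuts.
Qed.

End Chain.

(** * Coordinates of a cube *)

Section Cube.
Context {R : realType}.
Implicit Types (t u : set nat) (N k : nat) (D : set (set nat)).

Definition prefix t N : N.-tuple bool := [tuple `[< t i >] | i < N].

Lemma prefix_inj_on (L : seq (set nat)) : exists N,
  forall t u, t \in L -> u \in L -> prefix t N = prefix u N -> t = u.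
Proof.
have /choice[m mP] : forall tu : set nat * set nat, exists m, forall N,
    (m <= N)%N -> prefix tu.1 N = prefix tu.2 N -> tu.1 = tu.2.
  move=> [t u] /=; have [->|/eqP tu] := pselect (t = u); first by exists 0%N.
  have [i ti] : exists i, `[< t i >] != `[< u i >].
    apply: contra_neqP tu => /forallNP H; apply/funext => i.
    have /negP := H i; rewrite negbK => /eqP E.
    apply: propext.
    by split=> /asboolT; [rewrite E|rewrite -E] => /asboolW.
  exists i.+1 => N iN E; exfalso; move/eqP : ti; apply.
  have := congr1 (fun w => tnth w (Ordinal iN)) E.
  by rewrite !tnth_mktuple.
exists (\max_(t <- L) \max_(u <- L) m (t, u)) => t u tL uL.
apply: (mP (t, u)).
apply: leq_trans (leq_bigmax_seq (P := xpredT) _ tL isT).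
exact: (leq_bigmax_seq (P := xpredT) (F := fun u => m (t, u)) _ uL isT).
Qed.

(** A point of the index set is a finite table, prescribing the value of every
    coordinate according to its first [N] bits, as a multiple of [1 / k]. *)
Definition table : countType := {Nk : nat * nat & {ffun Nk.1.-tuple bool -> 'I_Nk.2.+1}}.

Definition table_value t (c : table) : R :=
  let: existT Nk h := c in (h (prefix t Nk.1))%:R / Nk.2%:R.

Definition cube_value t (n : nat) : R :=
  if (unpickle n : option table) is Some c then table_value t c else 0.

Lemma cube_value_itv t n : 0 <= cube_value t n <= 1.
Proof.
rewrite /cube_value; case: unpickle => [[[N k] h]|]; last by rewrite lexx ler01.
rewrite /= divr_ge0//=; case: k h => [|k] h; first by rewrite invr0 mulr0.
by rewrite ler_pdivrMr ?mul1r ?ltr0n// ler_nat -ltnS ltn_ord.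
Qed.

(** An independent family of continuum many functions on a countable set:
    finitely many coordinates can be prescribed at will on the grid of mesh
    [1 / k], since they differ by their first [N] bits for some [N]. *)
Lemma cube_point (L : seq (set nat)) k (v : set nat -> nat) :
  (forall t, (v t <= k)%N) ->
  exists p, forall t, t \in L -> cube_value t p = (v t)%:R / k%:R.
Proof.
move=> vk; have [N Ninj] := prefix_inj_on L.
pose h : {ffun N.-tuple bool -> 'I_k.+1} :=
  [ffun w => inord (v (nth set0 L (find (fun t => prefix t N == w) L)))].
pose c : table := existT (fun Nk : nat * nat => {ffun Nk.1.-tuple bool -> 'I_Nk.2.+1}) (N, k) h.
exists (pickle c) => t tL; rewrite /cube_value pickleK /= ffunE.
have ht : has (fun u => prefix u N == prefix t N) L by apply/hasP; exists t.
rewrite (Ninj _ t (mem_nth _ _) tL); last exact/eqP/(nth_find set0 ht).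
  by rewrite inordK// ltnS.
by rewrite -has_find.
Qed.

Lemma cube_subproof t : (fun n => (cube_value t n)%:C : R[i]) \in @linfty_pred R.
Proof.
rewrite inE; exists 1 => n; have /andP[v0 v1] := cube_value_itv t n.
by rewrite rnorm_real ger0_norm.
Qed.

Definition cube t := Linfty (cube_subproof t).

Lemma cubeE t n : cube t n = (cube_value t n)%:C. Proof. by []. Qed.

Lemma rnorm_cubeB t p q : rnorm (cube t p - cube t q) = `|cube_value t p - cube_value t q|.
Proof. by rewrite !cubeE -rmorphB rnorm_real. Qed.

Lemma cube_inj : injective cube.
Proof.
move=> t u tu; apply: contrapT => /eqP nu.
have [p pE] := @cube_point [:: t; u] 1 (fun s => (s == t)) (fun s => leq_b1 _).
have := congr1 (fun x : linfty R => x p) tu; rewrite !cubeE => /complexI.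
rewrite !pE ?inE ?eqxx ?orbT// eq_sym (negbTE nu) => /eqP.
by rewrite divr1 mul0r oner_eq0.
Qed.

Lemma cube_star t : star (cube t) = cube t.
Proof. by apply: linftyE => n; exact: conjc_real. Qed.

Lemma cubes_preimage_seq (L : seq (linfty R)) : (forall f, f \in L -> range cube f) ->
  exists U : seq (set nat), L = map cube U.
Proof.
elim: L => [|f L IHL] LS; first by exists [::].
have [|U ->] := IHL; first by move=> g gL; apply: LS; rewrite inE gL orbT.
by have [t _ <-] := LS f (mem_head _ _); exists (t :: U).
Qed.

Variable D : set (set nat).

Lemma cubes_card : cube @` D #= D.
Proof. by apply: inj_card_eq => t u _ _; exact: cube_inj. Qed.

Lemma cubes_self_adjoint : cube @` D `<=` self_adjoint.
Proof. by move=> _ [t _ <-]; exact: cube_star. Qed.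

Lemma cubes_independent : independent (cube @` D).
Proof.
move=> _ L [t _ <-] LD.
have [|U LU] := @cubes_preimage_seq L.
  by move=> f /LD[[u _ <-] _]; exists u.
have tU : t \notin U.
  apply/negP => tU; have [|_] := LD (cube t); first by rewrite LU map_f.
  by rewrite eqxx.
have [p pE] := @cube_point (t :: U) 1 (fun s => (s == t)) (fun s => leq_b1 _).
have [q qE] := @cube_point (t :: U) 1 (fun s => 0%N) (fun s => isT).
exists p, q; split=> [f|]; last first.
  by rewrite rnorm_cubeB pE ?qE ?mem_head// eqxx divr1 mul0r subr0 normr1.
rewrite LU => /mapP[u uU ->]; rewrite !cubeE pE ?qE ?inE ?uU ?orbT//.
have -> : (u == t) = false by apply: contraNF tU => /eqP <-.
by rewrite mul0r.
Qed.

End Cube.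

(** * Hamel dimensions of the algebras generated by cube coordinates *)

Section Dimensions.
Context {R : realType}.
Implicit Types (x y : linfty R) (D : set (set nat)).

Lemma poly_eq0_inverses (p : {poly R[i]}) :
  (forall m : nat, root p m.+1%:R^-1) -> p = 0.
Proof.
move=> p0; apply/eqP; apply: contraT => pn0.
pose rs : seq R[i] := [seq m.+1%:R^-1 | m <- iota 0 (size p)].
have urs : uniq rs.
  rewrite map_inj_uniq ?iota_uniq// => i j /invr_inj/eqP.
  by rewrite eqr_nat eqSS => /eqP.
have := max_poly_roots pn0 _ urs; rewrite size_map size_iota ltnn; apply.
by apply/allP => _ /mapP[m _ ->]; exact: p0.
Qed.

(** A coordinate takes infinitely many values, so that polynomial identities
    between its powers are formal. *)
Lemma cube_inverse (t : set nat) (m : nat) : exists n, @cube R t n = m.+1%:R^-1.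
Proof.
have [n nE] := @cube_point R [:: t] m.+1 (fun=> 1%N) (fun=> ltn0Sn m).
exists n; rewrite cubeE nE ?mem_head// mul1r fmorphV.
by rewrite rmorph_nat.
Qed.

Section Powers.
Variable t : set nat.

Lemma cube_expE k n : (@cube R t ^+ k.+1) n = (@cube R t n) ^+ k.+1.
Proof.
elim: k => [|k IHk]; first by rewrite !expr1.
by rewrite exprS [RHS]exprS -IHk.
Qed.

Lemma cube_powers_poly n (a : 'I_n -> R[i]) (k : 'I_n -> nat) :
  \sum_i a i *: @cube R t ^+ (k i).+1 = 0 -> \sum_i a i *: 'X^(k i) = 0 :> {poly R[i]}.
Proof.
move=> a0; apply: poly_eq0_inverses => m; have [p pE] := cube_inverse t m.
have := congr1 (fun x : linfty R => x p) a0; rewrite linfty_sumE => E.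
have m0 : (m.+1%:R^-1 : R[i]) != 0 by rewrite invr_eq0 pnatr_eq0.
apply/rootP; apply: (mulfI m0); rewrite mulr0 -[RHS]E horner_sum mulr_sumr.
apply: eq_bigr => i _; rewrite cube_expE pE hornerZ hornerXn exprS.
by rewrite mulrCA.
Qed.

Lemma cube_exp_inj : injective (fun k => @cube R t ^+ k.+1).
Proof.
move=> k l kl; pose a (i : 'I_2) : R[i] := if val i == 0%N then 1 else -1.
pose e (i : 'I_2) := if val i == 0%N then k else l.
have := @cube_powers_poly 2 a e; rewrite !big_ord_recl !big_ord0 /a /e /=.
rewrite !scale1r !scaleN1r kl !addr0 subrr => /(_ erefl)/eqP.
rewrite subr_eq0 => /eqP /(congr1 (fun p : {poly R[i]} => size p)).
by rewrite !size_polyXn => -[].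
Qed.

Lemma cube_powers_independent :
  linearly_independent (range (fun k => @cube R t ^+ k.+1)).
Proof.
move=> n a e einj Ee a0.
have /choice[k kE] : forall i, exists k, @cube R t ^+ k.+1 = e i.
  by move=> i; have [k _ <-] := Ee i; exists k.
have kinj : injective k by move=> i j ij; apply: einj; rewrite -!kE ij.
have p0 : \sum_i a i *: 'X^(k i) = 0 :> {poly R[i]}.
  apply: cube_powers_poly; rewrite -[RHS]a0.
  by apply: eq_bigr => i _; rewrite kE.
move=> i; have := congr1 (fun p : {poly R[i]} => p`_(k i)) p0.
rewrite coef_sum coef0 (bigD1 i)//= coefZ coefXn eqxx mulr1 big1 ?addr0// => j ji.
by rewrite coefZ coefXn (inj_eq kinj) eq_sym (negbTE ji) mulr0.
Qed.

End Powers.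

Lemma finite_products_exp (S : set (linfty R)) x k : S x -> finite_products S (x ^+ k.+1).
Proof.
move=> Sx; exists (nseq k.+1 x); split=> // [s|].
  by rewrite mem_nseq => /andP[_ /eqP ->].
by rewrite big_nseq -Monoid.iteropE.
Qed.

Lemma countable_finite_products (S : set (linfty R)) :
  countable S -> countable (finite_products S).
Proof.
move=> Sc; have [e Se] := countable_enum 0 Sc.
have sub : finite_products S `<=`
    (fun l : seq nat => \prod_(i <- l) e i) @` [set: seq nat].
  move=> _ [l [_ lS ->]]; elim: l lS => [|x l IHl] lS.
    by exists [::] => //; rewrite !big_nil.
  have [|m _ mE] := IHl; first by move=> s sl; apply: lS; rewrite inE sl orbT.
  have [i _ ix] := Se x (lS x (mem_head _ _)).
  by exists (i :: m) => //; rewrite !big_cons mE ix.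
apply: sub_countable (subset_card_le sub) _.
apply: card_le_trans (card_image_le _ _) _; exact: countableP.
Qed.

Lemma cubes_countable_dim D : D !=set0 -> countable D ->
  has_dim (alg_span (@cube R @` D)) aleph0.
Proof.
move=> [t Dt] Dc; set S := cube @` D.
have [|E [E0E EG Eind ES]] := @basis_extension _ _
  (range (fun k => @cube R t ^+ k.+1)) (finite_products S) _
  (@cube_powers_independent t).
  by move=> _ [k _ <-]; apply: finite_products_exp; exists t.
exists E; split=> //; rewrite card_eq_le; apply/andP; split.
  apply: sub_countable (subset_card_le EG) _; apply: countable_finite_products.
  exact: card_le_trans (card_image_le _ _) Dc.
apply: card_le_trans (subset_card_le E0E).
apply: (@injection_card_le _ _ _ _ (fun k => cube t ^+ k.+1)) => [k _|k l _ _].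
  by exists k.
exact: cube_exp_inj.
Qed.

(** Continuum many ratios in the interval from 1/4 to 3/8: the upper bound 1/2
    makes the geometric series converge and the lower bound keeps them nonzero. *)
Definition ratio (B : set nat) : R := (1 + ternary B) / 4.

Lemma ratio_inj : injective ratio.
Proof.
move=> B C /(mulIf (invr_neq0 _)) BC; apply: (@ternary_inj R).
by apply: (addrI 1); apply: BC; rewrite pnatr_eq0.
Qed.

Lemma ratio_gt0 B : 0 < ratio B.
Proof. by rewrite divr_gt0// ltr_wpDr// ternary_ge0. Qed.

Lemma ratio_le B : ratio B <= 2^-1.
Proof. by have := @ternary_le_half R B; rewrite /ratio; lra. Qed.

Variable t : set nat.

Let denom_gt0 B n : 2^-1 <= 1 - ratio B * cube_value t n.
Proof.
have /andP[v0 v1] := @cube_value_itv R t n; have := ratio_le B.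
have := ratio_gt0 B; nra.
Qed.

Definition geometric_fun B n : R :=
  ratio B * cube_value t n / (1 - ratio B * cube_value t n).

Lemma geometric_subproof B : (fun n => (geometric_fun B n)%:C : R[i]) \in @linfty_pred R.
Proof.
rewrite inE; exists 1 => n; rewrite rnorm_real ger0_norm /geometric_fun.
  rewrite ler_pdivrMr ?mul1r; last exact: lt_le_trans (denom_gt0 B n).
  have /andP[v0 v1] := @cube_value_itv R t n; have := ratio_le B.
  have := ratio_gt0 B; nra.
have /andP[v0 v1] := @cube_value_itv R t n.
apply: divr_ge0; first exact: mulr_ge0 (ltW (ratio_gt0 B)) v0.
by apply: le_trans (denom_gt0 B n); rewrite invr_ge0.
Qed.

(** The sum of the geometric series [\sum_k (ratio B *: cube t) ^+ k.+1], an
    element of the closed algebra generated by [cube t]. *)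
Definition geometric B := Linfty (geometric_subproof B).

Let x B : linfty R := (ratio B)%:C *: cube t.

Lemma geometric_fixpoint B : geometric B = x B + x B * geometric B.
Proof.
apply: linftyE => n.
rewrite [LHS](_ : _ = (geometric_fun B n)%:C)//.
rewrite [RHS](_ : _ = (ratio B)%:C * (cube_value t n)%:C +
  (ratio B)%:C * (cube_value t n)%:C * (geometric_fun B n)%:C)//.
rewrite -!rmorphM -rmorphD; congr (_%:C); rewrite /geometric_fun.
have : 1 - ratio B * cube_value t n != 0.
  by rewrite gt_eqF// (lt_le_trans _ (denom_gt0 B n)).
by move=> d0; field.
Qed.

Lemma cnorm_x B : cnorm (x B) <= 2^-1.
Proof.
apply: linfty_norm_le => n.
rewrite [X in rnorm X](_ : _ = (ratio B)%:C * (cube_value t n)%:C)//.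
rewrite -rmorphM rnorm_real; have /andP[v0 v1] := @cube_value_itv R t n.
rewrite ger0_norm; last exact: mulr_ge0 (ltW (ratio_gt0 B)) v0.
by have := ratio_le B; have := ratio_gt0 B; nra.
Qed.

(** Iterating the fixpoint equation, a contraction of factor 1/2, from 0. *)
Lemma geometric_closure (B : set (linfty R)) C : subalgebra B -> B (cube t) ->
  norm_closure B (geometric C).
Proof.
move=> [B0 BD BM] Bt; have Bx : B (x C).
  by rewrite /x -[_ *: _]addr0; exact: BD.
have approx N : exists2 y, B y &
    cnorm (geometric C - y) <= 2^-1 ^+ N * cnorm (geometric C).
  elim: N => [|N [y By yN]]; first by exists 0; rewrite // subr0 expr0 mul1r.
  exists (x C + x C * y).
    by rewrite -[x C]scale1r; apply: BD => //; rewrite scale1r; exact: BM.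
  rewrite {1}geometric_fixpoint opprD addrACA subrr add0r -mulrBr.
  rewrite exprS -mulrA (le_trans (cnormM _ _))//.
  by rewrite ler_pM ?cnorm_ge0// cnorm_x.
apply/norm_closureP => e e0; set c := cnorm (geometric C) in approx.
have [N Ne] : exists N, 2^-1 ^+ N * c < e.
  have c1 : 0 < c + 1 by rewrite ltr_wpDl ?cnorm_ge0.
  have : (fun N => (2^-1 : R) ^+ N) @ \oo --> (0 : R).
    by apply: cvg_expr; rewrite ger0_norm ?invr_ge0// invf_lt1// ltr1n.
  move=> /cvgrPdist_lt/(_ _ (divr_gt0 e0 c1))[N _ /(_ N (leqnn N))].
  rewrite /= sub0r normrN ger0_norm ?exprn_ge0 ?invr_ge0// ltr_pdivlMr// => H.
  exists N; apply: le_lt_trans H.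
  by rewrite ler_wpM2l ?exprn_ge0 ?invr_ge0// lerDl.
by have [y By yN] := approx N; exists y => //; exact: le_lt_trans Ne.
Qed.

(** Distinct ratios give rational functions with distinct poles: clearing
    denominators yields a polynomial with infinitely many zeros, and evaluation
    at the pole of one term kills all the others. *)
Lemma geometric_sum_eq0 n (a : 'I_n -> R[i]) (B : 'I_n -> set nat) :
  injective B -> \sum_i a i *: geometric (B i) = 0 -> forall i, a i = 0.
Proof.
move=> Binj a0.
pose l i : R[i] := (ratio (B i))%:C.
have l0 i : l i != 0 by rewrite /l (inj_eq (@complexI R) _ 0) gt_eqF// ratio_gt0.
pose p : {poly R[i]} := \sum_i (a i * l i) *: \prod_(j | j != i) (1 - l j *: 'X).
have p0 : p = 0.
  apply: poly_eq0_inverses => m; have [q qE] := cube_inverse t m.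
  have := congr1 (fun x : linfty R => x q) a0; rewrite linfty_sumE => E.
  have m0 : (m.+1%:R^-1 : R[i]) != 0 by rewrite invr_eq0 pnatr_eq0.
  have d0 i : 1 - l i * m.+1%:R^-1 != 0.
    rewrite -qE cubeE /l -rmorphM -(rmorph1 (real_complex R)) -rmorphB.
    rewrite (inj_eq (@complexI R) _ 0) gt_eqF//.
    exact: lt_le_trans (denom_gt0 _ _).
  apply/rootP; apply: (mulfI m0); rewrite mulr0.
  rewrite -[RHS](mulr0 (\prod_j (1 - l j * m.+1%:R^-1))) -[X in _ = _ * X]E.
  rewrite horner_sum !mulr_sumr; apply: eq_bigr => i _.
  have -> : geometric (B i) q = l i * m.+1%:R^-1 / (1 - l i * m.+1%:R^-1).
    rewrite -qE cubeE /l -rmorphM -(rmorph1 (real_complex R)) -rmorphB.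
    by rewrite -fmorphV -rmorphM.
  rewrite hornerZ horner_prod [in RHS](bigD1 i)//=.
  under eq_bigr do rewrite !hornerE.
  move: (\prod_(j < n | j != i) _) (d0 i) => P; move: (m.+1%:R^-1) (l i) => w li d.
  by field.
move=> i; have := congr1 (fun p : {poly R[i]} => p.[(l i)^-1]) p0.
rewrite horner0 horner_sum (bigD1 i)//= [X in _ + X]big1 ?addr0; last first.
  move=> j ji; rewrite hornerZ horner_prod (bigD1 i) 1?eq_sym//=.
  have -> : (1 - l i *: 'X).[(l i)^-1] = 0 by rewrite !hornerE divff// subrr.
  by rewrite mul0r mulr0.
rewrite hornerZ horner_prod => /eqP; rewrite mulf_eq0 mulf_eq0 (negbTE (l0 i)) orbF.
move=> /orP[/eqP //|]; rewrite prodf_seq_eq0 => /hasP[j _ /andP[ji]].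
rewrite !hornerE subr_eq0 => /eqP/esym/divr1_eq/complexI/ratio_inj/Binj ij.
by rewrite ij eqxx in ji.
Qed.

Lemma geometric_inj : injective geometric.
Proof.
move=> B C BC; apply: contrapT => nBC.
pose a (i : 'I_2) : R[i] := if val i == 0%N then 1 else -1.
pose e (i : 'I_2) := if val i == 0%N then B else C.
have einj : injective e.
  by move=> [[|[|//]] ?] [[|[|//]] ?] /= E; apply/val_inj => //=; exfalso; apply: nBC.
have := @geometric_sum_eq0 2 a e einj; rewrite !big_ord_recl !big_ord0 /a /e /=.
rewrite BC scale1r scaleN1r addr0 subrr => /(_ erefl ord0) /eqP.
by rewrite oner_eq0.
Qed.

Lemma geometric_independent : linearly_independent (range geometric).
Proof.
move=> n a e einj Ee a0.
have /choice[B BE] : forall i, exists B, geometric B = e i.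
  by move=> i; have [B _ <-] := Ee i; exists B.
apply: (@geometric_sum_eq0 n a B) => [i j ij|].
  by apply: einj; rewrite -!BE ij.
by under eq_bigr do rewrite BE.
Qed.

End Dimensions.

(** The geometric series bound the dimension from below, and the number of
    bounded sequences bounds it from above. *)
Lemma cubes_closure_dim (R : realType) (D : set (set nat)) : D !=set0 ->
  has_dim (norm_closure (alg_span (@cube R @` D))) continuum.
Proof.
move=> [t Dt]; set B := norm_closure _.
have Bs : subalgebra B by apply: norm_closure_subalgebra; exact: alg_span_subalgebra.
have [|E [E0E EB Eind ES]] := @basis_extension _ _ (range (@geometric R t)) B _
  (@geometric_independent R t).
  move=> _ [C _ <-]; apply: geometric_closure; first exact: alg_span_subalgebra.
  by apply: alg_span_sub; exists t.
exists E; split=> //.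
  rewrite ES; apply/seteqP; split; last exact: linear_span_sub.
  by apply: linear_span_min => //; exact: subalgebra_subspace.
rewrite card_eq_le; apply/andP; split.
  exact: card_le_trans (card_leT E) card_linfty_continuum.
apply: card_le_trans (subset_card_le E0E).
apply: (@injection_card_le _ _ _ _ (@geometric R t)) => [C _|C C' _ _].
  by exists C.
exact: geometric_inj.
Qed.

(** * Invariance of dimension *)

Section Dimension.
Context {R : realType}.
Implicit Types (f : linfty R).

(** No integer lies between [y] and [z]. *)
Lemma eq_floor_far (y z e : R) : (forall m : int, e <= `|y - m%:~R|) -> `|y - z| < e ->
  Num.floor z = Num.floor y.
Proof.
move=> far yz; apply: floor_def.
have := ge_floor y; have := lt_succ_floor y; rewrite !rmorphD !rmorph1.
have := far (Num.floor y); have := far (Num.floor y + 1); rewrite rmorphD rmorph1.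
move: (Num.floor y)%:~R yz => m; rewrite ltr_norml !ler_normr.
move=> /andP[yz1 yz2] /orP[] m1 /orP[] m2 m3 m4; apply/andP; split; lra.
Qed.

Lemma self_adjoint_seqE f n : star f = f -> f n = (complex.Re (f n))%:C.
Proof.
move=> /(congr1 (fun x : linfty R => x n)) /=; case: (f n) => a b [] /eqP.
by rewrite eq_sym -subr_eq0 opprK -mulr2n mulrn_eq0/= => /eqP ->.
Qed.

Lemma rnorm_self_adjointB f p q : star f = f ->
  rnorm (f p - f q) = `|complex.Re (f p) - complex.Re (f q)|.
Proof.
move=> fs; rewrite (self_adjoint_seqE p fs) (self_adjoint_seqE q fs).
by rewrite -rmorphB rnorm_real.
Qed.

(** Consider the [n] grids of hyperplanes with integer coordinates, shifted by
    [c / n].  A coordinate within [1 / (2 n)] of the hyperplanes of two shifts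
    would put these shifts less than [1 / n] apart, so it excludes at most one
    shift, and there are fewer coordinates than shifts. *)
Lemma pigeonhole_shift (T : eqType) (n : nat) (F : seq T) (y : T -> R) :
  (size F < n)%N -> exists c : 'I_n, forall f : T, f \in F -> forall m : int,
    (2 * n%:R)^-1 <= `|y f - c%:R / n%:R - m%:~R|.
Proof.
move=> Fn; have n0 : 0 < n%:R :> R by rewrite ltr0n (leq_ltn_trans _ Fn).
apply: contrapT => /forallNP no.
have /choice[g gP] : forall c : 'I_n, exists f : T, f \in F /\ exists m : int,
    `|y f - c%:R / n%:R - m%:~R| < (2 * n%:R)^-1.
  move=> c; apply: contrapT => H; apply: (no c) => f fF m.
  by rewrite leNgt; apply/negP => lt; apply: H; exists f; split=> //; exists m.
have idx c : (index (g c) F < size F)%N by rewrite index_mem; exact: (gP c).1.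
pose h c := Ordinal (idx c).
have /injectivePn[c [c' cc' hcc']] : ~~ injectiveb h.
  apply/negP => /injectiveP/leq_card; rewrite !card_ord leqNgt => /negP; exact.
have gE : g c = g c'.
  have [gc gc'] := ((gP c).1, (gP c').1).
  have gi : index (g c) F = index (g c') F := congr1 val hcc'.
  by rewrite -(nth_index (g c) gc) gi nth_index.
have [_ [m Hm]] := gP c; have [_ [m' Hm']] := gP c'.
rewrite -gE in Hm'.
have : `|((c' : nat)%:R - (c : nat)%:R + n%:R * (m' - m)%:~R) : R| < 1.
  have -> : (c' : nat)%:R - (c : nat)%:R + n%:R * (m' - m)%:~R =
      n%:R * ((y (g c) - c%:R / n%:R - m%:~R) - (y (g c) - c'%:R / n%:R - m'%:~R)) :> R.
    by rewrite rmorphB /=; field; rewrite gt_eqF.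
  rewrite normrM (gtr0_norm n0) -ltr_pdivlMl// mulr1.
  rewrite (le_lt_trans (ler_normB _ _))//.
  have E : (n%:R)^-1 = (2 * n%:R)^-1 + (2 * n%:R)^-1 :> R.
    by field; rewrite gt_eqF.
  by rewrite [ltRHS]E; exact: ltrD.
have -> : (c' : nat)%:R - (c : nat)%:R + n%:R * (m' - m)%:~R =
    ((c' : nat)%:Z - (c : nat)%:Z + n%:Z * (m' - m))%:~R :> R.
  by rewrite [RHS]intrD intrM [X in _ = X + _]intrB.
rewrite -intr_norm -[X in _ < X](rmorph1 intr) ltr_int => lt1.
have E : c'%:Z - c%:Z + n%:Z * (m' - m) = 0.
  by move: lt1; rewrite ltr_norml => /andP[]; lia.
move/negP : cc'; apply.
have := ltn_ord c; have := ltn_ord c' => c'n cn.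
apply/eqP/val_inj => /=; apply/eqP; move: E; move: (m' - m) => z.
have [->|z0] := eqVneq z 0; first by rewrite mulr0 addr0 => /subr0_eq/eqP; rewrite eq_sym.
nia.
Qed.

(** Lebesgue's covering argument for the impossibility of embedding an [n]-cube
    in a space of smaller dimension [m], the embedding being [F].  For each of
    the [n] shifts [c], cut the target space into bricks of side [s], so small
    that no brick meets the images of two opposite faces of the cube.  Let
    [u c] be 1 at the points of the cube whose brick of shift [c] meets the face
    [x_c = 1]; it is 0 on the face [x_c = 0].  By [kuhn] a small cell has all the
    [u c] non constant.  But by [pigeonhole_shift] the image of this cell stays
    away from the walls of the bricks of some shift [c], and then [u c] is
    constant on it. *)
Lemma invariance_of_dimension (n : nat) (t : 'I_n -> set nat) (F : seq (linfty R)) :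
  injective t -> (forall f, f \in F -> star f = f) ->
  (forall f, f \in F -> uniform_over (range cube) f) ->
  (forall l, uniform_over [set` F] (cube (t l))) -> (n <= size F)%N.
Proof.
move=> tinj Fsa Fuc tuc; rewrite leqNgt; apply/negP => Fn.
have n0 : 0 < n%:R :> R by rewrite ltr0n (leq_ltn_trans _ Fn).
have [s [s0 sP]] : exists s : R, 0 < s /\ forall p q, close_on F s p q ->
    forall l, `|cube_value (t l) p - cube_value (t l) q| < 1 :> R.
  have [|L [s [s0 LF H]]] := @uniform_over_seq R [set` F]
      [seq cube (t l) | l <- enum 'I_n] _ 1 ltr01.
    by move=> _ /mapP[l _ ->]; exact: tuc.
  exists s; split=> // p q pq l; rewrite -rnorm_cubeB.
  apply: (H p q); last by apply: map_f; rewrite mem_enum.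
  by move=> f /LF fF; exact: pq.
(* [s * theta] is the distance to the walls guaranteed by [pigeonhole_shift] *)
pose theta : R := (2 * n%:R)^-1.
have theta0 : 0 < theta by rewrite invr_gt0 mulr_gt0.
have [L [d [d0 Lcube LP]]] := uniform_over_seq Fuc (mulr_gt0 s0 theta0).
have [U LU] := cubes_preimage_seq Lcube.
have [k kd] : exists k, k.+1%:R^-1 < d.
  have [k _ /(_ k (leqnn k))] := near_infty_natSinv_lt (PosNum d0).
  by exists k.
(* [P v] is an index whose cube coordinates [t l] are those of the grid point
   [v], of mesh [1 / k.+1]; the other coordinates that control [F] are set to 0
   so that they do not vary with [v]. *)
pose value (v : 'I_n -> nat) (u : set nat) : nat :=
  if [pick l | t l == u] is Some l then minn (v l) k.+1 else 0%N.
have valueE v l : value v (t l) = minn (v l) k.+1.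
  rewrite /value; case: pickP => [l' /eqP/tinj ->//|/(_ l)].
  by rewrite eqxx.
have /choice[P PE] : forall v, exists p, forall u, u \in U ++ map t (enum 'I_n) ->
    cube_value u p = (value v u)%:R / k.+1%:R :> R.
  move=> v; apply: (@cube_point R) => u; rewrite /value.
  by case: pickP => // l _; rewrite geq_minr.
have PtE v l : cube_value (t l) (P v) = (minn (v l) k.+1)%:R / k.+1%:R :> R.
  by rewrite PE ?valueE// mem_cat map_f ?orbT// mem_enum.
have cellP v w : in_cell v w -> close_on F (s * theta) (P v) (P w).
  move=> vw; apply: LP => f; rewrite LU => /mapP[u uU ->].
  rewrite rnorm_cubeB !PE ?mem_cat ?uU// -mulrBl normrM.
  apply: le_lt_trans kd; rewrite -[leRHS]mul1r.
  rewrite [X in _ * X]ger0_norm ?invr_ge0// ler_wpM2r ?invr_ge0//.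
  rewrite /value; case: pickP => [l _|_]; last by rewrite subrr normr0.
  have /andP[vl wl] := vw l.
  have : (minn (v l) k.+1 <= minn (w l) k.+1 <= (minn (v l) k.+1).+1)%N by lia.
  move: (minn (v l) _) (minn (w l) _) => a b /andP[ab ba].
  by rewrite distrC ger0_norm ?subr_ge0 ?ler_nat// lerBlDl natr1 ler_nat.
pose brick (c : 'I_n) v f : int := Num.floor (complex.Re (f (P v)) / s - c%:R / n%:R).
pose same c v w := forall f, f \in F -> brick c w f = brick c v f.
pose far c v := exists w : 'I_n -> nat, same c v w /\ (k.+1 <= w c)%N.
pose u c v : 'F_2 := if `[< far c v >] then 1 else 0.
have u0 c v : v c = 0%N -> u c v = 0.
  move=> vc; rewrite /u; case: asboolP => // -[w [vw wc]]; exfalso.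
  have : close_on F s (P w) (P v).
    move=> f fF; rewrite (rnorm_self_adjointB _ _ (Fsa f fF)).
    have := vw f fF; rewrite /brick; move: (complex.Re _) (complex.Re _) => a b E.
    have ab : `|a / s - b / s| < 1.
      have := ge_floor (a / s - c%:R / n%:R).
      have := lt_succ_floor (a / s - c%:R / n%:R).
      have := ge_floor (b / s - c%:R / n%:R).
      have := lt_succ_floor (b / s - c%:R / n%:R).
      rewrite -E !intrD !mulr1z ltr_norml => *; apply/andP; split; lra.
    rewrite distrC; have -> : a - b = s * (a / s - b / s) by field; rewrite gt_eqF.
    by rewrite normrM (gtr0_norm s0) gtr_pMr.
  move=> /sP /(_ c); rewrite !PtE vc min0n mul0r subr0 (minn_idPr wc).
  by rewrite divff ?pnatr_eq0// normr1 ltxx.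
have u1 c v : (k.+1 <= v c)%N -> u c v = 1.
  by move=> vc; rewrite /u asboolT//; exists v.
have [v vP] := kuhn u0 u1.
have [c cP] := pigeonhole_shift (fun f => complex.Re (f (P v)) / s) Fn.
have same_cell w : in_cell v w -> u c w = u c v.
  move=> /cellP vw; have bE : same c v w.
    move=> f fF; apply: (@eq_floor_far _ _ theta); first exact: cP.
    rewrite [X in `|X|](_ : _ =
      (complex.Re (f (P v)) - complex.Re (f (P w))) / s); last by ring.
    rewrite normrM -(rnorm_self_adjointB _ _ (Fsa f fF)).
    rewrite [X in _ * X]ger0_norm ?invr_ge0 ?(ltW s0)// ltr_pdivrMr// mulrC.
    exact: vw.
  rewrite /u; congr (if _ then _ else _); apply: asbool_equiv_eq.
  by split=> -[z [wz zc]]; exists z; split=> // f fF; rewrite wz// bE.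
have [w1 [w2 [vw1 vw2]]] := vP c.
by rewrite !same_cell// eqxx.
Qed.

End Dimension.

(** * Algebrability *)

Section InBoundedSequences.
Context {R : realType}.
Implicit Types (D : set (set nat)) (d n : nat).

Lemma card_le_or_gt (T : Type) (D : set T) n : D #<= `I_n \/ `I_n.+1 #<= D.
Proof.
have [/finite_setP[k Dk]|/infiniteP Dinf] := pselect (finite_set D).
  rewrite (card_le_eql Dk) (card_le_eqr Dk) !card_le_II.
  by have [] := leqP k n; [left|right].
by right; apply: card_le_trans Dinf; exact: card_leT.
Qed.

(** Finite generating sets are handled by dimension, infinite ones by counting
    the coordinates that control them. *)
Lemma cubes_need_card D : needs_card (@cube R @` D).
Proof.
move=> T _ Tsa TE; have Dind := @cubes_independent R D.
have [/finite_seqP[F0 TF0]|Tinf] := pselect (finite_set T); last first.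
  exact: infinite_generators.
pose F := undup F0; have TF : T = [set` F].
  by rewrite TF0; apply/seteqP; split=> f /=; rewrite mem_undup.
have FT : `I_(size F) #<= T.
  rewrite TF; apply: (@injection_card_le _ _ _ _ (nth 0 F)) => [i /= iF|i j iF jF].
    exact: mem_nth.
  by move/eqP; rewrite nth_uniq ?undup_uniq// => /eqP.
rewrite (card_le_eql (cubes_card D)).
have [DF|/(card_le_injection set0)[t [tD tinj]]] := card_le_or_gt D (size F).
  exact: card_le_trans DF FT.
suff : ((size F).+1 <= size F)%N by rewrite ltnn.
apply: (@invariance_of_dimension R _ (fun l => t (val l))) => [i j|f fF|f fF|l].
- by move/tinj => /(_ (ltn_ord i) (ltn_ord j))/val_inj.
- by apply: Tsa; rewrite TF.
- apply: (@uniform_overS _ (cube @` D)); first by apply: image_subset.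
  by apply: (same_closure_uniform_over TE); rewrite TF.
- rewrite -TF; apply: (same_closure_uniform_over (esym TE)).
  by exists (t (val l)) => //; apply: tD; exact: ltn_ord.
Qed.

Lemma block_algebrable d n : (0 < n)%N -> (n <= d)%N ->
  algebrable `I_d `I_n [set: linfty R] /\ Cstar_algebrable `I_d `I_n [set: linfty R].
Proof.
move=> n0 nd; have S0 : blocks (R := R) n d !=set0 by exists (block n d 0), 0%N.
have dimd := initial_seqs_dim (R := R) d.
split.
  apply: (independent_algebrable S0 (@blocks_self_adjoint R n d) _ _ _).1.
  - exact: blocks_independent.
  - exact: blocks_card.
  - by rewrite alg_span_blocks.
apply: (independent_Cstar_algebrable S0 (@blocks_self_adjoint R n d) _ _ _).1.
- exact: blocks_independent.
- exact: blocks_card.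
- by rewrite alg_span_blocks// initial_seqs_closed.
Qed.

Lemma block_genalgebrable d : (0 < d)%N ->
  genalgebrable `I_d `I_1 [set: linfty R] /\
  Cstar_genalgebrable `I_d `I_1 [set: linfty R].
Proof.
move=> d0; have S0 : blocks (R := R) 1 d !=set0 by exists (block 1 d 0), 0%N.
have dimd := initial_seqs_dim (R := R) d.
have need : needs_card (blocks (R := R) 1 d).
  move=> T [x Tx] _ _; rewrite (card_le_eql (blocks_card _ _))//.
  rewrite -(card_le_eql (card_set1 (x := x))).
  by apply: subset_card_le => _ ->.
split.
  apply: (independent_algebrable S0 (@blocks_self_adjoint R 1 d) _ _ _).2 need.
  - exact: blocks_independent.
  - exact: blocks_card.
  - by rewrite alg_span_blocks.
apply: (independent_Cstar_algebrable S0 (@blocks_self_adjoint R 1 d) _ _ _).2 need.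
- exact: blocks_independent.
- exact: blocks_card.
- by rewrite alg_span_blocks// initial_seqs_closed.
Qed.

Section Cardinal.
Variables (T : Type) (kappa : set T).

Lemma card_continuum_subset : kappa #<= continuum -> exists D, D #= kappa.
Proof.
move=> /(card_le_injection set0)[f [_ finj]]; exists (f @` kappa).
by apply: inj_card_eq => x y; rewrite !inE; exact: finj.
Qed.

Lemma card_eq_nonempty (U : Type) (D : set U) : `I_1 #<= kappa -> D #= kappa -> D !=set0.
Proof.
move=> k1 Dk; apply/set0P/eqP => D0.
move: Dk; rewrite D0 card_eq_sym card_eq0 => /eqP k0.
by move: k1; rewrite k0 card_le0 => /eqP I0; have : `I_1 0%N by []; rewrite I0.
Qed.

Lemma cube_Cstar_algebrable : `I_1 #<= kappa -> kappa #<= continuum ->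
  Cstar_genalgebrable continuum kappa [set: linfty R] /\
  Cstar_algebrable continuum kappa [set: linfty R].
Proof.
move=> k1 /card_continuum_subset[D Dk]; have D0 := card_eq_nonempty k1 Dk.
have S0 : @cube R @` D !=set0 by have [t Dt] := D0; exists (cube t), t.
have [alg gen] := independent_Cstar_algebrable S0 (@cubes_self_adjoint R D)
  (@cubes_independent R D) (card_eq_trans (cubes_card D) Dk) (cubes_closure_dim R D0).
by split=> //; apply: gen; exact: cubes_need_card.
Qed.

Lemma cube_algebrable : `I_1 #<= kappa -> kappa #<= aleph0 ->
  genalgebrable aleph0 kappa [set: linfty R] /\ algebrable aleph0 kappa [set: linfty R].
Proof.
move=> k1 kN; have Nc : aleph0 #<= continuum.
  apply: (@injection_card_le _ _ _ _ (fun n => [set n])) => // m n _ _ mn.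
  by have : [set n] m by rewrite -mn.
have [D Dk] := card_continuum_subset (card_le_trans kN Nc).
have D0 := card_eq_nonempty k1 Dk.
have S0 : @cube R @` D !=set0 by have [t Dt] := D0; exists (cube t), t.
have Dc : countable D by rewrite /countable (card_le_eql Dk).
have [alg gen] := independent_algebrable S0 (@cubes_self_adjoint R D)
  (@cubes_independent R D) (card_eq_trans (cubes_card D) Dk) (cubes_countable_dim D0 Dc).
by split=> //; apply: gen; exact: cubes_need_card.
Qed.

(** For an uncountable cardinality, counting settles finite and infinite
    generating sets alike, and cuts give the dimension at once. *)
Lemma chain_algebrable : card_lt aleph0 kappa -> kappa #<= continuum ->
  genalgebrable kappa kappa [set: linfty R] /\ algebrable kappa kappa [set: linfty R].
Proof.
move=> /andP[_ kN] /card_continuum_subset[C Ck].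
pose D := @ternary R @` C.
have Dk : D #= kappa.
  by apply: card_eq_trans Ck; apply: inj_card_eq => B B' _ _; exact: ternary_inj.
have Sk : @cut R @` D #= kappa := card_eq_trans (cuts_card D) Dk.
have Sunc : ~ countable (@cut R @` D).
  by rewrite /countable (card_le_eql Sk); exact/negP.
have S0 : @cut R @` D !=set0.
  by apply/set0P/eqP => S0; apply: Sunc; rewrite S0.
have Ddim : has_dim (alg_span (@cut R @` D)) kappa.
  have [E [Eind ES ED]] := cuts_dim D; exists E; split=> //.
  exact: card_eq_trans ED Dk.
have [alg gen] := independent_algebrable S0 (@cuts_self_adjoint R D)
  (@cuts_independent R D) Sk Ddim.
by split=> //; apply: gen; apply: uncountable_needs_card => //; exact: cuts_independent.
Qed.

End Cardinal.
End InBoundedSequences.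

Theorem corollary3p25 (R : realType) (A : cstarAlgType R) (M : set A)
    (hM : considered_set M) :
  (* (a) *)
  [/\ forall d : nat, (0 < d)%N ->
        genalgebrable `I_d `I_1 M /\ Cstar_genalgebrable `I_d `I_1 M,
      forall (T : Type) (kappa : set T),
        `I_1 #<= kappa -> kappa #<= continuum ->
        Cstar_genalgebrable continuum kappa M,
      forall (T : Type) (kappa : set T),
        `I_1 #<= kappa -> kappa #<= aleph0 ->
        genalgebrable aleph0 kappa M
    & forall (T : Type) (kappa : set T),
        card_lt aleph0 kappa -> kappa #<= continuum ->
        genalgebrable kappa kappa M] /\
  (* (b) *)
  [/\ forall d m n : nat, (0 < d)%N -> (0 < m)%N -> (0 < n)%N ->
        (m <= d)%N -> (n <= d)%N ->
        algebrable `I_d `I_n M /\ Cstar_algebrable `I_d `I_m M,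
      forall (T : Type) (kappa : set T),
        `I_1 #<= kappa -> kappa #<= continuum ->
        Cstar_algebrable continuum kappa M,
      forall (T : Type) (kappa : set T),
        `I_1 #<= kappa -> kappa #<= aleph0 ->
        algebrable aleph0 kappa M
    & forall (T : Type) (kappa : set T),
        card_lt aleph0 kappa -> kappa #<= continuum ->
        algebrable kappa kappa M].
Proof.
have [phi [phiL phiM phiS phiN phiR]] := considered_embedding hM.
have gen T U (a : set T) (b : set U) :=
  @genalgebrable_image R _ _ phi phiL phiM phiS phiN M phiR T U a b.
have alg T U (a : set T) (b : set U) :=
  @algebrable_image R _ _ phi phiL phiM phiS phiN M phiR T U a b.
have Cgen T U (a : set T) (b : set U) :=
  @Cstar_genalgebrable_image R _ _ phi phiL phiM phiS phiN M phiR T U a b.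
have Calg T U (a : set T) (b : set U) :=
  @Cstar_algebrable_image R _ _ phi phiL phiM phiS phiN M phiR T U a b.
split; split.
- by move=> d d0; have [g Cg] := @block_genalgebrable R d d0; split; [exact: gen|exact: Cgen].
- by move=> T kappa k1 kc; apply: Cgen; exact: (cube_Cstar_algebrable k1 kc).1.
- by move=> T kappa k1 kN; apply: gen; exact: (cube_algebrable k1 kN).1.
- by move=> T kappa k1 kc; apply: gen; exact: (chain_algebrable k1 kc).1.
- move=> d m n _ m0 n0 md nd; split.
    by apply: alg; exact: (block_algebrable n0 nd).1.
  by apply: Calg; exact: (block_algebrable m0 md).2.
- by move=> T kappa k1 kc; apply: Calg; exact: (cube_Cstar_algebrable k1 kc).2.
- by move=> T kappa k1 kN; apply: alg; exact: (cube_algebrable k1 kN).2.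
- by move=> T kappa k1 kc; apply: alg; exact: (chain_algebrable k1 kc).2.
Qed.
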